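(* Let $T\subset\mathbb{R}^3$ be a polyhedron and $k\ge3$ an integer. For the linear operator $R_h^{(3)}$, the $L^2$ projection $R_h^{(4)}$ from $L^2(T)$ onto $W_{k-3}^{(4)}(T)=P_{k-3}(T)$, and the weak divergence $\nabla_w\cdot: W_{k-2}^{(3)}(T)\to W_{k-3}^{(4)}(T)$, $$\nabla_w\cdot(R_h^{(3)}\mathbf{w})=R_h^{(4)}(\nabla\cdot\mathbf{w})\qquad\forall\mathbf{w}\in H(\mathrm{div};T)\cap[C(T)]^3.$$
   Context: Geometry and notation. $T\subset\mathbb{R}^3$ is a (closed, bounded) polyhedron with flat polygonal faces, each edge being shared by exactly two faces; $C(T)$ is the space of continuous functions on the closed region $T$. $F(T)$ is its set of faces. $P_j(D)$ is the space of polynomials of total degree at most $j$ on $D$. $(\cdot,\cdot)_D$ is the $L^2$ inner product on $D$. $\mathbf{n}$ is the unit outward normal on $\partial T$; $\mathbf{n}_f$ is a fixed unit normal to the face $f$. Spaces. $W_{k-2,0}^{(3)}(T)=[P_{k-2}(T)]^3$, $W_{k-3,f}^{(3)}(f)=\{w_f\mathbf{n}_f: w_f\in P_{k-3}(f)\}$, $W_{k-2}^{(3)}(T)=\{\mathbf{w}=\{\mathbf{w}_0,\mathbf{w}_f\}: \mathbf{w}_0\in W_{k-2,0}^{(3)}(T),\mathbf{w}_f\in W_{k-3,f}^{(3)}(f), f\in F(T)\}$, $W_{k-3}^{(4)}(T)=P_{k-3}(T)$. Weak divergence. For $\mathbf{w}=\{\mathbf{w}_0,\mathbf{w}_f\}\in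 W_{k-2}^{(3)}(T)$, $\nabla_w\cdot\mathbf{w}\in W_{k-3}^{(4)}(T)$ is determined by $$(\nabla_w\cdot\mathbf{w},\tau)_T=-(\mathbf{w}_0,\nabla\tau)_T+(\mathbf{w}_f,\tau\mathbf{n})_{\partial T}\quad\forall\tau\in W_{k-3}^{(4)}(T).$$ Projection. For $\mathbf{w}\in H(\mathrm{div};T)\cap[C(T)]^3$, $R_h^{(3)}\mathbf{w}=\{R_0^{(3)}\mathbf{w},\,R_f^{(3)}((\mathbf{w}|_f\cdot\mathbf{n}_f)\mathbf{n}_f)\}\in W_{k-2}^{(3)}(T)$, where $R_0^{(3)},R_f^{(3)}$ are the $L^2$ projections onto $W_{k-2,0}^{(3)}(T)$, $W_{k-3,f}^{(3)}(f)$. *)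

(* Defs.v *)
From HB Require Import structures.
From mathcomp Require Import all_boot all_order all_algebra.
From mathcomp Require Import all_classical all_reals all_analysis.
(* Not imported in full: the notations of mpoly clash with those of
   mathcomp-analysis. *)
From mathcomp Require mpoly.
Import (canonicals, coercions) mpoly.

Set Implicit Arguments.
Unset Strict Implicit.
Unset Printing Implicit Defensive.

Import Order.TTheory GRing.Theory Num.Theory.
Import numFieldNormedType.Exports.

Local Open Scope classical_set_scope.
Local Open Scope ring_scope.

(* Points of the plane and of space are tuples of reals, so that the product
   topology, the product sigma-algebra and the product measure apply. *)
Notation vec2 R := (R * R)%type.
Notation vec3 R := (R * R * R)%type.

Section vectors.
Context {R : realType}.

Definition coord2 (s : vec2 R) (i : 'I_2) : R := nth 0 [:: s.1; s.2] i.

Definition coord3 (x : vec3 R) (i : 'I_3) : R := nth 0 [:: x.1.1; x.1.2; x.2] i.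

Definition basis3 (i : nat) : vec3 R := ((i == 0)%:R, (i == 1)%:R, (i == 2)%:R).

Definition dot (x y : vec3 R) : R := \sum_(i < 3) coord3 x i * coord3 y i.

Definition segment {V : lmodType R} (a b : V) : set V :=
  [set a + t *: (b - a) | t in `[0, 1]%classic].

Definition mu2 := (@lebesgue_measure R \x @lebesgue_measure R)%E.

Definition mu3 := (mu2 \x @lebesgue_measure R)%E.

End vectors.

Section polyhedra.
Variable R : realType.

Record polygon := Polygon {
  pregion :> set (vec2 R) ;
  pedges : seq (vec2 R * vec2 R) ;
  polygon_closed : closed pregion ;
  polygon_bounded : bounded_set pregion ;
  polygon_nonempty : pregion !=set0 ;
  polygon_regular : closure (interior pregion) = pregion ;
  polygon_connected : connected (interior pregion) ;
  polygon_boundary : pregion `\` interior pregion =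
    [set s | exists2 e, e \in pedges & segment e.1 e.2 s] ;
  pedges_nondegenerate : forall e, e \in pedges -> e.1 != e.2 ;
  pedges_meet : forall e e' s, e \in pedges -> e' \in pedges -> e != e' ->
    segment e.1 e.2 s -> segment e'.1 e'.2 s ->
    (s \in [:: e.1; e.2]) && (s \in [:: e'.1; e'.2]) }.

(* A polygon placed in space: (fu, fv, fnormal) is an orthonormal frame and the
   planar point (s, t) is sent to forigin + s fu + t fv. This parametrization is
   an isometry, so it carries Lebesgue measure to surface measure. The fixed
   unit normal n_f is fnormal; it need not point outward. *)
Record face := Face {
  fpolygon : polygon ;
  forigin : vec3 R ;
  fu : vec3 R ;
  fv : vec3 R ;
  fnormal : vec3 R ;
  face_unit : [/\ dot fu fu = 1, dot fv fv = 1 & dot fnormal fnormal = 1] ;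
  face_orthogonal : [/\ dot fu fv = 0, dot fu fnormal = 0 & dot fv fnormal = 0] }.

Definition fpoint (f : face) (s : vec2 R) : vec3 R :=
  forigin f + s.1 *: fu f + s.2 *: fv f.

Definition fregion (f : face) : set (vec3 R) := fpoint f @` fpolygon f.

Definition frelint (f : face) : set (vec3 R) :=
  fpoint f @` interior (fpolygon f).

Definition fedge (f : face) : set (set (vec3 R)) :=
  [set E | exists2 e, e \in pedges (fpolygon f) &
    E = segment (fpoint f e.1) (fpoint f e.2)].

(* T is a regular closed set whose boundary is tiled by finitely many faces. *)
Record polyhedron := Polyhedron {
  tregion :> set (vec3 R) ;
  nfaces : nat ;
  tface : 'I_nfaces -> face ;
  polyhedron_closed : closed tregion ;
  polyhedron_bounded : bounded_set tregion ;
  polyhedron_nonempty : tregion !=set0 ;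
  polyhedron_regular : closure (interior tregion) = tregion ;
  polyhedron_boundary : tregion `\` interior tregion =
    \bigcup_i fregion (tface i) ;
  polyhedron_faces : forall i j, i != j ->
    frelint (tface i) `&` fregion (tface j) = set0 ;
  polyhedron_edges : forall i E, fedge (tface i) E ->
    exists! j, j != i /\ fedge (tface j) E }.

Arguments tface : clear implicits.

Definition is_outward_normal (T : polyhedron) (x nu : vec3 R) : Prop :=
  [/\ dot nu nu = 1,
      exists2 i, frelint (tface T i) x &
        dot nu (fu (tface T i)) = 0 /\ dot nu (fv (tface T i)) = 0 &
      exists2 e : R, 0 < e & forall t, 0 < t < e ->
        interior T (x - t *: nu) /\ ~ tregion T (x + t *: nu)].

(* The outward normal exists, uniquely, in the relative interior of the faces;
   it is 0 on the edges, which are negligible for surface measure. *)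
Definition outward_normal (T : polyhedron) (x : vec3 R) : vec3 R :=
  xget 0 (is_outward_normal T x).

End polyhedra.

Arguments tface {R} _ _.

Section function_spaces.
Context {R : realType}.

Definition grad (f : vec3 R -> R) (x : vec3 R) : vec3 R :=
  ('D_(basis3 0) f x, 'D_(basis3 1) f x, 'D_(basis3 2) f x).

Fixpoint Cn (n : nat) (f : vec3 R -> R) : Prop :=
  match n with
  | 0 => continuous f
  | m.+1 => continuous f /\ forall i : 'I_3,
      (forall x, derivable f x (basis3 i)) /\ Cn m (fun x => 'D_(basis3 i) f x)
  end.

(* Compactly supported smooth functions on the open set U. *)
Definition test_function (U : set (vec3 R)) (phi : vec3 R -> R) : Prop :=
  let supp := closure [set x | phi x != 0] in
  [/\ forall n, Cn n phi, compact supp & supp `<=` U].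

Definition L2 (D : set (vec3 R)) (f : vec3 R -> R) : Prop :=
  measurable_fun D f /\ mu3.-integrable D (fun x => ((f x) ^+ 2)%:E).

(* g is the divergence of w on D, in the sense of distributions. *)
Definition is_divergence (D : set (vec3 R)) (w : vec3 R -> vec3 R)
    (g : vec3 R -> R) : Prop :=
  L2 D g /\ forall phi, test_function (interior D) phi ->
    \int[mu3]_(x in D) (g x * phi x) = - \int[mu3]_(x in D) dot (w x) (grad phi x).

Definition Hdiv (D : set (vec3 R)) (w : vec3 R -> vec3 R) : Prop :=
  (forall i, L2 D (fun x => coord3 (w x) i)) /\ exists g, is_divergence D w g.

(* Determined up to a null subset of D. *)
Definition divergence (D : set (vec3 R)) (w : vec3 R -> vec3 R) : vec3 R -> R :=
  xget (cst 0) (is_divergence D w).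

(* msize is the total degree plus one, and 0 for the zero polynomial. *)
Definition Pdeg (n j : nat) : set (mpoly.mpoly n R) :=
  [set p | (mpoly.msize p <= j.+1)%N].

Definition ev2 (p : mpoly.mpoly 2 R) (s : vec2 R) : R :=
  mpoly.meval (coord2 s) p.

Definition ev3 (p : mpoly.mpoly 3 R) (x : vec3 R) : R :=
  mpoly.meval (coord3 x) p.

Definition evV (p : vec3 (mpoly.mpoly 3 R)) (x : vec3 R) : vec3 R :=
  (ev3 p.1.1 x, ev3 p.1.2 x, ev3 p.2 x).

End function_spaces.

Section weak_Galerkin.
Context {R : realType}.
Variables (T : polyhedron R) (k : nat).
Local Notation face_ i := (tface T i).

(* The sets being regular closed, polynomials are identified with their
   restrictions to T, or to a face. Polynomials on a face are polynomials in its
   planar coordinates; the total degree does not depend on the frame. *)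
Definition W30 : set (vec3 (mpoly.mpoly 3 R)) :=
  [set p | [/\ Pdeg (k - 2) p.1.1, Pdeg (k - 2) p.1.2 & Pdeg (k - 2) p.2]].

(* p stands for the vector field p n_f on the face f. *)
Definition W3f : set (mpoly.mpoly 2 R) := Pdeg (k - 3).

Definition W4 : set (mpoly.mpoly 3 R) := Pdeg (k - 3).

Definition normal_field (i : 'I_(nfaces T)) (p : mpoly.mpoly 2 R) (s : vec2 R) :
  vec3 R := ev2 p s *: fnormal (face_ i).

Record W3 := MkW3 {
  w0 : vec3 (mpoly.mpoly 3 R) ;
  wf : 'I_(nfaces T) -> mpoly.mpoly 2 R ;
  w0_in : W30 w0 ;
  wf_in : forall i, W3f (wf i) }.

(* (w_f, tau n) on the boundary of T, summed face by face. *)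
Definition boundary_ip (w : W3) (tau : mpoly.mpoly 3 R) : R :=
  \sum_i \int[mu2]_(s in fpolygon (face_ i))
    dot (normal_field i (wf w i) s)
        (ev3 tau (fpoint (face_ i) s) *:
           outward_normal T (fpoint (face_ i) s)).

Definition is_weak_div (w : W3) (d : mpoly.mpoly 3 R) : Prop :=
  W4 d /\ forall tau, W4 tau ->
    \int[mu3]_(x in T) (ev3 d x * ev3 tau x) =
    (- \int[mu3]_(x in T) dot (evV (w0 w) x) (grad (ev3 tau) x))
    + boundary_ip w tau.

(* Here and below, the polynomial selected by xget exists and is unique; the
   default value 0 is never used on the functions of the intended domain. *)
Definition weak_div (w : W3) : mpoly.mpoly 3 R := xget 0 (is_weak_div w).

Definition is_R0 (w : vec3 R -> vec3 R) (p : vec3 (mpoly.mpoly 3 R)) : Prop :=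
  W30 p /\ forall q, W30 q ->
    \int[mu3]_(x in T) dot (w x - evV p x) (evV q x) = 0.

Definition is_Rf (i : 'I_(nfaces T)) (w : vec3 R -> vec3 R)
    (p : mpoly.mpoly 2 R) : Prop :=
  W3f p /\ forall q, W3f q ->
    \int[mu2]_(s in fpolygon (face_ i))
      dot (w (fpoint (face_ i) s) - normal_field i p s) (normal_field i q s) = 0.

Definition R0 (w : vec3 R -> vec3 R) : vec3 (mpoly.mpoly 3 R) :=
  xget 0 (is_R0 w).

Definition Rf (i : 'I_(nfaces T)) (w : vec3 R -> vec3 R) : mpoly.mpoly 2 R :=
  xget 0 (is_Rf i w).

Lemma R0_in (w : vec3 R -> vec3 R) : W30 (R0 w).
Proof.
rewrite /R0; case: xgetP => [p _ []//|_]; rewrite /W30 /Pdeg /=.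
by rewrite mpoly.msize0.
Qed.

Lemma Rf_in (i : 'I_(nfaces T)) (w : vec3 R -> vec3 R) : W3f (Rf i w).
Proof.
by rewrite /Rf; case: xgetP => [p _ []//|_]; rewrite /W3f /Pdeg /= mpoly.msize0.
Qed.

Definition normal_part (i : 'I_(nfaces T)) (w : vec3 R -> vec3 R)
  (x : vec3 R) : vec3 R := dot (w x) (fnormal (face_ i)) *: fnormal (face_ i).

Definition Rh3 (w : vec3 R -> vec3 R) : W3 :=
  @MkW3 (R0 w) (fun i => Rf i (normal_part i w))
    (R0_in w) (fun i => Rf_in i (normal_part i w)).

Definition is_Rh4 (g : vec3 R -> R) (p : mpoly.mpoly 3 R) : Prop :=
  W4 p /\ forall q, W4 q ->
    \int[mu3]_(x in T) ((g x - ev3 p x) * ev3 q x) = 0.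

Definition Rh4 (g : vec3 R -> R) : mpoly.mpoly 3 R := xget 0 (is_Rh4 g).

End weak_Galerkin.

(* Main.v *)
(* The divergence of w is only known against test functions supported inside T.
   The point is to extend this to Green's formula
     int_T (div w) eta + int_T w . grad eta = sum_f sigma_f int_f eta (w . n_f)
   for polynomials eta, where sigma_f = 1 or -1 tells on which side of the face f
   the polyhedron lies; the sign is constant because the interior of a polygon is
   connected.  If eta has degree at most k - 3, then grad eta is in [P_(k-2)]^3
   and eta restricts to P_(k-3) on each face, so w may be replaced by its
   projections on the left and on the right, and the weak divergence of R_h w and
   the projection of div w solve the same variational problem.

   Green's formula is local.  If eta is supported near a relative interior point
   of a face, multiply it by a step function of the distance to the face, with a
   layer of width 1/m: the gradient of the step concentrates on the face, where
   the continuity of w gives the flux.  A partition of unity yields the formula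
   for eta supported away from the edges.  Finally the edges have vanishing
   capacity: there are cutoffs that vanish near the edges and tend to 1
   elsewhere, whose gradients tend to 0 in L^1, while w is bounded. *)

Require Import Defs.
From HB Require Import structures.
From mathcomp Require Import all_boot all_order all_algebra.
From mathcomp Require Import all_classical all_reals all_analysis.
From mathcomp Require Import measurable_realfun ring lra.
From mathcomp Require mpoly.
Import (canonicals, coercions) mpoly.

Set Implicit Arguments.
Unset Strict Implicit.
Unset Printing Implicit Defensive.

Import Order.TTheory GRing.Theory Num.Theory.
Import numFieldNormedType.Exports.

Local Open Scope classical_set_scope.
Local Open Scope ring_scope.

(** * Invariance of Lebesgue measure under isometries *)

(** Continuity of [w] gives pointwise traces but no derivatives, so every derivative stays on a
    smooth scalar factor and [w] enters only through its values on [T]. Green's formula is proved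
    for an arbitrary continuous field [W] with an integrable distributional divergence [G], and in
    the end only for [eta = 1]: the polynomial [tau] is absorbed by taking [W = tau w] and
    [G = tau div w + w . grad tau], which leaves [eta] free to be a cutoff. The layer argument uses
    Fubini in coordinates adapted to a slanted face, hence the invariance of Lebesgue measure under
    rotations, which is derived from translation invariance. Faces and edges differ by codimension:
    a cutoff at distance [1/m] has a gradient of order [m], carried by a volume of order [1/m]
    around a face and [1/m^2] around an edge. The first product stays of order 1 and leaves the
    flux; the second tends to 0. *)

Section preserves.
Context {R : realType}.

(** Invariance is phrased with integrals of nonnegative functions instead of measures of sets: this
    form passes through Tonelli for products and composes directly. *)
Definition preserves d (T : measurableType d) (m : {measure set T -> \bar R})
    (phi : T -> T) :=
  measurable_fun setT phi /\
  forall f : T -> \bar R, measurable_fun setT f -> (forall x, (0 <= f x)%E) ->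
    (\int[m]_x f (phi x) = \int[m]_x f x)%E.

(** The pushforward by a translation gives every half-open interval its length, and this
    characterizes Lebesgue measure. *)
Lemma preserves_shift (a : R) :
  preserves (@lebesgue_measure R) (fun x : R => x + a).
Proof.
set phi : measurableTypeR R -> measurableTypeR R := fun x : R => x + a.
have mphi : measurable_fun setT phi.
  apply: continuous_measurable_fun => x.
  by apply: cvgD; [exact: cvg_id|exact: cvg_cst].
split=> // f mf f0.
have E A : measurable A ->
    lebesgue_measure A = pushforward (@lebesgue_measure R) phi A.
  apply: (lebesgue_measure_unique (mu := pushforward _ _ )).
  move=> _ [[x y] _ <-]; rewrite /pushforward /=.
  rewrite [X in _ = lebesgue_measure X](_ : _ = `]x - a, y - a]%classic); last first.
    by apply/seteqP; split=> z /=; rewrite /phi /= !in_itv /=; lra.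
  rewrite !lebesgue_measure_itv /= !lte_fin ltrD2r.
  by case: ifP => //= _; rewrite -!EFinD; congr EFin; lra.
transitivity (\int[pushforward (@lebesgue_measure R) phi]_x f x)%E.
  by rewrite (ge0_integral_pushforward mphi).
by apply: eq_measure_integral => A mA _; exact: (esym (E A mA)).
Qed.

Lemma preserves_prod d1 d2 (T1 : measurableType d1) (T2 : measurableType d2)
    (m1 : {sigma_finite_measure set T1 -> \bar R})
    (m2 : {sigma_finite_measure set T2 -> \bar R}) phi1 phi2 :
  preserves m1 phi1 -> preserves m2 phi2 ->
  preserves (m1 \x m2)%E (fun z => (phi1 z.1, phi2 z.2)).
Proof.
move=> [mp1 p1] [mp2 p2].
have mphi : measurable_fun setT (fun z : T1 * T2 => (phi1 z.1, phi2 z.2)).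
  apply/measurable_fun_pairP; split=> /=.
    exact: (measurableT_comp mp1 measurable_fst).
  exact: (measurableT_comp mp2 measurable_snd).
split=> // f mf f0.
rewrite [RHS]fubini_tonelli1 //.
rewrite [LHS]fubini_tonelli1 //; last exact: (measurableT_comp mf mphi).
have mF : measurable_fun setT (fun x => \int[m2]_y f (x, y))%E.
  exact: measurable_fun_fubini_tonelli_F.
rewrite -(p1 (fun x => \int[m2]_y f (x, y))%E) //; last first.
  by move=> x; apply: integral_ge0.
apply: eq_integral => x _ /=.
rewrite -(p2 (fun y => f (phi1 x, y))) //.
exact: measurableT_comp.
Qed.

End preserves.

(** Lets [mu2] and [mu3] be declared sigma-finite, so that the product theorems apply to products
    having one of them as a factor. *)
Lemma product_sigma_finite {R : realType} d1 d2 (T1 : measurableType d1)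
    (T2 : measurableType d2) (m1 : {sigma_finite_measure set T1 -> \bar R})
    (m2 : {sigma_finite_measure set T2 -> \bar R}) :
  sigma_finite setT (m1 \x m2)%E.
Proof.
have /sigma_finiteP[F [TF ndF Foo]] := sigma_finiteT m1.
have /sigma_finiteP[G [TG ndG Goo]] := sigma_finiteT m2.
exists (fun n => F n `*` G n).
  rewrite -setXTT TF TG; apply/seteqP; split=> [[x y] /= [[n _ Fnx] [k _ Gky]]|].
    exists (maxn n k) => //; split.
      by move: x Fnx; exact/subsetPset/ndF/leq_maxl.
    by move: y Gky; exact/subsetPset/ndG/leq_maxr.
  by move=> [x y] [n _ []/= ? ?]; split; exists n.
move=> k; have [? ?] := Foo k; have [? ?] := Goo k.
split; first exact: measurableX.
by rewrite product_measure1E// lte_mul_pinfty// ge0_fin_numE.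
Qed.

HB.instance Definition _ (R : realType) := Measure.copy (@mu2 R)
  (@lebesgue_measure R \x @lebesgue_measure R)%E.
HB.instance Definition _ (R : realType) := @Measure_isSigmaFinite.Build _ _ _
  (@mu2 R) (product_sigma_finite (@lebesgue_measure R) (@lebesgue_measure R)).
HB.instance Definition _ (R : realType) := Measure.copy (@mu3 R)
  (@mu2 R \x @lebesgue_measure R)%E.
HB.instance Definition _ (R : realType) := @Measure_isSigmaFinite.Build _ _ _
  (@mu3 R) (product_sigma_finite (@mu2 R) (@lebesgue_measure R)).

Section translations.
Context {R : realType}.

Lemma preserves_mu2 (a : vec2 R) : preserves (@mu2 R) (fun x : vec2 R => x + a).
Proof. exact: (preserves_prod (preserves_shift a.1) (preserves_shift a.2)). Qed.

Lemma preserves_mu3 (a : vec3 R) : preserves (@mu3 R) (fun x : vec3 R => x + a).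
Proof. exact: (preserves_prod (preserves_mu2 a.1) (preserves_shift a.2)). Qed.

End translations.

(* mu2 and mu3 are built on measurableTypeR, a structure on R other than the one
   found by default. *)
Notation vec2m R := (measurableTypeR R * measurableTypeR R)%type.
Notation vec3m R := (measurableTypeR R * measurableTypeR R * measurableTypeR R)%type.

(** * Borel measurability in the plane and in space *)

Section open_measurable.
Context {R : realType}.

(** An open set is the union of the balls it contains whose centre lies in the countable dense
    family [D] and whose radius is rational. The family [M] is abstract so that one proof serves
    both dimensions. *)
Lemma open_sigma (T : pseudoMetricType R) (I : countType) (D : I -> T)
    (M : set (set T)) :
  (forall x (e : R), 0 < e -> exists i, ball x e (D i)) ->
  (forall i (e : R), M (ball (D i) e)) ->
  M set0 -> (forall F : (set T)^nat, (forall n, M (F n)) -> M (\bigcup_n F n)) ->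
  forall A, open A -> M A.
Proof.
move=> dD mD m0 mU A oA.
pose F n := if unpickle n : option (I * rat) is Some (i, r) then
  if `[< ball (D i) (ratr r : R) `<=` A >] then ball (D i) (ratr r) else set0
  else set0.
have -> : A = \bigcup_n F n.
  apply/seteqP; split=> x; last first.
    move=> [n _]; rewrite /F; case: unpickle => [[i r]|//].
    by case: ifPn => // /asboolP; exact.
  move: oA; rewrite openE => /[apply] /nbhs_ballP[e /= e0 xeA].
  (* A radius below [e / 2] makes the ball around the nearby centre [D i] contain [x] and stay
     inside [ball x e]. *)
  have /rat_in_itvoo[r] : 0 < e / 2 by rewrite divr_gt0.
  rewrite in_itv /= => /andP[r0 re].
  have [i xi] := dD x _ r0.
  exists (pickle (i, r)) => //; rewrite /F pickleK; case: ifPn => [_|/asboolP].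
    exact: ball_sym.
  case=> y iy; apply: xeA; apply: (@le_ball _ _ _ (ratr r + ratr r)); first lra.
  exact: (ball_triangle xi).
apply: mU => n; rewrite /F; case: unpickle => [[i r]|//].
by case: ifPn.
Qed.

Let ball_rat (x e : R) : 0 < e -> exists q : rat, ball x e (ratr q : R).
Proof.
move=> e0; have /rat_in_itvoo[q] : x < x + e by lra.
rewrite in_itv /= => /andP[xq qx]; exists q.
by rewrite /ball /= ltr_norml; lra.
Qed.

Lemma open_measurable2 (A : set (vec2 R)) :
  open A -> @measurable _ (vec2m R) A.
Proof.
apply: (@open_sigma _ (rat * rat)%type
  (fun q => (ratr q.1 : R, ratr q.2 : R)) (@measurable _ (vec2m R))).
- move=> [x y] e e0; have [q ?] := ball_rat x e0; have [q' ?] := ball_rat y e0.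
  by exists (q, q').
- move=> i e; rewrite (_ : ball _ _ = ball (ratr i.1 : R) e `*` ball (ratr i.2 : R) e) //.
  by apply: measurableX; exact: measurable_ball.
- exact: measurable0.
- by move=> F mF; exact: bigcupT_measurable.
Qed.

Lemma open_measurable3 (A : set (vec3 R)) :
  open A -> @measurable _ (vec3m R) A.
Proof.
apply: (@open_sigma _ (rat * rat * rat)%type
  (fun q => (ratr q.1.1 : R, ratr q.1.2 : R, ratr q.2 : R)) (@measurable _ (vec3m R))).
- move=> [[x y] z] e e0; have [q ?] := ball_rat x e0.
  have [q' ?] := ball_rat y e0; have [q'' ?] := ball_rat z e0.
  by exists (q, q', q'').
- move=> i e; rewrite (_ : ball _ _ = ball (ratr i.1.1 : R) e `*`
    ball (ratr i.1.2 : R) e `*` ball (ratr i.2 : R) e) //.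
  by apply: measurableX; [apply: measurableX|]; exact: measurable_ball.
- exact: measurable0.
- by move=> F mF; exact: bigcupT_measurable.
Qed.

Lemma closed_measurable2 (A : set (vec2 R)) :
  closed A -> @measurable _ (vec2m R) A.
Proof. by move=> /closed_openC /open_measurable2 /measurableC; rewrite setCK. Qed.

Lemma closed_measurable3 (A : set (vec3 R)) :
  closed A -> @measurable _ (vec3m R) A.
Proof. by move=> /closed_openC /open_measurable3 /measurableC; rewrite setCK. Qed.

(** The map [h] is the identity in both uses; it separates the topological structure of its target
    from the measurable structure of its source. *)
Lemma within_continuous_measurable d (T : topologicalType) (T' : measurableType d)
    (h : T' -> T) (A : set T) (f : T -> R) :
  (forall B, open B -> measurable (h @^-1` B)) ->
  closed A -> {within A, continuous f} ->
  measurable_fun (h @^-1` A) (f \o h).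
Proof.
move=> hm cA cf; apply: (measurability _ (RGenOpens.measurableE R)).
move=> _ [B [a [b BE]] <-]; rewrite BE.
have oB : open (f @^-1` `]a, b[ : set (subspace A)).
  by move/continuousP: cf; apply; exact: interval_open.
have [U oU UE] := (open_subspaceP _ _).1 oB.
have -> : h @^-1` A `&` (f \o h) @^-1` `]a, b[ = h @^-1` A `&` h @^-1` U.
  apply/seteqP; split=> x /= [Ax].
    move=> fx; have : (U `&` A) (h x) by rewrite UE.
    by case.
  by move=> Ux; have : (U `&` A) (h x) by []; rewrite UE => -[].
apply: measurableI; last exact: hm.
by have := measurableC (hm _ (closed_openC cA)); rewrite -preimage_setC setCK.
Qed.

Lemma continuous_measurable2 (A : set (vec2 R)) (f : vec2 R -> R) :
  closed A -> {within A, continuous f} ->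
  @measurable_fun _ _ (vec2m R) _ A f.
Proof.
move=> cA cf; have := @within_continuous_measurable _ _ (vec2m R) id A f.
by apply=> // B; exact: open_measurable2.
Qed.

Lemma continuous_measurable3 (A : set (vec3 R)) (f : vec3 R -> R) :
  closed A -> {within A, continuous f} ->
  @measurable_fun _ _ (vec3m R) _ A f.
Proof.
move=> cA cf; have := @within_continuous_measurable _ _ (vec3m R) id A f.
by apply=> // B; exact: open_measurable3.
Qed.

End open_measurable.

(** * Invariance under orthogonal maps *)

Section orthogonal.
Context {R : realType}.
Implicit Types (x y z u v n : vec3 R).

Lemma dotE x y : dot x y = x.1.1 * y.1.1 + x.1.2 * y.1.2 + x.2 * y.2.
Proof. by rewrite /dot !big_ord_recr big_ord0 /= add0r. Qed.

Lemma vecD1 x y : (x + y).1.1 = x.1.1 + y.1.1. Proof. by case: x => [[? ?] ?]. Qed.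
Lemma vecD2 x y : (x + y).1.2 = x.1.2 + y.1.2. Proof. by case: x => [[? ?] ?]. Qed.
Lemma vecD3 x y : (x + y).2 = x.2 + y.2. Proof. by case: x => [[? ?] ?]. Qed.
Lemma vecN1 x : (- x).1.1 = - x.1.1. Proof. by case: x => [[? ?] ?]. Qed.
Lemma vecN2 x : (- x).1.2 = - x.1.2. Proof. by case: x => [[? ?] ?]. Qed.
Lemma vecN3 x : (- x).2 = - x.2. Proof. by case: x => [[? ?] ?]. Qed.
Lemma vecZ1 (a : R) x : (a *: x).1.1 = a * x.1.1. Proof. by case: x => [[? ?] ?]. Qed.
Lemma vecZ2 (a : R) x : (a *: x).1.2 = a * x.1.2. Proof. by case: x => [[? ?] ?]. Qed.
Lemma vecZ3 (a : R) x : (a *: x).2 = a * x.2. Proof. by case: x => [[? ?] ?]. Qed.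
Definition vecE := (vecD1, vecD2, vecD3, vecN1, vecN2, vecN3, vecZ1, vecZ2, vecZ3).

Lemma dotC x y : dot x y = dot y x.
Proof. by rewrite !dotE; ring. Qed.

Lemma dotDl x y z : dot (x + y) z = dot x z + dot y z.
Proof. by rewrite !dotE ?vecE /=; ring. Qed.

Lemma dotZl (a : R) x y : dot (a *: x) y = a * dot x y.
Proof. by rewrite !dotE ?vecE /=; ring. Qed.

Lemma dotNl x y : dot (- x) y = - dot x y.
Proof. by rewrite !dotE ?vecE /=; ring. Qed.

Lemma dotDr x y z : dot z (x + y) = dot z x + dot z y.
Proof. by rewrite !dotE ?vecE /=; ring. Qed.

Lemma dotZr (a : R) x y : dot y (a *: x) = a * dot y x.
Proof. by rewrite !dotE ?vecE /=; ring. Qed.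

Lemma dotBl x y z : dot (x - y) z = dot x z - dot y z.
Proof. by rewrite !dotE ?vecE /=; ring. Qed.

Lemma dot0l x : dot 0 x = 0.
Proof. by rewrite !dotE ?vecE /=; ring. Qed.

Lemma continuous_coord3 (i : 'I_3) : continuous (fun x => coord3 x i).
Proof.
case: i => -[|[|[|//]]] i3 [[a b] c]; rewrite /coord3 /=.
- apply: (@cvg_comp _ _ _ (fst : vec3 R -> _) fst); exact: cvg_fst.
- apply: (@cvg_comp _ _ _ (fst : vec3 R -> _) snd); [exact: cvg_fst|exact: cvg_snd].
- exact: cvg_snd.
Qed.

Lemma continuous_x1 : continuous (fun x => x.1.1).
Proof. exact: (@continuous_coord3 ord0). Qed.

Lemma continuous_x2 : continuous (fun x => x.1.2).
Proof. exact: (@continuous_coord3 (Ordinal (isT : 1 < 3)%N)). Qed.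

Lemma continuous_x3 : continuous (fun x => x.2).
Proof. exact: (@continuous_coord3 ord_max). Qed.

Lemma within_continuous_dot (D : set (vec3 R)) (f g : vec3 R -> vec3 R) :
  {within D, continuous f} -> {within D, continuous g} ->
  {within D, continuous (fun x => dot (f x) (g x))}.
Proof.
move=> cf cg.
have cp (p : vec3 R -> R) (h : vec3 R -> vec3 R) : continuous p ->
    {within D, continuous h} -> {within D, continuous (p \o h)}.
  by move=> cp ch x; exact: (@continuous_comp (subspace D) _ _ h p x (ch x) (cp _)).
rewrite (_ : (fun x => _) = ((fun y => y.1.1) \o f) \* ((fun y => y.1.1) \o g) \+
  ((fun y => y.1.2) \o f) \* ((fun y => y.1.2) \o g) \+
  ((fun y => y.2) \o f) \* ((fun y => y.2) \o g)); last first.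
  by apply/funext => x /=; rewrite dotE.
have [c1 [c2 c3]] := (continuous_x1, (continuous_x2, continuous_x3)).
move=> x; apply: continuousD; first apply: continuousD.
- by apply: continuousM; exact: cp.
- by apply: continuousM; exact: cp.
- by apply: continuousM; exact: cp.
Qed.

Lemma continuous_dot (f g : vec3 R -> vec3 R) :
  continuous f -> continuous g -> continuous (fun x => dot (f x) (g x)).
Proof.
move=> /continuous_subspace_setT cf /continuous_subspace_setT cg.
exact/continuous_subspace_setT/within_continuous_dot.
Qed.

Lemma measurable_vec3 d (T : measurableType d) (h : T -> vec3 R) :
  (forall i, measurable_fun setT (fun t => coord3 (h t) i)) ->
  measurable_fun setT (h : T -> vec3m R).
Proof.
move=> mh.
have m0 : measurable_fun setT (fun t => (h t).1.1) := mh ord0.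
have m1 : measurable_fun setT (fun t => (h t).1.2) := mh (Ordinal (isT : 1 < 3)%N).
have m2 : measurable_fun setT (fun t => (h t).2) := mh ord_max.
apply/measurable_fun_pairP; split => //.
by apply/measurable_fun_pairP; split.
Qed.

Lemma measurable_coord3 (i : 'I_3) :
  measurable_fun setT ((fun x => coord3 x i) : vec3m R -> R).
Proof.
by apply: continuous_measurable3 => //; exact/continuous_subspaceT/continuous_coord3.
Qed.

(** Balls are those of the maximum norm, hence squares here and cubes in space, of side [2 r]. *)
Lemma mu2_ball (x : vec2 R) (r : R) : 0 <= r -> mu2 (ball x r) = ((r *+ 2) ^+ 2)%:E.
Proof.
move=> r0.
transitivity (lebesgue_measure (ball x.1 r) * lebesgue_measure (ball x.2 r))%E.
  by apply: product_measure1E; exact: measurable_ball.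
by rewrite !lebesgue_measure_ball// -!EFinM; congr EFin; ring.
Qed.

Lemma mu3_ball x (r : R) : 0 <= r -> mu3 (ball x r) = ((r *+ 2) ^+ 3)%:E.
Proof.
move=> r0.
transitivity (mu2 (ball x.1 r) * lebesgue_measure (ball x.2 r))%E.
  apply: product_measure1E; last exact: measurable_ball.
  by apply: (@measurableX _ _ _ _ (ball x.1.1 r) (ball x.1.2 r)); exact: measurable_ball.
by rewrite mu2_ball// !lebesgue_measure_ball// -!EFinM; congr EFin; ring.
Qed.

(** The Euclidean unit ball, which orthogonal maps preserve, unlike the cubes [ball]. Its measure
    gets cancelled at the end, so it must be positive and finite. *)
Let Q : set (vec3 R) := [set x | dot x x <= 1].

Let mQ : @measurable _ (vec3m R) Q.
Proof.
apply: closed_measurable3; rewrite (_ : Q = (fun x => dot x x) @^-1` [set t | t <= 1]) //.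
apply: preimage_closed; last exact: closed_le.
by move=> x _; apply: (@continuous_dot id id) => ?; exact: cvg_id.
Qed.

Let Q_gt0 : (0 < mu3 Q)%E.
Proof.
apply: (@lt_le_trans _ _ (mu3 (ball (0 : vec3 R) 2^-1))).
  by rewrite mu3_ball// lte_fin exprn_gt0.
apply: le_measure; rewrite ?inE //; first exact: open_measurable3 (ball_open _ _).
move=> [[a b] c] [[]]; rewrite /ball /= !sub0r !normrN => ha hb hc.
rewrite /Q /= dotE /=.
have sq (t : R) : `|t| < 2^-1 -> t * t <= 4^-1.
  by rewrite ltr_norml => /andP[? ?]; nra.
move: (sq _ ha) (sq _ hb) (sq _ hc); lra.
Qed.

Let Q_ltoo : (mu3 Q < +oo)%E.
Proof.
apply: (@le_lt_trans _ _ (mu3 (ball (0 : vec3 R) 2))); last first.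
  by rewrite mu3_ball// ltry.
apply: le_measure; rewrite ?inE //; first exact: open_measurable3 (ball_open _ _).
move=> [[a b] c]; rewrite /Q /= dotE /= => h.
have sq (t : R) : t * t <= 1 -> `|t| < 2 by move=> ?; rewrite ltr_norml; nra.
by split; [split|]; rewrite /ball /= sub0r normrN; apply: sq; nra.
Qed.

(* Both sides of the Tonelli exchange in
   int int 1_Q(x) f(x + A y) dx dy
   are computed by translation invariance: A preserves the unit ball Q. *)
Lemma preserves_orthogonal (A B : vec3 R -> vec3 R) :
  measurable_fun setT (A : vec3m R -> vec3m R) ->
  (forall x y, A (x + y) = A x + A y) -> cancel B A ->
  (forall x, dot (A x) (A x) = dot x x) ->
  preserves (@mu3 R) A.
Proof.
move=> mA AD BK AQ; split=> // f mf f0.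
have A0 : A 0 = 0 by apply: (addrI (A 0)); rewrite -AD !addr0.
have AN x : A (- x) = - A x.
  by apply: (addrI (A x)); rewrite -AD !subrr.
pose q x : \bar R := (\1_Q x)%:E.
have mq : measurable_fun setT (q : vec3m R -> _).
  by apply/measurable_EFinP; exact: measurable_indic.
have q0 x : (0 <= q x)%E by rewrite lee_fin.
(* [x - A y] is [A (B x - y)], and [A] preserves the Euclidean norm. *)
have qE x y : q (x - A y) = q (y - B x).
  rewrite /q !indicE !/Q; congr (_ _)%:E; congr (nat_of_bool _).
  have E : dot (B x - y) (B x - y) = dot (y - B x) (y - B x).
    by rewrite !dotE !vecE; ring.
  by rewrite -{1}(BK x) -AN -AD; apply/idP/idP; rewrite !inE /= AQ E.
have intq : (\int[mu3]_x q x = mu3 Q)%E by rewrite integral_indic// setIT.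
pose g (z : vec3m R * vec3m R) : \bar R := (q z.1 * f ((z.1 : vec3 R) + A z.2)%R)%E.
pose g' (z : vec3m R * vec3m R) : \bar R := (q ((z.1 : vec3 R) - A z.2)%R * f z.1)%E.
have mc i : measurable_fun setT ((fun x => coord3 x i) : vec3m R -> R) := measurable_coord3 i.
have m1 (i : 'I_3) : measurable_fun setT (fun z : vec3m R * vec3m R => coord3 z.1 i).
  by apply: (measurableT_comp (mc i)); exact: measurable_fst.
have m2 (i : 'I_3) : measurable_fun setT (fun z : vec3m R * vec3m R => coord3 (A z.2) i).
  apply: (measurableT_comp (mc i)); apply: (measurableT_comp mA).
  exact: measurable_snd.
have cD x y i : coord3 (x + y) i = coord3 x i + coord3 y i.
  by case: i => -[|[|[|//]]] ?; rewrite /coord3 /= ?vecE.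
have cN x i : coord3 (- x) i = - coord3 x i.
  by case: i => -[|[|[|//]]] ?; rewrite /coord3 /= ?vecE.
pose hD (z : vec3m R * vec3m R) : vec3 R := (z.1 : vec3 R) + A z.2.
pose hB (z : vec3m R * vec3m R) : vec3 R := (z.1 : vec3 R) - A z.2.
have mD : measurable_fun setT (hD : _ -> vec3m R).
  apply: measurable_vec3 => i.
  by under eq_fun do rewrite /hD cD; exact: measurable_funD.
have mB : measurable_fun setT (hB : _ -> vec3m R).
  apply: measurable_vec3 => i.
  by under eq_fun do rewrite /hB cD cN; exact: measurable_funB.
have mg : measurable_fun setT g.
  apply: emeasurable_funM; last exact: (measurableT_comp mf mD).
  exact: (measurableT_comp mq measurable_fst).
have mg' : measurable_fun setT g'.
  apply: emeasurable_funM; first exact: (measurableT_comp mq mB).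
  exact: (measurableT_comp mf measurable_fst).
have g0 t : (0 <= g t)%E by exact: mule_ge0.
have g'0 t : (0 <= g' t)%E by exact: mule_ge0.
have mfA : measurable_fun setT (f \o A : vec3m R -> _) := measurableT_comp mf mA.
have E1 : (\int[mu3]_x \int[mu3]_y g (x, y) =
    mu3 Q * \int[mu3]_y f (A y))%E.
  transitivity (\int[mu3]_x (q x * \int[mu3]_y f (A y)))%E.
    apply: eq_integral => x _; rewrite /g /= ge0_integralZl//; last first.
      by apply: (measurableT_comp mf); exact: (measurableT_comp mD (pair1_measurable x)).
    congr (_ * _)%E.
    rewrite -((preserves_mu3 (B x)).2 (f \o A) mfA (fun y => f0 (A y))).
    by apply: eq_integral => y _ /=; rewrite AD BK addrC.
  by rewrite ge0_integralZr ?intq //; exact: integral_ge0.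
have E2 : (\int[mu3]_y \int[mu3]_x g' (x, y) = mu3 Q * \int[mu3]_y f y)%E.
  rewrite -(fubini_tonelli _ mg' g'0).
  transitivity (\int[mu3]_x (mu3 Q * f x))%E; last by rewrite ge0_integralZl.
  apply: eq_integral => x _; rewrite /g' /= ge0_integralZr//; last first.
    by apply: (measurableT_comp mq); exact: (measurableT_comp mB (pair1_measurable x)).
  congr (_ * _)%E; rewrite -intq.
  rewrite -((preserves_mu3 (- B x)).2 q mq q0).
  by apply: eq_integral => y _ /=; rewrite qE.
(* For fixed [y], translating [x] by [- A y] turns [g] into [g']. *)
have E3 : (\int[mu3]_x \int[mu3]_y g (x, y) = \int[mu3]_y \int[mu3]_x g' (x, y))%E.
  rewrite (fubini_tonelli _ mg g0); apply: eq_integral => y _.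
  have mgy : measurable_fun setT (fun x => g (x, y)).
    by apply: measurableT_comp.
  rewrite -((preserves_mu3 (- A y)).2 _ mgy (fun x => g0 _)).
  by apply: eq_integral => x _; rewrite /g /g' /= subrK.
move: E3; rewrite E1 E2 => /(congr1 (fun t => (fine (mu3 Q))^-1%:E * t)%E).
have Qfin : mu3 Q \is a fin_num by rewrite ge0_fin_numE.
have Q0 : fine (mu3 Q) != 0 by rewrite gt_eqF// fine_gt0// Q_gt0.
have Qe := esym (fineK Qfin); rewrite /= Qe !muleA -EFinM mulVf//.
by rewrite !mul1e.
Qed.

End orthogonal.

Section preserves_integral.
Context {R : realType} d (T : measurableType d) (m : {measure set T -> \bar R}).
Variable phi : T -> T.
Hypothesis pphi : preserves m phi.

Lemma preserves_integral (f : T -> \bar R) : measurable_fun setT f ->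
  (\int[m]_x f (phi x) = \int[m]_x f x)%E.
Proof.
move=> mf; rewrite [in LHS]integralE [in RHS]integralE.
congr (_ - _)%E.
  have mp : measurable_fun setT (f^\+)%E by exact: measurable_funepos.
  rewrite -(pphi.2 _ mp) //; apply: eq_integral => x _; by rewrite !funeposE.
have mp : measurable_fun setT (f^\-)%E by exact: measurable_funeneg.
by rewrite -(pphi.2 _ mp) //; apply: eq_integral => x _; rewrite !funenegE.
Qed.

Lemma preserves_Rintegral (f : T -> R) : measurable_fun setT f ->
  \int[m]_x f (phi x) = \int[m]_x f x.
Proof.
move=> mf; congr fine; apply: (preserves_integral (f := EFin \o f)).
exact/measurable_EFinP.
Qed.

Lemma preserves_integrable (f : T -> \bar R) :
  m.-integrable setT f -> m.-integrable setT (f \o phi).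
Proof.
move=> /integrableP[mf foo]; apply/integrableP; split.
  exact: (measurableT_comp mf pphi.1).
have mf' : measurable_fun setT (abse \o f) by exact: measurableT_comp.
by rewrite (pphi.2 (abse \o f) mf' (fun x => abse_ge0 _)).
Qed.

Lemma preserves_measure (A : set T) : measurable A ->
  m (phi @^-1` A) = m A.
Proof.
move=> mA; have mpA : measurable (phi @^-1` A).
  by rewrite -[_ @^-1` _]setTI; exact: pphi.1.
have mi : measurable_fun setT (EFin \o \1_A : T -> \bar R).
  by apply/measurable_EFinP; exact: measurable_indic.
have i0 x : (0 <= (EFin \o (\1_A : T -> R)) x)%E by rewrite lee_fin.
have e B : measurable B -> (\int[m]_x (EFin \o \1_B) x = m B)%E.
  by move=> mB; rewrite integral_indic// setIT.
rewrite -(e _ mA) -(e _ mpA) -(pphi.2 _ mi i0).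
by apply: eq_integral => x _; rewrite /= !indicE.
Qed.

End preserves_integral.

(** * Coordinates adapted to a face *)

Section frame.
Context {R : realType}.
Implicit Types (f : face R) (x y z : vec3 R) (s : vec2 R).

Lemma vec3P x y : x.1.1 = y.1.1 -> x.1.2 = y.1.2 -> x.2 = y.2 -> x = y.
Proof. by case: x y => [[? ?] ?] [[? ?] ?] /= -> -> ->. Qed.

(** Orthonormality says [M *m M^T = 1], where the rows of [M] are the three vectors. For a square
    matrix this gives [M^T *m M = 1], and [x] multiplied by the latter is the expansion. *)
Lemma orthonormal_expansion (u v n x : vec3 R) :
  [/\ dot u u = 1, dot v v = 1 & dot n n = 1] ->
  [/\ dot u v = 0, dot u n = 0 & dot v n = 0] ->
  x = dot x u *: u + dot x v *: v + dot x n *: n.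
Proof.
move=> [uu vv nn] [uv un vn].
pose b (i : 'I_3) := nth 0 [:: u; v; n] i.
pose M := \matrix_(i < 3, j < 3) coord3 (b i) j.
have MM : M *m M^T = 1%:M.
  apply/matrixP => i j; rewrite !mxE.
  rewrite (eq_bigr (fun k => coord3 (b i) k * coord3 (b j) k)); last first.
    by move=> k _; rewrite !mxE.
  rewrite -/(dot (b i) (b j)).
  by case: i j => -[|[|[|//]]] ? [[|[|[|//]]] ?]; rewrite /b /= // dotC.
have := congr1 (fun A => \row_j coord3 x j *m A) (mulmx1C MM).
rewrite mulmx1 mulmxA => /rowP E.
have e k : coord3 x k = \sum_i dot x (b i) * coord3 (b i) k.
  have := E k; rewrite !mxE => <-; apply: eq_bigr => i _; rewrite !mxE.
  by congr (_ * _); apply: eq_bigr => j _; rewrite !mxE.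
have ext (a c : vec3 R) : (forall k, coord3 a k = coord3 c k) -> a = c.
  case: a c => [[a1 a2] a3] [[c1 c2] c3] h.
  by have := (h ord0, h (Ordinal (isT : 1 < 3)%N), h ord_max);
    rewrite /coord3 /= => -[[-> ->] ->].
apply: ext => k; rewrite e !big_ord_recr big_ord0 /= add0r.
by case: k => -[|[|[|//]]] ? ; rewrite /coord3 /b /= ?vecE.
Qed.

(** The isometry that flattens a face: the plane of the face becomes third coordinate 0, and the
    third coordinate is the signed distance to it. Fubini in these coordinates links volume
    integrals to surface integrals. *)
Definition frame_point f z : vec3 R :=
  forigin f + z.1.1 *: fu f + z.1.2 *: fv f + z.2 *: fnormal f.

Definition frame_coord f x : vec3 R :=
  (dot (x - forigin f) (fu f), dot (x - forigin f) (fv f),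
   dot (x - forigin f) (fnormal f)).

Lemma fpointE f s : fpoint f s = frame_point f (s, 0).
Proof. by rewrite /frame_point scale0r addr0. Qed.

Lemma frame_coordK f : cancel (frame_coord f) (frame_point f).
Proof.
move=> x; rewrite /frame_point /frame_coord /=.
have := orthonormal_expansion (x - forigin f) (face_unit f) (face_orthogonal f).
by rewrite -!addrA => <-; rewrite addrC subrK.
Qed.

Lemma frame_pointK f : cancel (frame_point f) (frame_coord f).
Proof.
move=> [[a b] c]; rewrite /frame_point /frame_coord /=.
have [uu vv nn] := face_unit f; have [uv un vn] := face_orthogonal f.
have -> (o x y z : vec3 R) : o + x + y + z - o = x + y + z.
  by rewrite addrC !addrA addNr add0r.
congr (_, _, _); rewrite !dotDl !dotZl.
- by rewrite uu (dotC (fv f)) uv (dotC (fnormal f)) un; ring.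
- by rewrite uv vv (dotC (fnormal f)) vn; ring.
- by rewrite un vn nn; ring.
Qed.

Let frame_lin f z := z.1.1 *: fu f + z.1.2 *: fv f + z.2 *: fnormal f.

Lemma continuous_frame_point f : continuous (frame_point f).
Proof.
have [c1 [c2 c3]] := (@continuous_x1 R, (@continuous_x2 R, @continuous_x3 R)).
move=> z; rewrite /frame_point.
apply: cvgD; [apply: cvgD; [apply: cvgD|]|].
- exact: cvg_cst.
- by apply: cvgZr_tmp; exact: c1.
- by apply: cvgZr_tmp; exact: c2.
- by apply: cvgZr_tmp; exact: c3.
Qed.

Lemma preserves_frame f : preserves (@mu3 R) (frame_point f).
Proof.
have [uu vv nn] := face_unit f; have [uv un vn] := face_orthogonal f.
have mlin : measurable_fun setT (frame_lin f : vec3m R -> vec3m R).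
  apply: measurable_vec3 => i.
  apply: continuous_measurable3 => //; apply/continuous_subspaceT.
  rewrite (_ : (fun t => _) = (fun t => dot (frame_lin f t) (basis3 i))).
    apply: continuous_dot => x; last exact: cvg_cst.
    have [c1 [c2 c3]] := (@continuous_x1 R, (@continuous_x2 R, @continuous_x3 R)).
    apply: cvgD; [apply: cvgD|].
    - by apply: cvgZr_tmp; exact: c1.
    - by apply: cvgZr_tmp; exact: c2.
    - by apply: cvgZr_tmp; exact: c3.
  apply/funext => t; rewrite dotE /basis3; case: i => -[|[|[|//]]] ?; rewrite /coord3 /=;
  by rewrite ?mulr1 ?mulr0 ?addr0 ?add0r.
have plin : preserves (@mu3 R) (frame_lin f).
  apply: (preserves_orthogonal (B := fun x => (dot x (fu f), dot x (fv f), dot x (fnormal f)))).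
  - exact: mlin.
  - by move=> x y; apply: vec3P; rewrite /frame_lin !vecE; ring.
  - move=> x; rewrite /frame_lin /=.
    by rewrite -(orthonormal_expansion x (face_unit f) (face_orthogonal f)).
  - move=> x; rewrite /frame_lin !dotDl !dotDr !dotZl !dotZr.
    rewrite uu vv nn uv un vn (dotC (fv f)) uv !(dotC (fnormal f)) un vn dotE; ring.
have psh := preserves_mu3 (forigin f).
have E x : frame_point f x = frame_lin f x + forigin f.
  by rewrite /frame_point /frame_lin [RHS]addrC !addrA.
split.
  rewrite (_ : frame_point f = (fun x => x + forigin f) \o frame_lin f).
    exact: (measurableT_comp psh.1 plin.1).
  exact/funext.
move=> g mg g0; rewrite -(psh.2 g mg g0) -(plin.2 _ (measurableT_comp mg psh.1)).
  by apply: eq_integral => x _; rewrite E.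
by move=> x; exact: g0.
Qed.

(** In the frame coordinates this is the product of the whole plane with one point, and an infinite
    measure times 0 is 0. *)
Lemma plane_null f : mu3 [set x | dot (x - forigin f) (fnormal f) = 0] = 0%E.
Proof.
set P := [set x | _].
have mP : @measurable _ (vec3m R) P.
  apply: closed_measurable3.
  apply: (preimage_closed (f := fun x => dot (x - forigin f) (fnormal f)) (D := [set t | t = 0])).
    move=> x _; apply: (continuous_dot (f := fun x => x - forigin f)) => ?.
      by apply: cvgB; [exact: cvg_id|exact: cvg_cst].
    exact: cvg_cst.
  exact: closed_eq.
rewrite -(preserves_measure (preserves_frame f) mP).
transitivity (mu2 setT * lebesgue_measure [set (0%R : R)])%E.
  rewrite -[LHS]/(mu3 _) (_ : _ @^-1` _ = (setT : set (vec2m R)) `*` [set (0%R : R)]).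
    by apply: product_measure1E.
  apply/seteqP; split=> z; rewrite /P /=.
    move=> h; split=> //; have := frame_pointK f z.
    by rewrite /frame_coord h; case: z {h} => [[a b] c] [].
  move=> [_ z0]; have := frame_pointK f z; rewrite /frame_coord.
  by rewrite [in RHS](surjective_pairing z) z0 => -[].
by rewrite lebesgue_measure_set1 mule0.
Qed.

End frame.

(** * Smooth functions and cutoffs *)

Section flat.
Context {R : realType}.
Implicit Types (p : {poly R}) (x : R).

(* The derivatives of exp(-1/x), extended by 0 to x <= 0, all have this form. *)
Definition flat p x : R := if 0 < x then p.[x^-1] * expR (- x^-1) else 0.

Lemma flat_le0 p x : x <= 0 -> flat p x = 0.
Proof. by rewrite /flat ltNge => ->. Qed.

(** With [y = 1/x >= 1], the polynomial is at most [A * y ^+ size p] while [expR y] dominates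
    [y ^+ (size p + 2)] up to a factorial. The two spare powers give [x ^+ 2], so the difference
    quotient at 0 vanishes in the limit. *)
Lemma flat_bound p : exists2 C : R, 0 <= C &
  forall x, 0 < x < 1 -> `|flat p x| <= C * x ^+ 2.
Proof.
pose A := \sum_(i < size p) `|p`_i|.
have A0 : 0 <= A by exact: sumr_ge0.
pose n := (size p).+1.
exists (A * n.+1`!%:R); first by rewrite mulr_ge0.
move=> x /andP[x0 x1]; rewrite /flat x0 normrM (gtr0_norm (expR_gt0 _)) expRN.
set y := x^-1.
have y1 : 1 <= y by rewrite /y invf_ge1 ?ltW.
have y0 : 0 < y by rewrite (lt_le_trans _ y1).
have py : `|p.[y]| <= A * y ^+ (size p).
  rewrite horner_coef mulr_suml; apply: (le_trans (ler_norm_sum _ _ _)).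
  apply: ler_sum => i _; rewrite normrM ler_wpM2l// normrX (gtr0_norm y0).
  by apply: ler_weXn2l => //; exact: ltnW (ltn_ord i).
have ey : y ^+ n.+1 / n.+1`!%:R <= expR y.
  by apply: le_trans (expR_ge1Dxn n (ltW y0)); rewrite lerDr.
have f0 : 0 < n.+1`!%:R :> R by rewrite ltr0n fact_gt0.
have yn0 : 0 < y ^+ n.+1 by rewrite exprn_gt0.
apply: (le_trans (ler_pM _ _ py _ (y2 := n.+1`!%:R / y ^+ n.+1))) => //.
  by rewrite -invf_div lef_pV2 // posrE ?expR_gt0 // divr_gt0.
rewrite /n !exprS le_eqVlt; apply/orP; left; apply/eqP.
have -> : x = y^-1 by rewrite /y invrK.
by field; rewrite ?expf_neq0 ?gt_eqF.
Qed.

(** The [flat] functions are closed under derivation: away from 0 by the chain rule, the factor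
    [1/x^2] becoming ['X^2]; at 0 by [flat_bound]. *)
Lemma is_derive_flat p x :
  is_derive x 1 (flat p) (flat ('X^2 * (p - p^`())) x).
Proof.
have [x0|x0|->] := ltgtP x 0.
- rewrite (flat_le0 _ (ltW x0)).
  apply: (near_eq_is_derive (f := cst 0)) (is_derive_cst _ _ _).
  near=> z; rewrite flat_le0//; apply: ltW; near: z.
  exact: lt_nbhsl.
- pose g (y : R) := p.[y^-1] * expR (- y^-1).
  have xn0 : x != 0 by rewrite gt_eqF.
  apply: (near_eq_is_derive (f := g)).
    near=> z; rewrite /flat /g ifT//; near: z; exact: lt_nbhsr.
  have dV : is_derive x 1 (fun y : R => y^-1) (- x ^- 2).
    have := @is_deriveV _ id x 1 1 xn0 (is_derive_id _ _).
    by rewrite /= [_%:A]mulr1.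
  have dPV : is_derive x 1 (fun y => p.[y^-1]) (p^`().[x^-1] * - x ^- 2).
    exact: (is_derive1_comp (f := horner p) (g := fun y => y^-1)).
  have dE : is_derive x 1 (fun y => expR (- y^-1)) (expR (- x^-1) * x ^- 2).
    have dN : is_derive x 1 (fun y : R => - y^-1) (x ^- 2).
      by rewrite -[x ^- 2]opprK; exact: is_deriveN.
    exact: (is_derive1_comp (f := expR) (g := fun y => - y^-1)).
  have := is_deriveM dPV dE.
  rewrite /flat x0 hornerM hornerXn hornerD hornerN /= => h.
  apply: (is_derive_eq h); rewrite /GRing.scale /= exprVn; ring.
- rewrite flat_le0//.
  have [C C0 hC] := flat_bound p.
  have L : (fun h : R => h^-1 *: ((flat p \o shift 0) (h *: 1) - flat p 0)) @ 0^' --> (0 : R).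
    apply/cvgrPdist_lt => e e0.
    near=> h; rewrite /= sub0r normrN addr0 [h *: 1]mulr1 (flat_le0 p (lexx 0)) subr0.
    have hn0 : h != 0 by near: h; exact: nbhs_dnbhs_neq.
    have [h0|h0] := leP h 0; first by rewrite (flat_le0 _ h0) scaler0 normr0.
    have h1 : h < 1.
      near: h; apply: nbhs_dnbhs; exact: lt_nbhsl.
    have he : h < e / (C + 1).
      near: h; apply: nbhs_dnbhs; apply: lt_nbhsl; rewrite divr_gt0//; lra.
    rewrite normrZ normfV (gtr0_norm h0).
    apply: (@le_lt_trans _ _ (C * h)).
      rewrite ler_pdivrMl// (le_trans (hC h _)) ?h0//.
      by rewrite expr2 mulrCA.
    apply: (@le_lt_trans _ _ (h * (C + 1))); first by nra.
    by rewrite -ltr_pdivlMr//; lra.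
  apply: DeriveDef; last exact: cvg_lim L.
  by apply/cvg_ex; exists 0.
Unshelve. all: by end_near. Qed.

End flat.

Section Cn_theory.
Context {R : realType}.
Implicit Types (f g : vec3 R -> R) (x v : vec3 R).

Lemma derive_line f x v : 'D_v f x = 'D_1 (fun h : R => f (h *: v + x)) (0 : R).
Proof.
rewrite /derive; set g1 := fun h : R => h^-1 *: _; set g2 := fun h : R => h^-1 *: _.
suff -> : g1 = g2 by [].
by apply/funext => h; rewrite /g1 /g2 /= addr0 scale0r add0r [_%:A]mulr1.
Qed.

Lemma is_derive_line f x v (df : R) :
  is_derive (0 : R) 1 (fun h : R => f (h *: v + x)) df -> is_derive x v f df.
Proof.
move=> [dv <-]; rewrite -derive_line; constructor.
  exact: ((derivable1P f x v).2 dv).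
by [].
Qed.

Lemma line_is_derive f x v (df : R) :
  is_derive x v f df -> is_derive (0 : R) 1 (fun h : R => f (h *: v + x)) df.
Proof.
move=> [dv <-]; rewrite derive_line; constructor.
  exact: ((derivable1P f x v).1 dv).
by [].
Qed.

Lemma is_derive_mulr (a t : R) : is_derive t 1 (fun h : R => h * a) a.
Proof.
have := @is_deriveM _ _ id (cst a) t 1 1 0 (is_derive_id _ _) (is_derive_cst _ _ _).
by rewrite scaler0 add0r [_%:A]mulr1.
Qed.

Lemma is_derive_comp_dot (t : R -> R) (dt : R) (a : vec3 R) (c : R) x v :
  is_derive (dot a x + c) 1 t dt ->
  is_derive x v (fun y => t (dot a y + c)) (dot a v * dt).
Proof.
move=> tdt; apply: is_derive_line.
have L : is_derive (0 : R) 1 (fun h : R => h * dot a v + (dot a x + c)) (dot a v).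
  have L1 := is_derive_mulr (dot a v) (0 : R).
  by have := is_deriveD L1 (is_derive_cst (dot a x + c) (0 : R) 1); rewrite addr0.
rewrite (_ : (fun h : R => _) = t \o (fun h : R => h * dot a v + (dot a x + c))).
  by rewrite mulrC; apply: is_derive1_comp; rewrite mul0r add0r.
by apply/funext => h /=; rewrite dotDr dotZr addrA.
Qed.

Lemma CnS n f : Cn n.+1 f -> Cn n f.
Proof.
elim: n f => [f []//|n IHn f [cf Df]]; split=> // i.
by have [df Dfi] := Df i; split=> //; apply: IHn.
Qed.

Lemma Cn_continuous n f : Cn n f -> continuous f.
Proof. by case: n => [|n] // []. Qed.

Lemma Cn_derivable n f x (i : 'I_3) : Cn n.+1 f -> derivable f x (basis3 i).
Proof. by case=> _ /(_ i)[]. Qed.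

Arguments Cn_derivable [n f] x i.

Lemma Cn_derive n f (i : 'I_3) : Cn n.+1 f -> Cn n (fun x => 'D_(basis3 i) f x).
Proof. by case=> _ /(_ i)[]. Qed.

Lemma CnSI n f (d : 'I_3 -> vec3 R -> R) : continuous f ->
  (forall (i : 'I_3) x, is_derive x (basis3 i) f (d i x)) -> (forall i, Cn n (d i)) ->
  Cn n.+1 f.
Proof.
move=> cf dfd Cd; split=> // i; split=> [x|]; first by case: (dfd i x).
rewrite (_ : (fun x => _) = d i) //.
by apply/funext => x; case: (dfd i x).
Qed.

Arguments Cn_derive [n f] i.

Lemma Cn_cst n (c : R) : Cn n (fun=> c).
Proof.
elim: n c => [c|n IHn c]; first exact: cst_continuous.
apply: (@CnSI _ _ (fun _ _ => 0)).
- exact: cst_continuous.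
- by move=> i; exact: IHn.
Qed.

Lemma CnD n f g : Cn n f -> Cn n g -> Cn n (fun x => f x + g x).
Proof.
elim: n f g => [f g cf cg|n IHn f g Cf Cg].
  by move=> x; apply: cvgD; [exact: cf|exact: cg].
apply: (@CnSI _ _ (fun (i : 'I_3) x => 'D_(basis3 i) f x + 'D_(basis3 i) g x)).
- by move=> x; apply: cvgD; [exact: (Cn_continuous Cf)|exact: (Cn_continuous Cg)].
- move=> i x; apply: is_deriveD; apply: derivableP.
    exact: (Cn_derivable x i Cf).
  exact: (Cn_derivable x i Cg).
- by move=> i; apply: IHn; [exact: (Cn_derive i Cf)|exact: (Cn_derive i Cg)].
Qed.

Lemma CnM n f g : Cn n f -> Cn n g -> Cn n (fun x => f x * g x).
Proof.
elim: n f g => [f g cf cg|n IHn f g Cf Cg].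
  by move=> x; apply: cvgM; [exact: cf|exact: cg].
apply: (@CnSI _ _ (fun (i : 'I_3) x => f x * 'D_(basis3 i) g x + g x * 'D_(basis3 i) f x)).
- by move=> x; apply: cvgM; [exact: (Cn_continuous Cf)|exact: (Cn_continuous Cg)].
- move=> i x; apply: is_deriveM; apply: derivableP.
    exact: (Cn_derivable x i Cf).
  exact: (Cn_derivable x i Cg).
- move=> i; apply: CnD; apply: IHn.
  + exact: (CnS Cf).
  + exact: (Cn_derive i Cg).
  + exact: (CnS Cg).
  + exact: (Cn_derive i Cf).
Qed.

Lemma CnB n f g : Cn n f -> Cn n g -> Cn n (fun x => f x - g x).
Proof.
move=> Cf Cg; have := CnD Cf (CnM (Cn_cst n (-1)) Cg).
by congr (Cn n); apply/funext => x; rewrite mulN1r.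
Qed.

Lemma CnV n f : (forall x, f x != 0) -> Cn n f -> Cn n (fun x => (f x)^-1).
Proof.
move=> f0; elim: n => [cf x|n IHn Cf].
  by apply: cvgV => //; exact: cf.
apply: (@CnSI _ _ (fun (i : 'I_3) x => - ((f x)^-1 * (f x)^-1) * 'D_(basis3 i) f x)).
- by move=> x; apply: cvgV => //; exact: (Cn_continuous Cf).
- move=> i x; have df := Cn_derivable x i Cf.
  apply: DeriveDef; first exact: derivableV.
  by rewrite deriveV// /GRing.scale /= expr2 invfM.
- move=> i; apply: CnM; last exact: (Cn_derive i Cf).
  rewrite (_ : (fun x => _) = (fun x => 0 - (f x)^-1 * (f x)^-1)).
    by apply: CnB; [exact: Cn_cst|apply: CnM; apply: IHn; exact: (CnS Cf)].
  by apply/funext => x; rewrite sub0r.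
Qed.

(** The sequence [d] lists the successive derivatives of a function of one variable. Differentiating
    along a basis vector shifts [d] by one, so the induction treats all the [d k] together. *)
Lemma Cn_comp_dot (d : nat -> R -> R) (a : vec3 R) (c : R) n :
  (forall k (t : R), is_derive t 1 (d k) (d k.+1 t)) ->
  Cn n (fun x => d 0%N (dot a x + c)).
Proof.
move=> dd.
have cl k : continuous (fun x => d k (dot a x + c)).
  move=> x; apply: (@continuous_comp _ _ _ (fun x => dot a x + c) (d k)).
    apply: cvgD; last exact: cvg_cst.
    by apply: continuous_dot => y; [exact: cvg_cst|exact: cvg_id].
  by apply/differentiable_continuous/derivable1_diffP; case: (dd k (dot a x + c)).
suff : forall k, Cn n (fun x => d k (dot a x + c)) by [].
elim: n => [|n IHn] k; first exact: cl.
apply: (@CnSI _ _ (fun (i : 'I_3) x => dot a (basis3 i) * d k.+1 (dot a x + c))) => //.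
  by move=> i x; apply: is_derive_comp_dot; exact: dd.
by move=> i; apply: CnM; [exact: Cn_cst|exact: IHn].
Qed.

Lemma is_derive_scale_shift f (r : R) (c x v : vec3 R) (df : R) :
  is_derive (r *: (x - c)) v f df ->
  is_derive x v (fun y : vec3 R => f (r *: (y - c))) (r * df).
Proof.
move=> /line_is_derive fdf; apply: is_derive_line.
rewrite (_ : (fun h : R => _) = (fun h => f (h *: v + r *: (x - c))) \o (fun h => h * r)).
  rewrite mulrC; apply: is_derive1_comp; first by rewrite mul0r.
  exact: is_derive_mulr.
by apply/funext => h /=; rewrite -addrA scalerDr scalerA mulrC.
Qed.

Lemma Cn_scale_shift f (r : R) (c : vec3 R) n :
  Cn n f -> Cn n (fun y : vec3 R => f (r *: (y - c))).
Proof.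
have cs g : continuous g -> continuous (fun y : vec3 R => g (r *: (y - c))).
  move=> cg x; apply: (@continuous_comp _ _ _ (fun y : vec3 R => r *: (y - c)) g); last exact: cg.
  by apply: cvgZl_tmp; apply: cvgB; [exact: cvg_id|exact: cvg_cst].
elim: n f => [f cf|n IHn f Cf]; first exact: cs.
apply: (@CnSI _ _ (fun (i : 'I_3) x => r * 'D_(basis3 i) f (r *: (x - c)))).
- exact/cs/(Cn_continuous Cf).
- move=> i x; apply: is_derive_scale_shift; apply/derivableP.
  exact: (Cn_derivable _ _ Cf).
- move=> i; apply: CnM; first exact: Cn_cst.
  exact: (IHn (fun x => 'D_(basis3 i) f x) (Cn_derive i Cf)).
Qed.

End Cn_theory.

Section step.
Context {R : realType}.
Implicit Types (t : R).

(** The standard smooth transition from 0 to 1 over the unit interval; the two terms of the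
    denominator never vanish together. *)
Definition step t : R := flat 1 t / (flat 1 t + flat 1 (1 - t)).

Let dflat t : R := flat ('X^2 * (1 - 1^`())) t.

Definition dstep t : R :=
  let D := flat 1 t + flat 1 (1 - t) in
  (dflat t * D - flat 1 t * (dflat t - dflat (1 - t))) / D ^+ 2.

Let flat1_gt0 t : 0 < t -> 0 < flat 1 t.
Proof. by move=> t0; rewrite /flat t0 hornerC mul1r expR_gt0. Qed.

Let flat1_ge0 t : 0 <= flat 1 t.
Proof.
have [/flat_le0->//|/flat1_gt0/ltW//] := leP t 0.
Qed.

Let D_gt0 t : 0 < flat 1 t + flat 1 (1 - t).
Proof.
have [t0|t0] := leP t 0.
  by rewrite ltr_wpDl// flat1_gt0//; lra.
by rewrite ltr_wpDr// flat1_gt0.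
Qed.

Lemma step_ge0 t : 0 <= step t.
Proof. by rewrite divr_ge0// ltW. Qed.

Lemma step_le1 t : step t <= 1.
Proof. by rewrite ler_pdivrMr// mul1r lerDl. Qed.

Lemma step_0 t : t <= 0 -> step t = 0.
Proof. by move=> t0; rewrite /step flat_le0// mul0r. Qed.

Lemma step_1 t : 1 <= t -> step t = 1.
Proof.
move=> t1; rewrite /step [X in _ + X]flat_le0; last by lra.
by rewrite addr0 divff// gt_eqF// flat1_gt0//; lra.
Qed.

Lemma dstep_0 t : t <= 0 -> dstep t = 0.
Proof. by move=> t0; rewrite /dstep /dflat !(flat_le0 _ t0) !mul0r subrr mul0r. Qed.

Lemma dstep_1 t : 1 <= t -> dstep t = 0.
Proof.
move=> t1; have t0 : 1 - t <= 0 by lra.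
by rewrite /dstep /dflat !(flat_le0 _ t0) addr0 subr0 [X in X - _]mulrC subrr mul0r.
Qed.

Let dflatP t : is_derive t 1 (flat 1 : R -> R) (dflat t).
Proof. exact: is_derive_flat. Qed.

Let dflat1P t : is_derive t 1 (fun t => flat 1 (1 - t) : R) (- dflat (1 - t)).
Proof.
have -> : - dflat (1 - t) = dflat (1 - t) * (- 1) by rewrite mulrN1.
have d1 := is_deriveB (is_derive_cst (1 : R) t 1) (is_derive_id t 1).
rewrite sub0r in d1.
exact: (is_derive1_comp (f := flat 1) (g := fun t => 1 - t) (dflatP (1 - t)) d1).
Qed.

Lemma is_derive_step t : is_derive t 1 step (dstep t).
Proof.
have D0 := D_gt0 t.
have dD := is_deriveD (dflatP t) (dflat1P t).
have Dn0 : flat 1 t + flat 1 (1 - t) != 0 by rewrite gt_eqF.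
have dV : is_derive t 1 (fun t => (flat 1 t + flat 1 (1 - t))^-1 : R)
    (- (flat 1 t + flat 1 (1 - t)) ^- 2 * (dflat t - dflat (1 - t))).
  exact: (@is_deriveV _ _ t _ 1 Dn0 dD).
have h : is_derive t 1 step (flat 1 t * (- (flat 1 t + flat 1 (1 - t)) ^- 2 *
    (dflat t - dflat (1 - t))) + (flat 1 t + flat 1 (1 - t))^-1 * dflat t).
  exact: (is_deriveM (dflatP t) dV).
apply: (is_derive_eq h); rewrite /dstep.
move: (flat 1 t) (flat 1 (1 - t)) (dflat t) (dflat (1 - t)) Dn0 => a b c d.
by move=> Dn0; field.
Qed.

Let cflat p : continuous (flat p : R -> R).
Proof.
move=> t; apply/differentiable_continuous/derivable1_diffP.
by case: (is_derive_flat p t).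
Qed.

Lemma continuous_dstep : continuous dstep.
Proof.
have c1 p : continuous (fun t => flat p (1 - t)).
  move=> t; apply: (@continuous_comp _ _ _ (fun t => 1 - t) (flat p)); last exact: cflat.
  by apply: cvgB; [exact: cvg_cst|exact: cvg_id].
have cD : continuous (fun t : R => flat 1 t + flat 1 (1 - t)).
  by move=> t; apply: cvgD; [exact: cflat|exact: c1].
move=> t; rewrite /dstep /=; apply: cvgM.
  apply: cvgB; apply: cvgM; [exact: cflat|exact: cD|exact: cflat|].
  by apply: cvgB; [exact: cflat|exact: c1].
apply: cvgV; first by rewrite expf_neq0// gt_eqF.
by rewrite expr2; apply: cvgM; exact: cD.
Qed.

Lemma dstep_bounded : exists2 M : R, 0 <= M & forall t, `|dstep t| <= M.
Proof.
have [M [_ hM]] := compact_bounded (continuous_compact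
  (continuous_subspaceT continuous_dstep) (@segment_compact R 0 1)).
exists (`|M| + 1) => [|t]; first by rewrite addr_ge0.
have [t0|t0] := leP t 0; first by rewrite dstep_0// normr0 addr_ge0.
have [t1|t1] := leP 1 t; first by rewrite dstep_1// normr0 addr_ge0.
apply: hM; first by rewrite (le_lt_trans (ler_norm _))// ltrDl.
by exists t => //; rewrite /= in_itv /= !ltW.
Qed.

Lemma Cn_step_dot n (a : vec3 R) (c : R) : Cn n (fun x => step (dot a x + c)).
Proof.
have fl (a' : vec3 R) c' : Cn n (fun x => flat 1 (dot a' x + c')).
  (* The successive derivatives of [flat 1], by iterating the operator of [is_derive_flat]. *)
  pose d k : R -> R := flat (iter k (fun p => 'X^2 * (p - p^`())) 1).
  by apply: (@Cn_comp_dot R d) => k t; exact: is_derive_flat.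
have E x : 1 - (dot a x + c) = dot (- a) x + (1 - c) by rewrite dotNl; ring.
rewrite /step; under eq_fun do rewrite E.
apply: CnM; first exact: fl.
apply: CnV; last by apply: CnD; exact: fl.
by move=> x; rewrite -E gt_eqF.
Qed.

End step.

Section bump.
Context {R : realType}.
Implicit Types (c x : vec3 R).

(** A plateau in the direction [a]: 1 where [|dot a x| <= 1], 0 where it is at least 2. The product
    over the three axes fits the balls of the maximum norm. *)
Let chi (a x : vec3 R) : R := step (2 - dot a x) * step (2 + dot a x).

Let chi_smooth n a : Cn n (chi a).
Proof.
rewrite (_ : chi a = fun x => step (dot (- a) x + 2) * step (dot a x + 2)).
  by apply: CnM; exact: Cn_step_dot.
by apply/funext => x; rewrite /chi dotNl addrC [in X in _ * X]addrC.
Qed.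

Let chi_ge0 a x : 0 <= chi a x.
Proof. by rewrite mulr_ge0// step_ge0. Qed.

Let chi_le1 a x : chi a x <= 1.
Proof. by rewrite mulr_ile1 ?step_ge0 ?step_le1. Qed.

Let chi_1 a x : `|dot a x| <= 1 -> chi a x = 1.
Proof. by rewrite ler_norml => /andP[? ?]; rewrite /chi !step_1 ?mulr1//; lra. Qed.

Let chi_0 a x : 2 <= `|dot a x| -> chi a x = 0.
Proof.
rewrite ler_normr => /orP[h|h]; rewrite /chi.
  by rewrite step_0 ?mul0r//; lra.
by rewrite [X in _ * X]step_0 ?mulr0//; lra.
Qed.

Let bump0 x := chi (basis3 0) x * chi (basis3 1) x * chi (basis3 2) x.

Definition bump c (r : R) x := bump0 (r^-1 *: (x - c)).

Lemma bump_smooth c (r : R) n : Cn n (bump c r).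
Proof.
by apply: (Cn_scale_shift (f := bump0)); apply: CnM; [apply: CnM|]; exact: chi_smooth.
Qed.

Lemma bump_ge0 c (r : R) x : 0 <= bump c r x.
Proof. by apply: mulr_ge0; [apply: mulr_ge0|]; exact: chi_ge0. Qed.

Lemma bump_le1 c (r : R) x : bump c r x <= 1.
Proof.
have h := chi_le1; have h0 := chi_ge0; rewrite /bump /bump0.
apply: mulr_ile1 => //; first by apply: mulr_ge0.
by apply: mulr_ile1.
Qed.

Let dot_basis x : (dot (basis3 0) x = x.1.1) * (dot (basis3 1) x = x.1.2) *
  (dot (basis3 2) x = x.2).
Proof. by rewrite !dotE /basis3 /=; do ?split; ring. Qed.

Lemma bump_1 c (r : R) x : 0 < r -> ball c r x -> bump c r x = 1.
Proof.
move=> r0 [[]]; rewrite /ball /= => h1 h2 h3.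
have h (s t : R) : `|s - t| < r -> `|r^-1 * (t - s)| <= 1.
  rewrite distrC => st; rewrite normrM gtr0_norm ?invr_gt0//.
  by rewrite ler_pdivrMl// mulr1 ltW.
by rewrite /bump /bump0 !chi_1 ?mulr1// dot_basis !vecE h.
Qed.

Lemma bump_0 c (r : R) x : 0 < r -> ~ ball c (2 * r) x -> bump c r x = 0.
Proof.
move=> r0 nb.
have h (s t : R) : ~ `|s - t| < 2 * r -> 2 <= `|r^-1 * (t - s)|.
  rewrite distrC => /negP; rewrite -leNgt => st.
  rewrite normrM gtr0_norm ?invr_gt0//.
  by rewrite ler_pdivlMl// mulrC.
rewrite /bump /bump0.
have [h1|/h h1] := pselect (`|c.1.1 - x.1.1| < 2 * r); last first.
  by rewrite chi_0 ?mul0r// dot_basis.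
have [h2|/h h2] := pselect (`|c.1.2 - x.1.2| < 2 * r); last first.
  by rewrite [X in _ * X * _]chi_0 ?mulr0 ?mul0r// dot_basis.
have [h3|/h h3] := pselect (`|c.2 - x.2| < 2 * r); last first.
  by rewrite [X in _ * X]chi_0 ?mulr0// dot_basis.
by exfalso; apply: nb.
Qed.

Lemma nbhs_not_ball c (r r' : R) x : r < r' -> ~ ball c r' x ->
  \forall y \near x, ~ ball c r y.
Proof.
move=> rr' nb; apply/nbhs_ballP; exists (r' - r) => /=; first by rewrite subr_gt0.
move=> y xy cy; apply: nb; rewrite -[r'](subrKC r).
exact: ball_triangle cy (ball_sym xy).
Qed.

Lemma derive_near0 (f : vec3 R -> R) x v :
  (\forall y \near x, f y = 0) -> 'D_v f x = 0.
Proof.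
move=> f0; rewrite -(derive_cst (0 : R) x v); apply: near_eq_derive.
by near do rewrite /cst /=.
Unshelve. all: by end_near. Qed.

(** The bump vanishes outside radius [2 r]; the radius [3 r] makes it vanish on a whole
    neighbourhood of the point. *)
Lemma bump_derive0 c (r : R) x v : 0 < r -> ~ ball c (3 * r) x ->
  'D_v (bump c r) x = 0.
Proof.
move=> r0 nb; apply: derive_near0.
have := @nbhs_not_ball c (2 * r) (3 * r) x _ nb; move=> /(_ ltac:(lra)).
by apply: filterS => y /bump_0 ->.
Qed.

(** Every bump is a translate and dilate of [bump 0 1], whose derivatives are continuous and vanish
    off a compact cube. Dilation by [r] divides derivatives by [r], so [K] depends on neither centre
    nor radius. *)
Lemma bump_derive_bounded : exists2 K : R, 0 <= K &
  forall c (r : R) x (i : 'I_3), 0 < r -> `|'D_(basis3 i) (bump c r) x| <= K / r.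
Proof.
have bumpE : bump 0 1 = bump0.
  by apply/funext => x; rewrite /bump invr1 scale1r subr0.
pose B : set (vec3 R) := `[-3, 3]%classic `*` `[-3, 3]%classic `*` `[-3, 3]%classic.
have cB : compact B.
  by apply: compact_setX; [apply: compact_setX|]; exact: segment_compact.
have b1 (i : 'I_3) : exists2 K : R, 0 <= K & forall x, `|'D_(basis3 i) bump0 x| <= K.
  have cD : continuous (fun x => 'D_(basis3 i) bump0 x).
    rewrite -bumpE; exact: Cn_continuous (Cn_derive i (bump_smooth 0 1 1)).
  have [M [_ hM]] := compact_bounded (continuous_compact (continuous_subspaceT cD) cB).
  exists (`|M| + 1) => [|x]; first by rewrite addr_ge0.
  have [Bx|Bx] := pselect (B x).
    by apply: hM; [rewrite (le_lt_trans (ler_norm _))// ltrDl|exists x].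
  rewrite -bumpE bump_derive0 ?normr0 ?addr_ge0//.
  rewrite mulr1 => -[[]]; rewrite /ball /= !sub0r !normrN => h1 h2 h3; apply: Bx.
  by do ?split; rewrite /= in_itv /= -ler_norml ltW.
have [K0 K00 hK0] := b1 ord0; have [K1 K10 hK1] := b1 (Ordinal (isT : 1 < 3)%N).
have [K2 K20 hK2] := b1 ord_max.
exists (K0 + K1 + K2); first by rewrite !addr_ge0.
move=> c r x i r0; rewrite /bump.
have df : derivable bump0 (r^-1 *: (x - c)) (basis3 i).
  by rewrite -bumpE; exact: Cn_derivable (bump_smooth 0 1 1).
have := is_derive_scale_shift (derivableP df) => -[_ ->].
rewrite normrM gtr0_norm ?invr_gt0// mulrC ler_pM2r ?invr_gt0//.
case: i {df} => -[|[|[|//]]] i3.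
- have := hK0 (r^-1 *: (x - c)); rewrite /= ; lra.
- have := hK1 (r^-1 *: (x - c)); rewrite /= ; lra.
- have := hK2 (r^-1 *: (x - c)); rewrite /= ; lra.
Qed.

End bump.

(** * Polynomials and projections *)

Section polynomials.
Context {R : realType}.

Lemma mpoly_ind_ring n (P : mpoly.mpoly n R -> Prop) :
  (forall c, P (mpoly.mpolyC n c)) ->
  (forall i, P (mpoly.mpolyX R (mpoly.mnm1 i))) ->
  (forall p q, P p -> P q -> P (p + q)) ->
  (forall p q, P p -> P q -> P (p * q)) ->
  forall p, P p.
Proof.
move=> PC PX PD PM.
have P1 : P 1 by exact: PC.
have PXn i k : P (mpoly.mpolyX R (mpoly.mnm1 i) ^+ k).
  by elim: k => [|k IHk]; rewrite ?expr0// exprS; exact: PM.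
elim/mpoly.mpolyind => [|c m p _ _ Pp].
  by have := PC 0; rewrite mpoly.mpolyC0.
apply: (PD) => //; rewrite -mpoly.mul_mpolyC; apply: (PM) => //.
rewrite mpoly.mpolyXE_id; apply: (big_ind P) => [||i _];
  [exact: P1|exact: PM|exact: PXn].
Qed.

Lemma ev3_smooth n (p : mpoly.mpoly 3 R) : Cn n (ev3 p).
Proof.
elim/mpoly_ind_ring: p => [c|i|p q Cp Cq|p q Cp Cq].
- rewrite (_ : ev3 _ = fun=> c); first exact: Cn_cst.
  by apply/funext => x; rewrite /ev3 mpoly.mevalC.
- pose d k : R -> R := if k is k'.+1 then (if k' is 0 then cst 1 else cst 0) else id.
  rewrite (_ : ev3 _ = fun x => d 0%N (dot (basis3 i) x + 0)).
    apply: Cn_comp_dot => -[|[|k]] t /=; first exact: is_derive_id.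
      exact: is_derive_cst.
    exact: is_derive_cst.
  apply/funext => x; rewrite /ev3 mpoly.mevalXU /= addr0 dotE /basis3 /coord3.
  by case: i => -[|[|[|//]]] ? /=; ring.
- rewrite (_ : ev3 _ = fun x => ev3 p x + ev3 q x); first exact: CnD.
  by apply/funext => x; rewrite /ev3 mpoly.mevalD.
- rewrite (_ : ev3 _ = fun x => ev3 p x * ev3 q x); first exact: CnM.
  by apply/funext => x; rewrite /ev3 mpoly.mevalM.
Qed.

Lemma is_derive_ev3 (p : mpoly.mpoly 3 R) (i : 'I_3) x :
  is_derive x (basis3 i) (ev3 p) (ev3 (mpoly.mderiv i p) x).
Proof.
elim/mpoly_ind_ring: p => [c|j|p q dp dq|p q dp dq].
- rewrite mpoly.mderivC /ev3 mpoly.meval0.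
  rewrite (_ : (fun x => _) = cst c); first exact: is_derive_cst.
  by apply/funext => y; rewrite mpoly.mevalC.
- have E : ev3 (mpoly.mpolyX R (mpoly.mnm1 j)) = fun y : vec3 R => dot (basis3 j) y + 0.
    apply/funext => y; rewrite /ev3 mpoly.mevalXU addr0 dotE /basis3 /coord3.
    by case: j => -[|[|[|//]]] ? /=; ring.
  rewrite E; have := @is_derive_comp_dot R id 1 (basis3 j) 0 x (basis3 i) (is_derive_id _ _).
  move=> h; apply: (is_derive_eq h).
  rewrite mpoly.mderivX /ev3 mpoly.mevalZ mpoly.mnm1E dotE mulr1.
  have [<-|ji] := eqVneq j i.
    have -> : mpoly.mnm_sub (mpoly.mnm1 j) (mpoly.mnm1 j) = mpoly.mnm0.
      by apply/mpoly.mnmP => l; rewrite mpoly.mnmBE mpoly.mnm0E subnn.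
    rewrite mpoly.mpolyX0 mpoly.meval1 /basis3.
    by case: j {E h} => -[|[|[|//]]] ? /=; ring.
  rewrite mul0r /basis3; move: ji; rewrite -val_eqE.
  by case: j {E h} => -[|[|[|//]]] ?; case: i => -[|[|[|//]]] ? //= _; ring.
- rewrite mpoly.mderivD /ev3 mpoly.mevalD.
  rewrite (_ : (fun x => _) = ev3 p + ev3 q); first exact: is_deriveD.
  by apply/funext => y; rewrite mpoly.mevalD.
- rewrite mpoly.mderivM /ev3 mpoly.mevalD !mpoly.mevalM.
  rewrite (_ : (fun x => _) = ev3 p * ev3 q).
    apply: (is_derive_eq (is_deriveM dp dq)).
    by rewrite /ev3 /GRing.scale /= addrC [X in X + _]mulrC.
  by apply/funext => y; rewrite mpoly.mevalM.
Qed.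

(** Exhibits the gradient of a polynomial as a polynomial field, so that it can be a test field for
    the projection [R0]. *)
Lemma grad_ev3 (p : mpoly.mpoly 3 R) x : grad (ev3 p) x =
  evV (mpoly.mderiv ord0 p, mpoly.mderiv (Ordinal (isT : 1 < 3)%N) p,
       mpoly.mderiv ord_max p) x.
Proof.
rewrite /grad /evV /=.
by have [[_ <-] [_ <-] [_ <-]] := And3 (is_derive_ev3 p ord0 x)
  (is_derive_ev3 p (Ordinal (isT : 1 < 3)%N) x) (is_derive_ev3 p ord_max x).
Qed.

Lemma msize_sum n (I : Type) (r : seq I) (F : I -> mpoly.mpoly n R) j :
  (forall i, (mpoly.msize (F i) <= j)%N) -> (mpoly.msize (\sum_(i <- r) F i)%R <= j)%N.
Proof.
move=> Fj; elim/big_rec: _ => [|i p _ hp]; first by rewrite mpoly.msize0.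
by rewrite (leq_trans (mpoly.mmeasureD_le _ _ _))// geq_max Fj hp.
Qed.

(** Derivation does not raise the degree, which already places the gradient of an element of
    [P_(k-3)] in [[P_(k-2)]^3]. *)
Lemma Pdeg_mderiv n j i (p : mpoly.mpoly n R) : Pdeg j p -> Pdeg j (mpoly.mderiv i p).
Proof.
rewrite /Pdeg /= => pj; rewrite (mpoly.mderivwE _ pj); apply: msize_sum => m.
rewrite (leq_trans (mpoly.msizeZ_le _ _))// mpoly.msizeX ltnS.
apply: leq_trans (ltnSE (mpoly.bmdeg m)).
by rewrite !mpoly.mdegE; apply: leq_sum => l _; rewrite mpoly.mnmBE leq_subr.
Qed.

Lemma msizeM_pred n (p q : mpoly.mpoly n R) :
  (mpoly.msize (p * q)%R <= (mpoly.msize p + mpoly.msize q).-1)%N.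
Proof.
have [->|p0] := eqVneq p 0; first by rewrite mul0r mpoly.msize0.
have [->|q0] := eqVneq q 0; first by rewrite mulr0 mpoly.msize0.
by rewrite mpoly.msizeM.
Qed.

(** On a face each space coordinate is an affine form [L i] in the planar coordinates, and
    substituting affine forms does not raise the total degree. *)
Lemma fpoint_poly (f : face R) j (p : mpoly.mpoly 3 R) : Pdeg j p ->
  exists2 q : mpoly.mpoly 2 R, Pdeg j q &
    forall s, ev2 q s = ev3 p (fpoint f s).
Proof.
move=> pj.
pose L (i : 'I_3) : mpoly.mpoly 2 R := mpoly.mpolyC 2 (coord3 (forigin f) i) +
  (coord3 (fu f) i *: mpoly.mpolyX R (mpoly.mnm1 ord0) +
   coord3 (fv f) i *: mpoly.mpolyX R (mpoly.mnm1 ord_max)).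
have szL i : (mpoly.msize (L i) <= 2)%N.
  rewrite (leq_trans (mpoly.mmeasureD_le _ _ _))// geq_max mpoly.mmeasureC.
  rewrite (leq_trans (leq_b1 _))//=.
  rewrite (leq_trans (mpoly.mmeasureD_le _ _ _))// geq_max.
  by apply/andP; split; rewrite (leq_trans (mpoly.msizeZ_le _ _))// mpoly.msizeX mpoly.mdeg1.
have LE i s : ev2 (L i) s = coord3 (fpoint f s) i.
  rewrite /ev2 /L !mpoly.mevalD mpoly.mevalC !mpoly.mevalZ !mpoly.mevalXU.
  rewrite /fpoint /coord2 /= addrA.
  case: i => -[|[|[|//]]] ?; rewrite /coord3 /= ?vecE /GRing.scale /=; ring.
have szX i k : (mpoly.msize (L i ^+ k)%R <= k.+1)%N.
  elim: k => [|k IHk]; first by rewrite expr0 mpoly.msize1.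
  rewrite exprS (leq_trans (msizeM_pred _ _))//.
  by have := leq_add (szL i) IHk; rewrite add2n; case: (_ + _)%N.
pose lq := [tuple L i | i < 3].
exists (mpoly.comp_mpoly lq p).
  rewrite /Pdeg /= (mpoly.comp_mpolywE _ pj); apply: msize_sum => m.
  rewrite (leq_trans (mpoly.msizeZ_le _ _))//.
  apply: (@leq_trans (\sum_(i < 3) mpoly.bmnm m i).+1); last first.
    by rewrite -mpoly.mdegE; exact: mpoly.bmdeg.
  elim/big_ind2: _ => [|a b c d ha hc|i _].
  - by rewrite mpoly.msize1.
  - rewrite (leq_trans (msizeM_pred _ _))//.
    by have := leq_add ha hc; rewrite addSn addnS; case: (_ + _)%N.
  - by rewrite tnth_mktuple.
move=> s; rewrite /ev2 /ev3 mpoly.comp_mpoly_meval; apply: mpoly.meval_eq => i.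
by rewrite tnth_mktuple -/(ev2 (L i) s) LE.
Qed.

End polynomials.

(** * Existence of L2 projections onto polynomials *)

Section projection.
Context {R : realType} d (T : measurableType d) (m : {measure set T -> \bar R}).
(** [C] stands for the continuous functions on [T] or on a face; only an algebra of integrable
    functions containing the constants is used, so both projections share one proof. *)
Variables (D : set T) (mD : measurable D) (C : (T -> R) -> Prop).
Hypothesis Cc : forall c, C (fun=> c).
Hypothesis CD : forall f g, C f -> C g -> C (fun x => f x + g x).
Hypothesis CM : forall f g, C f -> C g -> C (fun x => f x * g x).
Hypothesis Ci : forall f, C f -> m.-integrable D (EFin \o f).

Let Csum I (r : seq I) (F : I -> T -> R) :
  (forall i, C (F i)) -> C (fun x => \sum_(i <- r) F i x).
Proof.
move=> CF; elim: r => [|i r IHr].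
  by under eq_fun do rewrite big_nil; exact: Cc.
by under eq_fun do rewrite big_cons; apply: CD.
Qed.

Let Rintegral_sum I (r : seq I) (F : I -> T -> R) : (forall i, C (F i)) ->
  \int[m]_(x in D) (\sum_(i <- r) F i x) = \sum_(i <- r) \int[m]_(x in D) F i x.
Proof.
move=> CF; elim: r => [|i r IHr].
  under eq_Rintegral do rewrite big_nil.
  by rewrite big_nil Rintegral_cst// mul0r.
under eq_Rintegral do rewrite big_cons.
by rewrite big_cons RintegralD ?IHr//; apply: Ci => //; exact: Csum.
Qed.

(** The degenerate case of Cauchy-Schwarz: a square of zero integral vanishes almost everywhere, and
    so does the product of [p] with [w]. *)
Let square_eq0 p w : C p -> C w ->
  \int[m]_(x in D) (p x * p x) = 0 -> \int[m]_(x in D) (w x * p x) = 0.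
Proof.
move=> Cp Cw p0.
have mp : measurable_fun D (EFin \o p) := measurable_int _ (Ci Cp).
have pae : ae_eq m D (fun x => (p x * p x)%:E) (cst 0%E).
  apply/ae_eq_integral_abs => //; first exact: measurable_int (Ci (CM Cp Cp)).
  have i2 := integrable_fin_num mD (Ci (CM Cp Cp)).
  rewrite (eq_integral (fun x => (p x * p x)%:E)); last first.
    by move=> x _ /=; rewrite ger0_norm// -expr2 sqr_ge0.
  by rewrite -[LHS](fineK i2) [X in X%:E]p0.
rewrite /Rintegral (ae_eq_integral (cst 0%E)) ?integral0//.
  exact: measurable_int (Ci (CM Cw Cp)).
move: pae; apply: filterS => x h Dx; have := h Dx.
by case=> /eqP; rewrite mulf_eq0 orbb => /eqP ->; rewrite mulr0.
Qed.

(* Solvability of the normal equations: the right-hand side is orthogonal to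
   the kernel of the Gram matrix, hence lies in its row space. *)
Lemma gram_solvable N (e : 'I_N -> T -> R) (w : T -> R) :
  (forall i, C (e i)) -> C w ->
  exists c : 'I_N -> R, forall j,
    \int[m]_(x in D) ((w x - \sum_i c i * e i x) * e j x) = 0.
Proof.
move=> Ce Cw.
pose G := \matrix_(i < N, j < N) \int[m]_(x in D) (e i x * e j x).
pose b := \row_(j < N) \int[m]_(x in D) (w x * e j x).
have Cp (v : 'I_N -> R) : C (fun x => \sum_i v i * e i x).
  by apply: Csum => i; apply: CM => //; exact: Cc.
have ip f (v : 'I_N -> R) : C f -> \int[m]_(x in D) (f x * \sum_i v i * e i x) =
    \sum_i v i * \int[m]_(x in D) (f x * e i x).
  move=> Cf; transitivity (\int[m]_(x in D) (\sum_i v i * (f x * e i x))).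
    by apply: eq_Rintegral => x _; rewrite mulr_sumr; apply: eq_bigr => i _; ring.
  rewrite Rintegral_sum => [|i]; last by apply: CM; [exact: Cc|exact: CM].
  by apply: eq_bigr => i _; rewrite RintegralZl//; apply: Ci; exact: CM.
have bG : (b <= G)%MS.
  rewrite submxE; apply/eqP/rowP => k; rewrite mxE [RHS]mxE.
  (* The [k]-th column [v] of the cokernel satisfies [G v = 0]. Hence the combination [p] has zero
     L2 norm, and [b v], which is the integral of [w * p], vanishes. *)
  pose v i := cokermx G i k; pose p x := \sum_i v i * e i x.
  have -> : \sum_j b 0 j * cokermx G j k = \int[m]_(x in D) (w x * p x).
    by rewrite ip//; apply: eq_bigr => j _; rewrite mxE mulrC.
  apply: square_eq0 => //; first exact: Cp.
  rewrite ip; last exact: Cp.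
  rewrite big1// => i _; apply/eqP; rewrite mulf_eq0; apply/orP; right; apply/eqP.
  have := congr1 (fun A : matrix R N N => A i k) (mulmx_coker G); rewrite !mxE => <-.
  rewrite [LHS](_ : _ = \int[m]_(x in D) (e i x * p x)).
    by rewrite ip//; apply: eq_bigr => j _; rewrite mxE mulrC.
  by apply: eq_Rintegral => x _; rewrite mulrC.
have /submxP[c bE] := bG; exists (fun i => c 0 i) => j.
transitivity (\int[m]_(x in D) (w x * e j x - e j x * \sum_i c 0 i * e i x)).
  by apply: eq_Rintegral => x _; ring.
rewrite RintegralB//; last 2 first.
- by apply: Ci; exact: CM.
- by apply: Ci; apply: CM => //; exact: Cp.
apply/eqP; rewrite subr_eq0 ip//; apply/eqP.
have := congr1 (fun A : matrix R 1 N => A 0 j) bE; rewrite !mxE => ->.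
apply: eq_bigr => i _; rewrite mxE; congr (_ * _).
by apply: eq_Rintegral => x _; rewrite mulrC.
Qed.

Lemma mpoly_projection n (v : T -> 'I_n -> R) (w : T -> R) (j : nat) :
  (forall p : mpoly.mpoly n R, C (fun x => mpoly.meval (v x) p)) -> C w ->
  exists2 p : mpoly.mpoly n R, Pdeg j p & forall q, Pdeg j q ->
    \int[m]_(x in D) ((w x - mpoly.meval (v x) p) * mpoly.meval (v x) q) = 0.
Proof.
move=> Cv Cw.
(* The multi-indices of degree less than [j + 1], that is, the monomials spanning [Pdeg j]. *)
pose B : finType := mpoly.bmultinom n j.+1.
pose X (b : B) : mpoly.mpoly n R := mpoly.mpolyX R (mpoly.bmnm b).
have [c hc] := @gram_solvable #|B| (fun i x => mpoly.meval (v x) (X (enum_val i))) w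
  (fun i => Cv _) Cw.
pose p := \sum_(i < #|B|) c i *: X (enum_val i).
exists p.
  apply: msize_sum => i; rewrite (leq_trans (mpoly.msizeZ_le _ _))//.
  by rewrite mpoly.msizeX; exact: mpoly.bmdeg.
move=> q qj; rewrite {1}(mpoly.mpolywE qj).
have pE x : mpoly.meval (v x) p = \sum_i c i * mpoly.meval (v x) (X (enum_val i)).
  rewrite /p; elim/big_rec2: _ => [|i y1 y2 _ <-]; first by rewrite mpoly.meval0.
  by rewrite mpoly.mevalD mpoly.mevalZ.
pose qc (b : B) := mpoly.mcoeff (mpoly.bmnm b) q.
transitivity (\int[m]_(x in D) (\sum_(b : B) qc b *
    ((w x - mpoly.meval (v x) p) * mpoly.meval (v x) (X b)))).
  apply: eq_Rintegral => x _.
  have -> : mpoly.meval (v x) (\sum_(b : B) qc b *: X b) =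
      \sum_(b : B) qc b * mpoly.meval (v x) (X b).
    elim/big_rec2: _ => [|i y1 y2 _ <-]; first by rewrite mpoly.meval0.
    by rewrite mpoly.mevalD mpoly.mevalZ.
  by rewrite mulr_sumr; apply: eq_bigr => b _; ring.
have CwX b : C (fun x => (w x - mpoly.meval (v x) p) * mpoly.meval (v x) (X b)).
  apply: CM => //; rewrite (_ : (fun x => _) = (fun x => w x + (-1) * mpoly.meval (v x) p)).
    by apply: CD => //; apply: CM.
  by apply/funext => x; rewrite mulN1r.
rewrite Rintegral_sum => [|b]; last by apply: CM.
apply: big1 => b _; rewrite RintegralZl//; last exact: Ci.
have := hc (enum_rank b); rewrite enum_rankK => h.
rewrite [X in _ * X](_ : _ = 0) ?mulr0// -[RHS]h.
by apply: eq_Rintegral => x _; rewrite pE.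
Qed.

End projection.

Section compact_integrable.
Context {R : realType}.

Lemma bounded_ball (V : normedModType R) (A : set V) : bounded_set A ->
  exists2 M : R, 0 < M & A `<=` ball 0 M.
Proof.
move=> /ex_strict_bound_gt0[M M0 hM]; exists M => // x Ax.
by rewrite -ball_normE /= sub0r normrN; exact: hM.
Qed.

Let ball_itv (x M : R) : ball 0 M x -> `[- M, M]%classic x.
Proof. by rewrite /ball /= sub0r normrN in_itv /= ltr_norml => /andP[/ltW-> /ltW->]. Qed.

Lemma compact_vec3 (A : set (vec3 R)) : closed A -> bounded_set A -> compact A.
Proof.
move=> cA /bounded_ball[M M0 AM].
apply: (@subclosed_compact _ A
  (`[- M, M]%classic `*` `[- M, M]%classic `*` `[- M, M]%classic)) => //.
  by apply: compact_setX; [apply: compact_setX|]; exact: segment_compact.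
by move=> x /AM [[] ? ? ?]; do ?split; exact: ball_itv.
Qed.

Lemma compact_vec2 (A : set (vec2 R)) : closed A -> bounded_set A -> compact A.
Proof.
move=> cA /bounded_ball[M M0 AM].
apply: (@subclosed_compact _ A (`[- M, M]%classic `*` `[- M, M]%classic)) => //.
  by apply: compact_setX; exact: segment_compact.
by move=> x /AM [? ?]; do ?split; exact: ball_itv.
Qed.

Lemma mu3_bounded (A : set (vec3 R)) : closed A -> bounded_set A -> (mu3 A < +oo)%E.
Proof.
move=> cA /bounded_ball[M M0 AM].
apply: (@le_lt_trans _ _ (mu3 (ball (0 : vec3 R) M))); last first.
  by rewrite mu3_ball ?ltry// ltW.
apply: le_measure => //; rewrite inE; first exact: closed_measurable3.
exact: (open_measurable3 (ball_open (0 : vec3 R) M)).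
Qed.

Lemma mu2_bounded (A : set (vec2 R)) : closed A -> bounded_set A -> (mu2 A < +oo)%E.
Proof.
move=> cA /bounded_ball[M M0 AM].
apply: (@le_lt_trans _ _ (mu2 (ball (0 : vec2 R) M))); last first.
  by rewrite mu2_ball ?ltry// ltW.
apply: le_measure => //; rewrite inE; first exact: closed_measurable2.
exact: (open_measurable2 (ball_open (0 : vec2 R) M)).
Qed.

Lemma integrable_within3 (A : set (vec3 R)) (f : vec3 R -> R) :
  closed A -> bounded_set A -> {within A, continuous f} ->
  (@mu3 R).-integrable A (EFin \o f).
Proof.
move=> cA bA cf; apply: measurable_bounded_integrable.
- exact: closed_measurable3.
- exact: mu3_bounded.
- exact: continuous_measurable3.
- have [M [Mr hM]] := compact_bounded (continuous_compact cf (compact_vec3 cA bA)).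
  by exists M; split=> // y yM x Ax; apply: hM => //; exists x.
Qed.

Lemma integrable_within2 (A : set (vec2 R)) (f : vec2 R -> R) :
  closed A -> bounded_set A -> {within A, continuous f} ->
  (@mu2 R).-integrable A (EFin \o f).
Proof.
move=> cA bA cf; apply: measurable_bounded_integrable.
- exact: closed_measurable2.
- exact: mu2_bounded.
- exact: continuous_measurable2.
- have [M [Mr hM]] := compact_bounded (continuous_compact cf (compact_vec2 cA bA)).
  by exists M; split=> // y yM x Ax; apply: hM => //; exists x.
Qed.

End compact_integrable.

(** * Faces and normals *)

Section face_geometry.
Context {R : realType}.
Implicit Types (x y z nu : vec3 R) (s : vec2 R).

Definition level (f : face R) y : R := dot (y - forigin f) (fnormal f).

Lemma level_frame (f : face R) z : level f (frame_point f z) = z.2.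
Proof. by have := frame_pointK f z; rewrite /frame_coord => /(congr1 snd). Qed.

Lemma level_fpoint (f : face R) s : level f (fpoint f s) = 0.
Proof. by rewrite fpointE level_frame. Qed.

Lemma levelD (f : face R) y z : level f (y + z) = level f y + dot z (fnormal f).
Proof. by rewrite /level -dotDl addrAC. Qed.

Lemma continuous_shift_dot (o n : vec3 R) : continuous (fun y => dot (y - o) n).
Proof.
apply: (continuous_dot (f := fun y => y - o)) => y; last exact: cvg_cst.
by apply: cvgB; [exact: cvg_id|exact: cvg_cst].
Qed.

Lemma continuous_level (f : face R) : continuous (level f).
Proof. exact: continuous_shift_dot. Qed.

Definition plane_coord (f : face R) y : vec2 R := (frame_coord f y).1.

Lemma continuous_plane_coord (f : face R) : continuous (plane_coord f).
Proof.
move=> y.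
exact: (cvg_pair (@continuous_shift_dot (forigin f) (fu f) y)
  (@continuous_shift_dot (forigin f) (fv f) y)).
Qed.

Lemma plane_coordK (f : face R) y : level f y = 0 -> fpoint f (plane_coord f y) = y.
Proof.
move=> y0; rewrite fpointE -[RHS](frame_coordK f); congr frame_point.
by rewrite /plane_coord [RHS]surjective_pairing /= -/(level f y) y0.
Qed.

Lemma fpointK (f : face R) s : plane_coord f (fpoint f s) = s.
Proof. by rewrite fpointE /plane_coord frame_pointK. Qed.

Lemma continuous_fpoint (f : face R) : continuous (fpoint f).
Proof.
move=> s; rewrite (_ : fpoint f = frame_point f \o (fun s => (s, 0))).
  apply: continuous_comp; last exact: continuous_frame_point.
  exact: (cvg_pair (@cvg_id _ (nbhs s)) (@cvg_cst _ (0 : R) _ (nbhs s) _)).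
by apply/funext => t; rewrite fpointE.
Qed.

Lemma fregion_closed (f : face R) : closed (fregion f).
Proof.
apply: compact_closed; first exact: norm_hausdorff.
apply: continuous_compact; first exact/continuous_subspaceT/continuous_fpoint.
by apply: compact_vec2; [exact: polygon_closed|exact: polygon_bounded].
Qed.

Lemma ball_convex x (r : R) y z (c : R) : 0 <= c <= 1 ->
  ball x r y -> ball x r z -> ball x r (y + c *: (z - y)).
Proof.
move=> /andP[c0 c1]; rewrite -!ball_normE /= => xy xz.
rewrite (_ : x - _ = (1 - c) *: (x - y) + c *: (x - z)); last first.
  by apply: vec3P; rewrite !vecE; ring.
rewrite (le_lt_trans (ler_normD _ _))// !normrZ (ger0_norm c0) ger0_norm ?subr_ge0//.
have [->|cn0] := eqVneq c 0; first by rewrite subr0 mul1r mul0r addr0.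
have c0' : 0 < c by rewrite lt_neqAle eq_sym cn0.
have h1 : (1 - c) * `|x - y| <= (1 - c) * r by rewrite ler_wpM2l ?subr_ge0// ltW.
have h2 : c * `|x - z| < c * r by rewrite ltr_pM2l.
by rewrite (lt_le_trans (ler_ltD h1 h2))// -mulrDl subrK mul1r.
Qed.

(** The segment is connected, and on it [interior T] is open and also closed, since it coincides
    there with [T]. A path leaving [T] would have to meet the boundary. *)
Lemma segment_interior (T : polyhedron R) (H : set (vec3 R)) y z :
  (forall c : R, 0 <= c <= 1 -> H (y + c *: (z - y))) ->
  (forall x, H x -> tregion T x -> interior T x) ->
  interior T y -> interior T z.
Proof.
move=> Hyz HT Ty.
pose g (c : R) := y + c *: (z - y).
have cg : {within `[0, 1]%classic, continuous g}.
  apply/continuous_subspaceT => c; apply: cvgD; first exact: cvg_cst.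
  by apply: cvgZr_tmp; exact: cvg_id.
have cK := connected_continuous_connected (@segment_connected R 0 1) cg.
set K := g @` _ in cK.
have K1 : K z.
  by exists 1; rewrite /= ?in_itv /= ?lexx ?ler01// /g scale1r addrC subrK.
have K0 : K y.
  by exists 0; rewrite /= ?in_itv /= ?lexx ?ler01// /g scale0r addr0.
have KH x : K x -> H x by move=> [c /=]; rewrite in_itv /= => /Hyz ? <-.
have : K `&` interior T = K.
  apply: cK; first by exists y.
    by exists (interior T) => //; exact: open_interior.
  exists (tregion T); first exact: polyhedron_closed.
  apply/seteqP; split=> x [Kx Tx]; split => //; first exact: interior_subset.
  exact: HT (KH _ Kx) Tx.
by move=> /seteqP[_ /(_ _ K1)[]].
Qed.

(** The local shape of [T] at a face: in this ball the boundary is a flat disc of the face [i], and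
    [T] lies where [sigma * level] is negative, so that [sigma *: fnormal] points outward. *)
Definition face_side (T : polyhedron R) i x (r sigma : R) :=
  forall y, ball x r y ->
    [/\ sigma * level (tface T i) y < 0 -> interior T y,
        0 < sigma * level (tface T i) y -> ~ tregion T y,
        level (tface T i) y = 0 -> frelint (tface T i) y &
        forall j, j != i -> ~ fregion (tface T j) y].

Lemma frelint_fregion (f : face R) : frelint f `<=` fregion f.
Proof. by move=> _ [s Ps <-]; exists s => //; exact: interior_subset. Qed.

(** The other faces are finitely many closed sets avoiding [x], so a small ball meets the boundary
    only in the plane of the face [i]. That plane cuts the ball into two halves, each of which lies
    inside or outside [T]. *)
Lemma face_side_exists (T : polyhedron R) i x : frelint (tface T i) x ->
  exists r sigma : R, [/\ 0 < r, sigma = 1 \/ sigma = -1 & face_side i x r sigma].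
Proof.
move=> fx; set f := tface T i in fx *.
have x0 : level f x = 0 by case: fx => s _ <-; rewrite level_fpoint.
have sx : interior (fpolygon f) (plane_coord f x).
  by case: fx => s Ps <-; rewrite fpointK.
have N1 : \forall y \near x, interior (fpolygon f) (plane_coord f y).
  apply: continuous_plane_coord; apply: open_nbhs_nbhs; split => //.
  exact: open_interior.
have N2 : \forall y \near x, forall j, j != i -> ~ fregion (tface T j) y.
  have N j : \forall y \near x, j != i -> ~ fregion (tface T j) y.
    have [->|ji] := eqVneq j i; first by near=> y.
    have : nbhs x (~` fregion (tface T j)).
      apply: open_nbhs_nbhs; split; first exact/closed_openC/fregion_closed.
      move=> fjx; rewrite eq_sym in ji.
      by have := polyhedron_faces ji => /seteqP[/(_ x) + _]; apply; split.
    by apply: filterS.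
  apply: (@filter_forall (vec3 R) 'I_(nfaces T)
    (fun j y => j != i -> ~ fregion (tface T j) y) (nbhs x)) => j; exact: N.
have [r /= r0 rB] : exists2 r : R, 0 < r & ball x r `<=`
    [set y | interior (fpolygon f) (plane_coord f y) /\
      forall j, j != i -> ~ fregion (tface T j) y].
  by apply/nbhs_ballP; near=> y; split; near: y.
have relint y : ball x r y -> level f y = 0 -> frelint f y.
  by move=> /rB[Py _] y0; exists (plane_coord f y) => //; rewrite plane_coordK.
have bd y : ball x r y -> tregion T y -> level f y <> 0 -> interior T y.
  move=> xy Ty y0; apply: contrapT => nT.
  have : (tregion T `\` interior T) y by [].
  rewrite polyhedron_boundary => -[j _ fj].
  have [ji|ji] := eqVneq j i; last by have [_ /(_ j ji)] := rB _ xy.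
  by apply: y0; case: fj => s _ <-; rewrite ji level_fpoint.
have zbd y : frelint f y -> tregion T y /\ ~ interior T y.
  move=> fy; have : (\bigcup_j fregion (tface T j)) y.
    by exists i => //; exact: frelint_fregion.
  by rewrite -polyhedron_boundary => -[].
(* A half-ball is convex and misses the boundary, so one point of [T] in it forces the whole half
   into the interior. *)
have half (e : R) : (forall y, ball x r y -> 0 < e * level f y -> interior T y) \/
    (forall y, ball x r y -> 0 < e * level f y -> ~ tregion T y).
  have [[a [xa ea Ta]]|none] := pselect (exists a,
      [/\ ball x r a, 0 < e * level f a & tregion T a]); last first.
    by right => y xy ey Ty; apply: none; exists y.
  left => y xy ey.
  have n0 b : 0 < e * level f b -> level f b <> 0.
    by move=> + b0; rewrite b0 mulr0 ltxx.
  apply: (@segment_interior T [set b | ball x r b /\ 0 < e * level f b] a).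
  - move=> c c01; split; first exact: ball_convex.
    have -> : level f (a + c *: (y - a)) = (1 - c) * level f a + c * level f y.
      by rewrite /level !dotBl dotDl dotZl dotBl; ring.
    rewrite mulrDr; case/andP: c01 => c0 c1.
    have h1 : 0 <= (1 - c) * (e * level f a) by rewrite mulr_ge0 ?subr_ge0// ltW.
    have h2 : 0 <= c * (e * level f y) by rewrite mulr_ge0// ltW.
    have [c2|c2] := ltP c 1.
      have : 0 < (1 - c) * (e * level f a) by rewrite mulr_gt0 ?subr_gt0.
      by lra.
    have -> : c = 1 by lra.
    by lra.
  - by move=> b [xb eb] Tb; exact: bd (n0 _ eb).
  - exact: bd (n0 _ ea).
(* Two inner halves would make [x] an interior point; two outer halves would contradict that [T] is
   the closure of its interior. The mixed cases give the two signs. *)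
have [P|P] := half 1; have [N|N] := half (-1).
- exfalso; have [Tx] := zbd x fx; apply.
  apply/nbhs_ballP; exists r => // y xy.
  have [y0|] := eqVneq (level f y) 0; first by have [] := zbd y (relint _ xy y0).
  rewrite neq_lt => /orP[y0|y0]; apply: interior_subset; [apply: N|apply: P] => //; lra.
- exists r, (-1); split => //; first by right.
  move=> y xy; have [_ h] := rB _ xy; split => //; last exact: relint.
    by move=> ?; apply: P => //; lra.
  by move=> ?; apply: N => //; lra.
- exists r, 1; split => //; first by left.
  move=> y xy; have [_ h] := rB _ xy; split => //; last exact: relint.
    by move=> ?; apply: N => //; lra.
  by move=> ?; apply: P => //; lra.
- exfalso; have [Tx _] := zbd x fx; rewrite -polyhedron_regular in Tx.
  have [y [Ty xy]] := Tx _ (nbhsx_ballx x r r0).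
  have [y0|] := eqVneq (level f y) 0.
    by have [] := zbd y (relint _ xy y0).
  rewrite neq_lt => /orP[y0|y0].
    by apply: (N y xy); [lra|exact: interior_subset].
  by apply: (P y xy); [lra|exact: interior_subset].
Unshelve. all: by end_near. Qed.

End face_geometry.

(** * Outward normals and the sign of a face *)

Section normals.
Context {R : realType}.
Implicit Types (x y z nu : vec3 R) (s : vec2 R).

Lemma face_sideS (T : polyhedron R) (i : 'I_(nfaces T)) x y (r r' sigma : R) :
  ball x r y -> r' <= r - `|x - y| -> face_side i x r sigma -> face_side i y r' sigma.
Proof.
move=> xy rr h z yz; apply: h; move: xy yz; rewrite -!ball_normE /= => xy yz.
rewrite (_ : x - z = (x - y) + (y - z)); last by rewrite addrA subrK.
rewrite (le_lt_trans (ler_normD _ _))//; lra.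
Qed.

Lemma dot_self_pm1 (a : R) x : dot x x = 1 -> dot (a *: x) (a *: x) = 1 ->
  a = 1 \/ a = -1.
Proof.
move=> xx; rewrite dotZl dotZr xx mulr1 => /eqP; rewrite -expr2 sqrf_eq1.
by case/orP => /eqP; [left|right].
Qed.

Lemma small_step x nu (r : R) : 0 < r -> exists2 e : R, 0 < e &
  forall t, `|t| < e -> ball x r (x + t *: nu).
Proof.
move=> r0; exists (r / (`|nu| + 1)); first by rewrite divr_gt0// ltr_wpDl.
move=> t te; rewrite -ball_normE /= opprD addrA subrr add0r normrN normrZ.
have n1 : 0 < `|nu| + 1 by rewrite ltr_wpDl.
move: te; rewrite ltr_pdivlMr// => te.
by have := normr_ge0 t; have := normr_ge0 nu; nra.
Qed.

(** The vector [sigma *: n] meets the specification. Any candidate is attached to the same face,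
    because relative interiors avoid the other faces, and is then [n] or [- n]. *)
Lemma outward_normal_side (T : polyhedron R) (i : 'I_(nfaces T)) x (r sigma : R) :
  frelint (tface T i) x -> 0 < r -> sigma = 1 \/ sigma = -1 ->
  face_side i x r sigma ->
  outward_normal T x = sigma *: fnormal (tface T i).
Proof.
move=> fx r0 s1 hs; set f := tface T i in fx *; set n := fnormal f.
have [uu vv nn] := face_unit f; have [uv un vn] := face_orthogonal f.
have ss : sigma * sigma = 1 by case: s1 => ->; ring.
have x0 : level f x = 0 by case: fx => s _ <-; rewrite level_fpoint.
have lev (a t : R) : level f (x + t *: (a *: n)) = t * a.
  by rewrite levelD x0 add0r !dotZl nn mulr1.
have levN (a t : R) : level f (x - t *: (a *: n)) = - (t * a).
  by rewrite levelD x0 add0r dotNl !dotZl nn mulr1.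
have pn : is_outward_normal T x (sigma *: n).
  split; first by rewrite dotZl dotZr nn mulr1.
    by exists i => //; rewrite !dotZl (dotC n) un (dotC n) vn mulr0.
  have [e e0 he] := small_step x (sigma *: n) r0; exists e => // t /andP[t0 te].
  have te' : `|t| < e by rewrite gtr0_norm.
  have te'' : `|- t| < e by rewrite normrN.
  split.
    have := he _ te''; rewrite scaleNr => /hs[+ _ _ _]; apply.
    by rewrite levN; nra.
  have [_ + _ _] := hs _ (he _ te'); apply; rewrite lev; nra.
rewrite /outward_normal; case: xgetP => [nu _|none]; last by have := none _ pn.
move=> [nu1 [j fj [nuu nuv]] [e e0 he]].
have ji : j = i.
  apply/eqP; apply/negPn/negP => ji.
  have := polyhedron_faces ji => /seteqP[/(_ x) + _]; apply.
  by split => //; exact: frelint_fregion.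
subst j.
have nuE : nu = dot nu n *: n.
  rewrite {1}(orthonormal_expansion nu (face_unit f) (face_orthogonal f)).
  by rewrite nuu nuv !scale0r !add0r.
set a := dot nu n in nuE.
have a1 : a = 1 \/ a = -1 by apply: (dot_self_pm1 nn); rewrite -nuE.
have [aE|aN] : a = sigma \/ a = - sigma.
- by case: a1 s1 => -> [] ->; rewrite ?opprK; auto.
- by rewrite nuE aE.
(* With the opposite sign, [x - t *: nu] is on the outer side of the face for small [t], yet the
   specification puts it inside [T]. The step [t] is small enough for both conditions. *)
exfalso.
have [e' e'0 he'] := small_step x (a *: n) r0.
pose t := Num.min e e' / 2.
have m0 : 0 < Num.min e e' by rewrite lt_min e0.
have t0 : 0 < t by rewrite divr_gt0.
have te : t < e /\ t < e'.
  have : Num.min e e' <= e by rewrite ge_min lexx.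
  have : Num.min e e' <= e' by rewrite ge_min lexx orbT.
  by rewrite /t; lra.
have /he[Tint _] : 0 < t < e by rewrite t0 te.1.
have tN : `|- t| < e' by rewrite normrN gtr0_norm// te.2.
have := he' _ tN; rewrite scaleNr -nuE => xb.
have [_ + _ _] := hs _ xb; apply; last exact: interior_subset.
by rewrite nuE levN aN; nra.
Qed.

(** The two sets [A sigma] and [A (- sigma)] are open and cover the interior of the polygon; they
    are disjoint because the outward normal has only one value at a point. *)
Lemma face_sign (T : polyhedron R) (i : 'I_(nfaces T)) :
  exists2 sigma : R, sigma = 1 \/ sigma = -1 &
    forall s, interior (fpolygon (tface T i)) s ->
    exists2 r : R, 0 < r & face_side i (fpoint (tface T i) s) r sigma.
Proof.
set f := tface T i; set P := interior (fpolygon f).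
have [[s0 Ps0]|none] := pselect (exists s, P s); last first.
  by exists 1; [left|move=> s Ps; exfalso; apply: none; exists s].
have rel s : P s -> frelint f (fpoint f s) by exists s.
pose A (e : R) s := P s /\ exists2 r : R, 0 < r & face_side i (fpoint f s) r e.
have oA e : open (A e).
  rewrite openE => s [Ps [r r0 hr]].
  have N1 : \forall s' \near s, P s'.
    by apply: open_nbhs_nbhs; split => //; exact: open_interior.
  have N2 : \forall s' \near s, ball (fpoint f s) (r / 2) (fpoint f s').
    by apply: continuous_fpoint; apply: nbhsx_ballx; rewrite divr_gt0.
  near=> s'; split; first by near: s'.
  exists (r / 2); first by rewrite divr_gt0.
  have b : ball (fpoint f s) (r / 2) (fpoint f s') by near: s'.
  apply: face_sideS hr; last by move: b; rewrite -ball_normE /=; lra.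
  by apply: le_ball b; lra.
have [r0 [sigma [r00 s1 hs]]] := face_side_exists (rel _ Ps0).
have s1N : - sigma = 1 \/ - sigma = -1.
  by case: s1 => ->; rewrite ?opprK; auto.
have disj s : A sigma s -> A (- sigma) s -> False.
  move=> [Ps [r rp hr]] [_ [r' rp' hr']].
  have := outward_normal_side (rel _ Ps) rp s1 hr.
  rewrite (outward_normal_side (rel _ Ps) rp' s1N hr') => /(congr1 (dot (fnormal f))).
  have [_ _ nn] := face_unit f.
  by rewrite !dotZr nn !mulr1; case: s1 => ->; lra.
have cover s : P s -> A sigma s \/ A (- sigma) s.
  move=> Ps; have [r [e [rp e1 he]]] := face_side_exists (rel _ Ps).
  have [<-|<-] : e = sigma \/ e = - sigma.
    by case: e1 s1 => -> [] ->; rewrite ?opprK; auto.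
  - by left; split=> //; exists r.
  - by right; split=> //; exists r.
have E : A sigma = P.
  apply: (polygon_connected (p := fpolygon f)).
  - by exists s0; split=> //; exists r0.
  - by exists (A sigma) => //; apply/seteqP; split=> s; [move=> As; split=> //; case: As|case].
  - exists (~` A (- sigma)); first exact/open_closedC.
    apply/seteqP; split=> s.
      by move=> As; split; [case: As|move=> /(disj _ As)].
    by move=> [/cover[]].
by exists sigma => // s; rewrite -/P -E => -[].
Unshelve. all: by end_near. Qed.

End normals.

(** * Green's formula *)

Section dct.
Context {R : realType} d (T : measurableType d) (m : {measure set T -> \bar R}).

Lemma Rintegral_dct (D : set T) (f_ : nat -> T -> R) (f g : T -> R) :
  measurable D -> (forall n, measurable_fun D (f_ n)) -> measurable_fun D f ->
  {ae m, forall x, D x -> f_ ^~ x @ \oo --> f x} ->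
  m.-integrable D (EFin \o g) -> (forall n x, D x -> `|f_ n x| <= g x) ->
  \int[m]_(x in D) f_ n x @[n --> \oo] --> \int[m]_(x in D) f x.
Proof.
move=> mD mf_ mf ff ig fg.
have [||||iF _ h] := @dominated_convergence _ _ _ m D mD (fun n x => (f_ n x)%:E)
    (fun x => (f x)%:E) (EFin \o g) _ _ _ ig.
- by move=> n; exact/measurable_EFinP.
- exact/measurable_EFinP.
- by apply: filterS ff => x h Dx; apply: cvg_EFin; [exact: nearW|exact: h].
- by apply: aeW => x n Dx; rewrite lee_fin fg.
- have fin := integrable_fin_num mD iF.
  by move: h; rewrite -(fineK fin) => /fine_cvg.
Qed.

End dct.

(** * A one-sided approximate identity *)

Section kernel.
Context {R : realType}.
Notation mu := (@lebesgue_measure R).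
Implicit Types (g : R -> R) (t : R).

(** The derivative of [step ((k + 1) t - 1)], of mass 1. The shift by 1 makes this cutoff vanish for
    [t <= 1 / (k + 1)], which will keep test functions away from the boundary. Estimates use a sup
    bound, not a sign. *)
Definition kap (k : nat) t : R := k.+1%:R * dstep (k.+1%:R * t - 1).

Let c0 k : 0 < k.+1%:R :> R. Proof. by []. Qed.

Lemma kap_out (k : nat) t : ~ (0 < t < 2 / k.+1%:R) -> kap k t = 0.
Proof.
move=> h; rewrite /kap; have [t0|t0] := leP t 0.
  by rewrite dstep_0 ?mulr0//; have := c0 k; nra.
rewrite dstep_1 ?mulr0//.
have [t1|t1] := ltP t (2 / k.+1%:R); first by exfalso; apply: h; rewrite t0 t1.
by move: t1; rewrite ler_pdivrMr//; lra.
Qed.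

Lemma continuous_kap (k : nat) : continuous (kap k).
Proof.
move=> t; apply: cvgM; first exact: cvg_cst.
apply: (@continuous_comp _ _ _ (fun t => k.+1%:R * t - 1) (@dstep R)).
  apply: cvgB; last exact: cvg_cst.
  by apply: cvgM; [exact: cvg_cst|exact: cvg_id].
exact: continuous_dstep.
Qed.

Let J k := `[(0 : R), 2 / k.+1%:R]%classic.

Let mJ k : @measurable _ (measurableTypeR R) (J k).
Proof. exact: measurable_itv. Qed.

Let muJ k : mu (J k) = (2 / k.+1%:R)%:E.
Proof. by rewrite /J lebesgue_measure_itv /= lte_fin divr_gt0// oppr0 adde0. Qed.

Let restrict_kap g k : (fun t => g t * kap k t) = (fun t => g t * kap k t) \_ (J k).
Proof.
apply/funext => t; rewrite patchE; case: ifPn => // /negP tJ.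
rewrite kap_out ?mulr0// => /andP[t0 t1]; apply: tJ.
by rewrite inE /J /= in_itv /= !ltW.
Qed.

Let integrable_J g (M : R) k : measurable_fun setT g -> (forall t, `|g t| <= M) ->
  mu.-integrable (J k) (EFin \o (fun t => g t * kap k t)).
Proof.
move=> mg gM.
have iM : mu.-integrable (J k) (EFin \o (fun t => M * `|kap k t|)).
  apply: continuous_compact_integrable; first exact: segment_compact.
  apply/continuous_subspaceT => t; apply: cvgM; first exact: cvg_cst.
  by apply: cvg_norm; exact: continuous_kap.
apply: (le_integrable (mJ k) _ _ iM).
  apply/measurable_EFinP; apply: measurable_funM.
    exact: measurable_funTS.
  by apply: measurable_funTS; apply: continuous_measurable_fun; exact: continuous_kap.
move=> t _; rewrite /= lee_fin (normrM (g t)) (normrM M) normr_id; apply: ler_wpM2r => //.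
by rewrite (le_trans (gM t))// ler_norm.
Qed.

Lemma integrable_kap g (M : R) k : measurable_fun setT g -> (forall t, `|g t| <= M) ->
  mu.-integrable setT (EFin \o (fun t => g t * kap k t)).
Proof.
move=> mg gM; rewrite restrict_kap -restrict_EFin.
by apply/(integrable_mkcond _ (mJ k)); exact: integrable_J gM.
Qed.

Let Rintegral_J g k :
  \int[mu]_t (g t * kap k t) = \int[mu]_(t in J k) (g t * kap k t).
Proof. by rewrite [RHS]Rintegral_mkcond -restrict_kap. Qed.

(** A height of at most [e * (k + 1) * L] over an interval of length [2 / (k + 1)]: the dependence
    on [k] cancels. *)
Let bound_J (a : R -> R) (L e : R) k : 0 <= e -> (forall t, `|dstep t| <= L) ->
  mu.-integrable (J k) (EFin \o a) ->
  (forall t, J k t -> `|a t| <= e * `|kap k t|) ->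
  `|\int[mu]_(t in J k) a t| <= 2 * L * e.
Proof.
move=> e0 dL ia ae.
have L0 : 0 <= L by apply: le_trans (dL 0).
apply: (le_trans (le_normr_Rintegral (mJ k) ia)).
apply: (@le_trans _ _ (\int[mu]_(t in J k) (e * (k.+1%:R * L)))).
  apply: (le_Rintegral (mJ k)).
  - have := integrable_abse ia; by apply: eq_integrable.
  - apply: continuous_compact_integrable; first exact: segment_compact.
    by apply/continuous_subspaceT => t; exact: cvg_cst.
  - move=> t Jt; rewrite (le_trans (ae _ Jt))// ler_wpM2l// normrM ger0_norm//.
    by rewrite ler_wpM2l.
rewrite (Rintegral_cst _ (mJ k)).
rewrite [X in _ * X](congr1 fine (muJ k)) /=.
have ck := c0 k; rewrite le_eqVlt; apply/orP; left; apply/eqP; field.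
by rewrite gt_eqF.
Qed.

(** The bound is uniform in [k]; it supplies the dominating function when the layers are integrated
    along the face. *)
Lemma kap_bound : exists2 L : R, 0 <= L & forall g (M : R) k,
  measurable_fun setT g -> (forall t, `|g t| <= M) ->
  `|\int[mu]_t (g t * kap k t)| <= L * M.
Proof.
have [L L0 dL] := @dstep_bounded R; exists (2 * L); first by rewrite mulr_ge0.
move=> g M k mg gM; rewrite Rintegral_J; apply: bound_J => //.
- exact: le_trans (gM 0).
- exact: integrable_J gM.
- by move=> t _; rewrite (normrM (g t)) ler_wpM2r.
Qed.

Let kap_mass k : \int[mu]_(t in J k) kap k t = 1.
Proof.
have ck := c0 k.
pose F t : R := step (k.+1%:R * t - 1).
have dF t : is_derive t 1 F (kap k t).
  rewrite /kap mulrC.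
  have dl : is_derive t 1 (fun t : R => k.+1%:R * t - 1) k.+1%:R.
    have dm : is_derive t 1 (fun t : R => k.+1%:R * t) (k.+1%:R : R).
      have := @is_derive_mulr R k.+1%:R t.
      rewrite (_ : (fun h : R => _) = (fun t : R => k.+1%:R * t))//.
      by apply/funext => h; rewrite mulrC.
    by have := is_deriveB dm (is_derive_cst (1 : R) t 1); rewrite subr0.
  exact: (is_derive1_comp (f := @step R) (g := fun t => k.+1%:R * t - 1) (is_derive_step _) dl).
have cF : continuous F.
  by move=> t; apply/differentiable_continuous/derivable1_diffP; case: (dF t).
have F1 : F (2 / k.+1%:R) = 1.
  by rewrite /F step_1// mulrCA divff ?mulr1 ?gt_eqF//; lra.
have F0 : F 0 = 0 by rewrite /F step_0// mulr0; lra.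
have := @continuous_FTC2 R (kap k) F 0 (2 / k.+1%:R).
rewrite /Rintegral => ->.
- by rewrite F1 F0 /= subr0.
- by rewrite divr_gt0.
- exact/continuous_subspaceT/continuous_kap.
- split.
  + by move=> t _; case: (dF t).
  + exact/cvg_at_right_filter/cF.
  + exact/cvg_at_left_filter/cF.
- by move=> t _; rewrite derive1E; case: (dF t).
Qed.

(** Only a limit from the right is required of [g]: it will be a function on [T] extended by 0,
    which may jump across the face, while [kap] lives on positive [t]. *)
Lemma kap_cvg g (M l : R) : measurable_fun setT g -> (forall t, `|g t| <= M) ->
  (forall e : R, 0 < e -> exists2 dl : R, 0 < dl & forall t, 0 < t < dl -> `|g t - l| <= e) ->
  \int[mu]_t (g t * kap k t) @[k --> \oo] --> l.
Proof.
move=> mg gM gl; have [L L0 dL] := @dstep_bounded R.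
apply/cvgrPdist_le => e e0.
pose e' := e / (2 * L + 1).
have L1 : 0 < 2 * L + 1 by lra.
have e'0 : 0 < e' by rewrite divr_gt0.
have [dl dl0 hdl] := gl _ e'0.
near=> k; rewrite distrC Rintegral_J.
have ck : 2 / k.+1%:R < dl.
  rewrite ltr_pdivrMr// mulrC -ltr_pdivrMr//; near: k.
  by apply: filterS (nbhs_infty_gtr (2 / dl)) => n h; rewrite (lt_trans h)// ltr_nat.
have mc : measurable_fun setT (fun _ : R => l) by [].
have ig := integrable_J k mg gM.
have il := integrable_J k mc (fun=> lexx `|l|).
have -> : \int[mu]_(t in J k) (g t * kap k t) - l =
    \int[mu]_(t in J k) (g t * kap k t - l * kap k t).
  rewrite (RintegralB (mJ k) ig il); congr (_ - _).
  rewrite (RintegralZl _ (mJ k)) ?kap_mass ?mulr1//.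
  apply: continuous_compact_integrable; first exact: segment_compact.
  exact/continuous_subspaceT/continuous_kap.
apply: (@le_trans _ _ (2 * L * e')).
  apply: bound_J => //; first exact: ltW.
    by have := integrableB (mJ k) ig il.
  move=> t Jt; rewrite -mulrBl (normrM (g t - l)).
  have [t0|/negP t0] := boolP (0 < t < 2 / k.+1%:R); last by rewrite kap_out// normr0 !mulr0.
  rewrite ler_wpM2r// hdl//; case/andP: t0 => -> /= t1.
  exact: lt_trans t1 ck.
by rewrite /e' mulrCA ger_pMr// ler_pdivrMr//; lra.
Unshelve. all: by end_near. Qed.

End kernel.

Lemma within_continuous_near {R : realType} (V : topologicalType) (D : set V)
    (h : V -> R) x (e : R) : {within D, continuous h} -> D x -> 0 < e ->
  \forall y \near x, D y -> `|h y - h x| <= e.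
Proof.
move=> ch Dx e0.
have : h @ within D (nbhs x) --> h x by rewrite nbhs_subspace_in//; exact: ch.
move=> /cvgrPdist_le /(_ e e0).
by apply: filterS => y; rewrite distrC.
Qed.

Section layer.
Context {R : realType}.
Implicit Types (x y z : vec3 R) (s : vec2 R).
Notation leb := (@lebesgue_measure R).

(* The layer k.+1^-1 <= level <= 2 / k.+1 along the inner side of a face
   collapses to the face as k tends to infinity. *)
Lemma layer_cvg (T : set (vec3 R)) (g : face R) x0 (r : R) (h : vec3 R -> R) :
  closed T -> bounded_set T -> {within T, continuous h} -> 0 < r ->
  (forall y, ball x0 r y -> 0 <= level g y -> T y) ->
  (forall y, ball x0 r y -> level g y = 0 -> fregion g y) ->
  (forall s, pregion (fpolygon g) s -> T (fpoint g s)) ->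
  (forall y, ~ ball x0 r y -> \forall z \near y, h z = 0) ->
  \int[mu3]_(x in T) (h x * kap k (level g x)) @[k --> \oo] -->
  \int[mu2]_(s in fpolygon g) h (fpoint g s).
Proof.
move=> cT bT ch r0 Tpos Tzero PT h0.
have mT := closed_measurable3 cT.
have mP : @measurable _ (vec2m R) (fpolygon g).
  by apply: closed_measurable2; exact: polygon_closed.
pose hT := h \_ T.
have mh : @measurable_fun _ _ (vec3m R) _ T h by exact: continuous_measurable3.
have mhT : @measurable_fun _ _ (vec3m R) _ setT hT.
  exact: (measurable_restrictT _ mT).1.
have [M M0 hM] : exists2 M : R, 0 <= M & forall y, `|hT y| <= M.
  have [M [_ hM]] := compact_bounded (continuous_compact ch (compact_vec3 cT bT)).
  exists (`|M| + 1) => [|y]; first by rewrite addr_ge0.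
  rewrite /hT patchE; case: ifPn => [|_]; last by rewrite normr0 addr_ge0.
  rewrite inE => Ty; apply: hM; last by exists y.
  by rewrite (le_lt_trans (ler_norm _))// ltrDl.
(* Since [T] is bounded, its planar coordinates stay in a fixed ball; outside it the inner integrals
   vanish, which makes a constant on this ball an integrable dominating function. *)
have [rho rho0 hrho] : exists2 rho : R, 0 < rho &
    forall s (t : R), hT (frame_point g (s, t)) != 0 -> ball 0 rho s.
  have cp : {within T, continuous (plane_coord g)}.
    exact/continuous_subspaceT/continuous_plane_coord.
  have /bounded_ball[rho rho0 hr] :=
    compact_bounded (continuous_compact cp (compact_vec3 cT bT)).
  exists rho => // s t; rewrite /hT patchE; case: ifPn => [|_]; last by rewrite eqxx.
  rewrite inE => Ty _; apply: hr; exists (frame_point g (s, t)) => //.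
  by rewrite /plane_coord frame_pointK.
pose E k (z : vec3 R) : R := hT (frame_point g z) * kap k z.2.
have pf := preserves_frame g.
have ckl k : continuous (fun y => kap k (level g y)).
  move=> y; apply: (@continuous_comp _ _ _ (level g) (kap k)).
    exact: continuous_level.
  exact: continuous_kap.
have iT k : (@mu3 R).-integrable T (EFin \o (fun y => h y * kap k (level g y))).
  apply: integrable_within3 => //.
  move=> y; apply: (@cvgM R (subspace T) (nbhs (y : subspace T)) _ h (fun y => kap k (level g y))).
    exact: ch.
  exact: continuous_subspaceT (ckl k) y.
have patchE' k : (fun y => h y * kap k (level g y)) \_ T =
    (fun y => hT y * kap k (level g y)).
  by apply/funext => y; rewrite /hT !patchE; case: ifP; rewrite ?mul0r.
have iE k : (@mu3 R).-integrable setT (EFin \o E k).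
  have := (integrable_mkcond _ mT).1 (iT k).
  rewrite restrict_EFin patchE' => /(preserves_integrable pf).
  by congr (integrable _ _ _); apply/funext => z; rewrite /= level_frame.
have EI k : \int[mu3]_(x in T) (h x * kap k (level g x)) = \int[mu3]_z E k z.
  rewrite Rintegral_mkcond patchE' -(preserves_Rintegral pf).
    by apply: eq_Rintegral => z _; rewrite /E level_frame.
  have := measurable_int _ ((integrable_mkcond _ mT).1 (iT k)).
  by rewrite restrict_EFin patchE' => /measurable_EFinP.
pose f k s : R := \int[leb]_t (hT (frame_point g (s, t)) * kap k t).
have mgs s : measurable_fun setT (fun t : measurableTypeR R => hT (frame_point g (s, t))).
  apply: (measurableT_comp mhT); apply: (measurableT_comp pf.1).
  exact: pair1_measurable.
have ifs k s : leb.-integrable setT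
    (EFin \o (fun t => hT (frame_point g (s, t)) * kap k t)).
  exact: (integrable_kap k (mgs s) (fun t => hM _)).
have fE k s : (f k s)%:E = (\int[leb]_t (E k (s, t))%:E)%E.
  by rewrite /f /Rintegral fineK//; apply: integrable_fin_num => //; exact: ifs.
have mf k : @measurable_fun _ _ (vec2m R) _ setT (f k).
  apply/measurable_EFinP.
  have := @measurable_fubini_F _ _ _ _ R (@mu2 R) leb (EFin \o E k) (iE k).
  by congr (measurable_fun _ _); apply/funext => s; rewrite /= fE.
have EF k : \int[mu3]_z E k z = \int[mu2]_s f k s.
  have := @integral12_prod_meas1 _ _ _ _ R (@mu2 R) leb (EFin \o E k) (iE k).
  move=> e; congr fine; rewrite -[LHS]e.
  by apply: eq_integral => s _; rewrite /= fE.
under eq_fun do rewrite EI EF.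
(* Off the polygon the integrand is 0: in the ball a plane point of [T] would belong to the face,
   and outside the ball [h] vanishes. *)
have -> : \int[mu2]_(s in fpolygon g) h (fpoint g s) = \int[mu2]_s hT (fpoint g s).
  rewrite Rintegral_mkcond; apply: eq_Rintegral => s _.
  rewrite /hT !patchE; case: ifPn => [|/negP nP].
    by rewrite inE => Ps; rewrite mem_set//; exact: PT.
  case: ifPn => // _; apply/esym.
  have [Bs|/h0/nbhs_singleton//] := pselect (ball x0 r (fpoint g s)).
  have [s' Ps' e] := Tzero _ Bs (level_fpoint g s).
  by exfalso; apply: nP; rewrite inE -(fpointK g s) -e fpointK.
have [L L0 hL] := @kap_bound R.
have mB : @measurable _ (vec2m R) (ball (0 : vec2 R) rho).
  exact: (open_measurable2 (ball_open (0 : vec2 R) rho)).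
have mB2 : (mu2 (ball (0%R : vec2 R) rho) < +oo)%E by rewrite mu2_ball ?ltry// ltW.
apply: (@Rintegral_dct R _ (vec2m R) (@mu2 R) setT f (fun s => hT (fpoint g s))
  ((fun=> L * M) \_ (ball (0 : vec2 R) rho))).
- exact: measurableT.
- exact: mf.
- apply: (measurableT_comp mhT).
  rewrite (_ : fpoint g = frame_point g \o (fun s => (s, 0))).
    apply: (measurableT_comp pf.1); exact: pair2_measurable.
  by apply/funext => s; rewrite fpointE.
- apply: aeW => s _; rewrite /f.
  apply: (@kap_cvg _ _ M) => [|t|e e0]; [exact: mgs|exact: hM|].
  have cst : continuous (fun t : R => frame_point g (s, t)).
    move=> t; apply: continuous_comp; last exact: continuous_frame_point.
    exact: (cvg_pair (@cvg_cst _ s _ (nbhs t) _) (@cvg_id _ (nbhs t))).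
  (* In the ball, points at small positive height lie in [T] by [Tpos], so continuity within [T]
     gives the limit; outside the ball [h] is 0 nearby. *)
  have [Bs|nB] := pselect (ball x0 r (fpoint g s)).
    have Ts : T (fpoint g s) by apply: Tpos => //; rewrite level_fpoint.
    have N : \forall t \near (0 : R), ball x0 r (frame_point g (s, t)).
      have B0 : nbhs (frame_point g (s, 0)) (ball x0 r).
        by rewrite -fpointE; apply: open_nbhs_nbhs; split => //; exact: ball_open.
      exact: (cst 0 _ B0).
    have C : \forall y \near fpoint g s, T y -> `|h y - h (fpoint g s)| <= e.
      exact: within_continuous_near.
    have C' : \forall t \near (0 : R), T (frame_point g (s, t)) ->
        `|h (frame_point g (s, t)) - h (fpoint g s)| <= e.
      have C0 : nbhs (frame_point g (s, 0))
        [set y | T y -> `|h y - h (fpoint g s)| <= e] by rewrite -fpointE; exact: C.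
      exact: (cst 0 _ C0).
    have /nbhs_ballP[dl /= dl0 hdl] : \forall t \near (0 : R),
        ball x0 r (frame_point g (s, t)) /\ (T (frame_point g (s, t)) ->
        `|h (frame_point g (s, t)) - h (fpoint g s)| <= e).
      by near=> t; split; near: t.
    exists dl => // t /andP[t0 tdl].
    have /hdl[Bt ht] : ball (0 : R) dl t by rewrite /ball /= sub0r normrN gtr0_norm.
    have Tt : T (frame_point g (s, t)).
      by apply: Tpos => //; rewrite level_frame ltW.
    by rewrite /hT !patchE !mem_set//; exact: ht.
  have Z : \forall t \near (0 : R), h (frame_point g (s, t)) = 0.
    have Z0 : nbhs (frame_point g (s, 0)) [set y | h y = 0].
      by rewrite -fpointE; exact: h0.
    exact: (cst 0 _ Z0).
  have [dl /= dl0 hdl] := (nbhs_ballP _ _).1 Z.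
  exists dl => // t /andP[t0 tdl].
  have /hdl ht : ball (0 : R) dl t by rewrite /ball /= sub0r normrN gtr0_norm.
  have hs : h (fpoint g s) = 0 by exact: nbhs_singleton (h0 _ nB).
  by rewrite /hT !patchE ht hs !if_same subrr normr0 ltW.
- rewrite -restrict_EFin; apply/(integrable_mkcond _ mB).
  apply: measurable_bounded_integrable; [exact: mB|exact: mB2|exact: measurable_cst|].
  by exists (`|L * M|); split=> // y yM x _; apply: ltW.
- move=> k s _; rewrite patchE; case: ifPn => [_|/negP sB].
    exact: hL (mgs s) (fun t => hM _).
  rewrite /f (_ : (fun t => _) = fun=> 0).
    by rewrite Rintegral_cst// mul0r normr0.
  apply/funext => t; apply/eqP; rewrite mulf_eq0; apply/orP; left.
  apply/negPn/negP => ht; apply: sB; rewrite inE; exact: hrho ht.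
Unshelve. all: by end_near. Qed.

End layer.

Section green_local.
Context {R : realType}.
Implicit Types (x y z : vec3 R) (s : vec2 R) (eta psi : vec3 R -> R).

Lemma continuous_grad eta : Cn 1 eta -> continuous (grad eta).
Proof.
move=> Ce x; have c (i : 'I_3) := Cn_continuous (Cn_derive i Ce).
exact: (cvg_pair (cvg_pair (c ord0 x) (c (Ordinal (isT : 1 < 3)%N) x)) (c ord_max x)).
Qed.

Lemma gradM eta psi x : Cn 1 eta -> Cn 1 psi ->
  grad (fun y => eta y * psi y) x = eta x *: grad psi x + psi x *: grad eta x.
Proof.
move=> Ce Cp.
have d (i : 'I_3) := deriveM (@Cn_derivable R 0 eta x i Ce) (@Cn_derivable R 0 psi x i Cp).
by apply: vec3P; rewrite !vecE /grad /=;
  [exact: (d ord0)|exact: (d (Ordinal (isT : 1 < 3)%N))|exact: (d ord_max)].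
Qed.

Lemma gradD eta psi x : Cn 1 eta -> Cn 1 psi ->
  grad (fun y => eta y + psi y) x = grad eta x + grad psi x.
Proof.
move=> Ce Cp.
have d (i : 'I_3) := deriveD (@Cn_derivable R 0 eta x i Ce) (@Cn_derivable R 0 psi x i Cp).
by apply: vec3P; rewrite !vecE /grad /=;
  [exact: (d ord0)|exact: (d (Ordinal (isT : 1 < 3)%N))|exact: (d ord_max)].
Qed.

Lemma grad_near0 eta x : (\forall y \near x, eta y = 0) -> grad eta x = 0.
Proof. by move=> e0; rewrite /grad !derive_near0. Qed.

Lemma integrableM_within (D : set (vec3 R)) (F psi : vec3 R -> R) :
  closed D -> bounded_set D -> (@mu3 R).-integrable D (EFin \o F) ->
  {within D, continuous psi} ->
  (@mu3 R).-integrable D (EFin \o (fun x => F x * psi x)).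
Proof.
move=> cD bD iF cpsi; have mD := closed_measurable3 cD.
have [M [_ hM]] := compact_bounded (continuous_compact cpsi (compact_vec3 cD bD)).
have hM' x : D x -> `|psi x| <= `|M| + 1.
  by move=> Dx; apply: hM; [rewrite (le_lt_trans (ler_norm _))// ltrDl|exists x].
have iFM := integrableZr mD (`|M| + 1) iF.
apply: (le_integrable mD _ _ iFM).
  apply/measurable_EFinP; apply: measurable_funM; last exact: continuous_measurable3.
  by apply/measurable_EFinP; exact: (measurable_int _ iF).
move=> x Dx; rewrite /= lee_fin !normrM ler_wpM2l//.
by rewrite (le_trans (hM' _ Dx))// ler_norm.
Qed.

Lemma ae_mu3S (P Q : vec3 R -> Prop) : (forall x, P x -> Q x) ->
  {ae @mu3 R, forall x, P x} -> {ae @mu3 R, forall x, Q x}.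
Proof. by move=> PQ; apply: negligibleS => x nQ /PQ. Qed.

Lemma cutoff_cvg (D : set (vec3 R)) (F : vec3 R -> R) (psi : nat -> vec3 R -> R) :
  closed D -> (@mu3 R).-integrable D (EFin \o F) ->
  (forall k, continuous (psi k)) -> (forall k x, 0 <= psi k x <= 1) ->
  {ae @mu3 R, forall x, D x -> F x <> 0 -> \forall k \near \oo, psi k x = 1} ->
  \int[mu3]_(x in D) (F x * psi k x) @[k --> \oo] --> \int[mu3]_(x in D) F x.
Proof.
move=> cD iF cpsi psi01 aeq; have mD := closed_measurable3 cD.
have mF : @measurable_fun _ _ (vec3m R) _ D F.
  by apply/measurable_EFinP; exact: (measurable_int _ iF).
apply: (@Rintegral_dct R _ (vec3m R) (@mu3 R) D (fun k x => F x * psi k x) F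
  (fun x => `|F x|)).
- exact: mD.
- move=> k; apply: measurable_funM => //.
  by apply: continuous_measurable3 => //; exact: continuous_subspaceT.
- exact: mF.
- apply: ae_mu3S aeq => x hx Dx.
  have [F0|F0] := pselect (F x = 0).
    by rewrite F0; under eq_fun do rewrite mul0r; exact: cvg_cst.
  apply: cvg_near_cst; apply: filterS (hx Dx F0) => k ->.
  by rewrite mulr1.
- exact: integrable_norm iF.
- move=> k x _; rewrite normrM ler_piMr//.
  by have /andP[p0 p1] := psi01 k x; rewrite ger0_norm.
Qed.

(** The boundary lies in the planes of finitely many faces. The union is indexed by natural numbers,
    with empty terms from [nfaces T] on. *)
Lemma boundary_ae (T : polyhedron R) :
  {ae @mu3 R, forall x, tregion T x -> interior T x}.
Proof.
have pl i : (@mu3 R).-negligible [set x | level (tface T i) x = 0].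
  exists [set x | level (tface T i) x = 0]; split => //; last exact: plane_null.
  apply: closed_measurable3.
  apply: (preimage_closed (f := level (tface T i)) (D := [set t | t = 0])).
    by move=> x _; exact: continuous_level.
  exact: closed_eq.
have U : (@mu3 R).-negligible (\bigcup_k
    [set x | exists2 i : 'I_(nfaces T), val i = k & level (tface T i) x = 0]).
  apply: negligible_bigcup => k; have [kn|kn] := ltnP k (nfaces T).
    apply: negligibleS (pl (Ordinal kn)) => x [i ik].
    by rewrite (_ : i = Ordinal kn)//; exact: val_inj.
  have n0 : (@mu3 R).-negligible set0 by exact: negligible_set0.
  by apply: negligibleS n0 => x [i ik]; move: kn; rewrite -ik leqNgt ltn_ord.
apply: negligibleS U => x /= /not_implyP[Tx nTx].
have : (tregion T `\` interior T) x by [].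
rewrite polyhedron_boundary => -[i _ [s _ <-]]; exists (val i) => //.
by exists i => //; exact: level_fpoint.
Qed.

(** Reorients the frame so that the normal points into [T] and [level] is positive inside; both
    signs then reduce to one case. *)
Lemma inner_face (f : face R) (sigma : R) : sigma = 1 \/ sigma = -1 ->
  exists g : face R, [/\ fpolygon g = fpolygon f, forall s, fpoint g s = fpoint f s,
    fnormal g = (- sigma) *: fnormal f & forall y, level g y = - sigma * level f y].
Proof.
move=> s1; have [uu vv nn] := face_unit f; have [uv un vn] := face_orthogonal f.
have nn' : [/\ dot (fu f) (fu f) = 1, dot (fv f) (fv f) = 1 &
    dot ((- sigma) *: fnormal f) ((- sigma) *: fnormal f) = 1].
  by rewrite dotZl dotZr nn; split=> //; case: s1 => ->; ring.
have un' : [/\ dot (fu f) (fv f) = 0, dot (fu f) ((- sigma) *: fnormal f) = 0 &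
    dot (fv f) ((- sigma) *: fnormal f) = 0].
  by rewrite !dotZr un vn mulr0.
exists (Face (fpolygon f) (forigin f) nn' un'); split => //.
by move=> y; rewrite /level /= dotZr.
Qed.

Section fields.
Variables (T : polyhedron R) (W : vec3 R -> vec3 R) (G : vec3 R -> R).
Hypothesis cW : {within T, continuous W}.
Hypothesis iG : (@mu3 R).-integrable T (EFin \o G).
Hypothesis HG : forall phi, test_function (interior T) phi ->
  \int[mu3]_(x in T) (G x * phi x) = - \int[mu3]_(x in T) dot (W x) (grad phi x).
Variable sigma : 'I_(nfaces T) -> R.

(** Green's formula with [eta] isolated: for fixed [W] and [G] it is additive in [eta], hence can be
    localized. *)
Definition green_at eta :=
  \int[mu3]_(x in T) (G x * eta x) + \int[mu3]_(x in T) dot (W x) (grad eta x) =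
  \sum_i sigma i * \int[mu2]_(s in fpolygon (tface T i))
    (eta (fpoint (tface T i) s) *
     dot (W (fpoint (tface T i) s)) (fnormal (tface T i))).

Let cT : closed T := @polyhedron_closed R T.
Let bT : bounded_set T := @polyhedron_bounded R T.

Lemma within_dot_grad eta : Cn 1 eta ->
  {within T, continuous (fun x => dot (W x) (grad eta x))}.
Proof.
by move=> Ce; apply: within_continuous_dot => //; exact/continuous_subspaceT/continuous_grad.
Qed.

Lemma fregion_boundary i x : fregion (tface T i) x -> tregion T x /\ ~ interior T x.
Proof.
move=> fx; have : (\bigcup_j fregion (tface T j)) x by exists i.
by rewrite -polyhedron_boundary => -[].
Qed.

Lemma fpoint_T i s : pregion (fpolygon (tface T i)) s -> tregion T (fpoint (tface T i) s).
Proof. by move=> Ps; have [] := @fregion_boundary i (fpoint (tface T i) s); [exists s|]. Qed.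

Lemma test_functionI phi : (forall n, Cn n phi) ->
  closure [set x | phi x != 0] `<=` interior T -> test_function (interior T) phi.
Proof.
move=> Cphi sub; split=> //; apply: compact_vec3; first exact: closed_closure.
have [M [Mr hM]] := bT; exists M; split=> // y yM x /sub/interior_subset.
exact: hM.
Qed.

Lemma green_at_interior eta : (forall n, Cn n eta) ->
  closure [set x | eta x != 0] `<=` interior T -> green_at eta.
Proof.
move=> Ce sub; rewrite /green_at HG; last exact: test_functionI.
rewrite addNr big1// => i _; rewrite (_ : \int[_]_(_ in _) _ = 0) ?mulr0//.
rewrite -[RHS](mul0r (fine (mu2 (fpolygon (tface T i))))).
have mP : @measurable _ (vec2m R) (fpolygon (tface T i)).
  by apply: closed_measurable2; exact: polygon_closed.
rewrite -(Rintegral_cst _ mP); apply: eq_Rintegral => s; rewrite inE => Ps.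
have [->|e0] := eqVneq (eta (fpoint (tface T i) s)) 0; first by rewrite mul0r.
have [_] := @fregion_boundary i (fpoint (tface T i) s) (ex_intro2 _ _ s Ps erefl).
by case; apply: sub; exact: subset_closure.
Qed.

End fields.
End green_local.

Lemma within_continuous_comp {R : realType} (U V : topologicalType) (A : set U)
    (B : set V) (h : U -> V) (F : V -> R) : continuous h ->
  (forall x, A x -> B (h x)) -> {within B, continuous F} ->
  {within A, continuous (fun x => F (h x))}.
Proof.
move=> ch AB /subspace_continuousP cF; apply/subspace_continuousP => x Ax P.
move=> /(cF _ (AB _ Ax)); rewrite /= /nbhs /= /within /= => /ch.
move=> H; have H' : nbhs x (fun y => B (h y) -> P (F (h y))) := H.
suff : nbhs x (fun y => A y -> P (F (h y))) by [].
by apply: filterS H' => y hy Ay; apply: hy; exact: AB.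
Qed.

Section green_face.
Context {R : realType}.
Implicit Types (x y z : vec3 R) (s : vec2 R) (eta psi : vec3 R -> R).
Variables (T : polyhedron R) (W : vec3 R -> vec3 R) (G : vec3 R -> R).
Hypothesis cW : {within T, continuous W}.
Hypothesis iG : (@mu3 R).-integrable T (EFin \o G).
Hypothesis HG : forall phi, test_function (interior T) phi ->
  \int[mu3]_(x in T) (G x * phi x) = - \int[mu3]_(x in T) dot (W x) (grad phi x).
Variable sigma : 'I_(nfaces T) -> R.

Let cT : closed T := @polyhedron_closed R T.
Let bT : bounded_set T := @polyhedron_bounded R T.

Lemma integrable_flux i eta : continuous eta ->
  (@mu2 R).-integrable (fpolygon (tface T i)) (EFin \o (fun s =>
    eta (fpoint (tface T i) s) *
    dot (W (fpoint (tface T i) s)) (fnormal (tface T i)))).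
Proof.
move=> ce; apply: integrable_within2; [exact: polygon_closed|exact: polygon_bounded|].
apply: (@within_continuous_comp _ _ _ _ T (fpoint (tface T i))
  (fun x => eta x * dot (W x) (fnormal (tface T i)))).
- exact: continuous_fpoint.
- exact: fpoint_T.
- move=> x; apply: (@cvgM R (subspace T) (nbhs (x : subspace T)) _ eta
    (fun y => dot (W y) (fnormal (tface T i)))).
    exact: continuous_subspaceT ce x.
  by apply: within_continuous_dot => //; exact: continuous_subspaceT (@cst_continuous _ _ _).
Qed.

(** Testing the divergence against [eta * psi k] gives the identity [B]. Its left side is a layer
    integral tending to the flux, by [layer_cvg]; on the right [psi k] tends to 1 in the interior of
    [T]. *)
Lemma green_at_face i x0 (r : R) eta : 0 < r -> sigma i = 1 \/ sigma i = -1 ->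
  face_side i x0 r (sigma i) -> (forall n, Cn n eta) ->
  closure [set x | eta x != 0] `<=` ball x0 r -> green_at W G sigma eta.
Proof.
move=> r0 s1 side Ce supp; set f := tface T i.
have mT := closed_measurable3 cT.
have [g [gP gs gn gl]] := inner_face f s1; set nu := fnormal g.
have eta0 y : ~ ball x0 r y -> \forall z \near y, eta z = 0.
  move=> nb; have : nbhs y (~` closure [set x | eta x != 0]).
    apply: open_nbhs_nbhs; split; first exact/closed_openC/closed_closure.
    by move=> /supp.
  apply: filterS => z nz; apply/eqP/negPn/negP => ez; apply: nz.
  exact: subset_closure.
have Fpos y : ball x0 r y -> 0 < level g y -> interior T y.
  by move=> /side[+ _ _ _] gy; apply; move: gy; rewrite gl; lra.
have Fneg y : ball x0 r y -> level g y < 0 -> ~ tregion T y.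
  by move=> /side[_ + _ _] gy; apply; move: gy; rewrite gl; lra.
have Fzero y : ball x0 r y -> level g y = 0 -> frelint f y.
  move=> /side[_ _ + _] gy0; apply; move: gy0; rewrite gl.
  by case: s1 => ->; lra.
have Fother j y : ball x0 r y -> j != i -> ~ fregion (tface T j) y.
  by move=> /side[_ _ _ +] ji; apply.
pose psi (k : nat) y : R := step (k.+1%:R * level g y - 1).
pose dpsi k (j : 'I_3) y : R := dot nu (basis3 j) * kap k (level g y).
have psiE k : psi k = fun y => step (dot (k.+1%:R *: nu) y +
    (- k.+1%:R * dot (forigin g) nu - 1)).
  by apply/funext => y; rewrite /psi /level dotBl dotZl (dotC nu); congr step; ring.
have Cpsi n k : Cn n (psi k) by rewrite psiE; exact: Cn_step_dot.
have gpsi k y : grad (psi k) y = kap k (level g y) *: nu.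
  have d (j : 'I_3) : 'D_(basis3 j) (psi k) y = dot nu (basis3 j) * kap k (level g y).
    have := is_derive_comp_dot (a := k.+1%:R *: nu) (basis3 j) (is_derive_step
      (dot (k.+1%:R *: nu) y + (- k.+1%:R * dot (forigin g) nu - 1))).
    rewrite -psiE => -[_ ->].
    have -> : dot (k.+1%:R *: nu) y + (- k.+1%:R * dot (forigin g) nu - 1) =
        k.+1%:R * level g y - 1.
      by rewrite /level dotBl dotZl (dotC nu); ring.
    by rewrite dotZl /kap; ring.
  apply: vec3P; rewrite !vecE /grad /= mulrC.
  - by rewrite (d ord0) dotE /basis3 /=; ring.
  - by rewrite (d (Ordinal (isT : 1 < 3)%N)) dotE /basis3 /=; ring.
  - by rewrite (d ord_max) dotE /basis3 /=; ring.
pose phi k y := eta y * psi k y.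
have Cphi n k : Cn n (phi k) by exact: CnM.
have gphi k y : grad (phi k) y =
    (eta y * kap k (level g y)) *: nu + psi k y *: grad eta y.
  by rewrite gradM// gpsi scalerA.
(* The support lies in the ball and in the closed set [level g >= 1 / (k + 1)], which together are
   inside the interior of [T]. *)
have tphi k : test_function (interior T) (phi k).
  apply: test_functionI => //.
  have sub1 : closure [set x | phi k x != 0] `<=` closure [set x | eta x != 0].
    by apply: closure_subset => x /=; rewrite /phi mulf_eq0 negb_or => /andP[].
  have sub2 : closure [set x | phi k x != 0] `<=` [set x | k.+1%:R^-1 <= level g x].
    have cl : closed [set x | k.+1%:R^-1 <= level g x].
      apply: (preimage_closed (f := level g) (D := [set t | k.+1%:R^-1 <= t])).
        by move=> x _; exact: continuous_level.
      exact: closed_ge.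
    move: cl => /closure_id ->; apply: closure_subset => y /=.
    rewrite /phi mulf_eq0 negb_or => /andP[_]; apply: contraNT; rewrite -ltNge => gy.
    rewrite /psi step_0// subr_le0 mulrC -ler_pdivlMr// mul1r.
    exact: ltW.
  move=> x cx; apply: Fpos; first exact/supp/sub1.
  by apply: lt_le_trans (sub2 _ cx); rewrite invr_gt0.
(* The minus sign comes from [nu] being the inward normal, [- sigma i] times [fnormal f]. *)
pose h y := - (eta y * dot (W y) nu).
have ch : {within T, continuous h}.
  move=> x; apply: (@cvgN R _ (subspace T) (nbhs (x : subspace T))).
  apply: (@cvgM R (subspace T) (nbhs (x : subspace T)) _ eta (fun y => dot (W y) nu)).
    exact: continuous_subspaceT (Cn_continuous (Ce 0%N)) x.
  apply: within_continuous_dot => //; exact: continuous_subspaceT (@cst_continuous _ _ _).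
have psi01 k x : 0 <= psi k x <= 1 by rewrite step_ge0 step_le1.
have cpsi k : continuous (psi k) := Cn_continuous (Cpsi 0%N k).
have B k : \int[mu3]_(x in T) (h x * kap k (level g x)) =
    \int[mu3]_(x in T) (G x * eta x * psi k x) +
    \int[mu3]_(x in T) (dot (W x) (grad eta x) * psi k x).
  have i1 : (@mu3 R).-integrable T (EFin \o (fun x => h x * kap k (level g x))).
    apply: (integrableM_within (F := h)) => //; first exact: integrable_within3.
    apply: continuous_subspaceT => y; apply: (@continuous_comp _ _ _ (level g) (kap k)).
      exact: continuous_level.
    exact: continuous_kap.
  have i2 : (@mu3 R).-integrable T (EFin \o (fun x => dot (W x) (grad eta x) * psi k x)).
    apply: integrableM_within => //; last exact/continuous_subspaceT/cpsi.
    by apply: integrable_within3 => //; exact: within_dot_grad.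
  have := HG (tphi k).
  rewrite (_ : \int[mu3]_(x in T) dot (W x) (grad (phi k) x) =
      \int[mu3]_(x in T) (dot (W x) (grad eta x) * psi k x - h x * kap k (level g x))).
    rewrite RintegralB// => e.
    have -> : \int[mu3]_(x in T) (G x * eta x * psi k x) = \int[mu3]_(x in T) (G x * phi k x).
      by apply: eq_Rintegral => x _; rewrite /phi mulrA.
    by rewrite e; ring.
  by apply: eq_Rintegral => x _; rewrite gphi dotDr !dotZr /h; ring.
have lim1 : \int[mu3]_(x in T) (h x * kap k (level g x)) @[k --> \oo] -->
    \int[mu2]_(s in fpolygon g) h (fpoint g s).
  apply: (@layer_cvg R T g x0 r h) => //.
  - move=> y yb; rewrite le_eqVlt => /orP[/eqP/esym y0|/(Fpos _ yb)/interior_subset//].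
    by have [] := fregion_boundary (frelint_fregion (Fzero _ yb y0)).
  - by move=> y yb /Fzero => /(_ yb) /frelint_fregion [s Ps <-]; exists s; rewrite ?gP.
  - by move=> s; rewrite gP gs; exact: fpoint_T.
  - by move=> y /eta0; apply: filterS => z z0; rewrite /h z0 mul0r oppr0.
have psi1 x : ball x0 r x -> interior T x -> \forall k \near \oo, psi k x = 1.
  move=> xb Tx; have gx : 0 < level g x.
    have [//|gx|gx] := ltgtP 0 (level g x).
      by case: (Fneg _ xb gx); exact: interior_subset.
    by have [_ []] := fregion_boundary (frelint_fregion (Fzero _ xb (esym gx))).
  apply: filterS (nbhs_infty_gtr (2 / level g x)) => k hk; apply: step_1.
  suff : 2 < k.+1%:R * level g x by lra.
  by rewrite -ltr_pdivrMr// (lt_trans hk)// ltr_nat.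
have lim2 : \int[mu3]_(x in T) (G x * eta x * psi k x) +
    \int[mu3]_(x in T) (dot (W x) (grad eta x) * psi k x) @[k --> \oo] -->
    \int[mu3]_(x in T) (G x * eta x) + \int[mu3]_(x in T) dot (W x) (grad eta x).
  apply: cvgD; apply: cutoff_cvg => //.
  - apply: integrableM_within => //; exact: continuous_subspaceT (Cn_continuous (Ce 0%N)).
  - apply: ae_mu3S (boundary_ae T) => x Tx /Tx Tx' ex.
    have [xb|/eta0/nbhs_singleton e0] := pselect (ball x0 r x); first exact: psi1.
    by exfalso; apply: ex; rewrite e0 mulr0.
  - by apply: integrable_within3 => //; exact: within_dot_grad.
  - apply: ae_mu3S (boundary_ae T) => x Tx /Tx Tx' ex.
    have [xb|/eta0/grad_near0 e0] := pselect (ball x0 r x); first exact: psi1.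
    by exfalso; apply: ex; rewrite e0 dotC dot0l.
move: lim1; under eq_fun do rewrite B.
move=> /(cvg_unique (@Rhausdorff R) lim2); rewrite /green_at => ->.
rewrite (bigD1 i)//= big1 ?addr0 => [|j ji].
  rewrite gP -RintegralZl.
  - apply: eq_Rintegral => s _; rewrite /h gs /nu gn dotZr -/f; ring.
  - apply: closed_measurable2; exact: polygon_closed.
  - by apply: integrable_flux; exact: (Cn_continuous (Ce 0%N)).
rewrite (_ : \int[_]_(_ in _) _ = 0) ?mulr0//.
rewrite -[RHS](mul0r (fine (mu2 (fpolygon (tface T j))))).
have mP : @measurable _ (vec2m R) (fpolygon (tface T j)).
  by apply: closed_measurable2; exact: polygon_closed.
rewrite -(Rintegral_cst _ mP); apply: eq_Rintegral => s; rewrite inE => Ps.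
have [xb|/eta0/nbhs_singleton->] := pselect (ball x0 r (fpoint (tface T j) s)); last first.
  by rewrite mul0r.
by case: (Fother j _ xb ji); exists s.
Qed.

End green_face.

(* [compact_cover] asks for a pointed topological type, which products are not
   declared to be; near coverings along the filter of finite lists do not. *)
Lemma compact_finite_cover {R : realType} (V : pseudoMetricType R) (K : set V)
    (rho : V -> R) : compact K -> (forall x, K x -> 0 < rho x) ->
  exists2 l : seq V, forall x, x \in l -> K x &
    forall y, K y -> exists2 x, x \in l & ball x (rho x) y.
Proof.
move=> /compact_near_coveringP cK rho0.
pose F : set_system (seq V) :=
  [set A | exists l0 : seq V, forall l : seq V, {subset l0 <= l} -> A l].
have FF : Filter F.
  split.
  - by exists [::].
  - move=> A B [l1 h1] [l2 h2]; exists (l1 ++ l2) => l sub; split.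
      by apply: h1 => x xl; apply: sub; rewrite mem_cat xl.
    by apply: h2 => x xl; apply: sub; rewrite mem_cat xl orbT.
  - by move=> A B AB [l0 h]; exists l0 => l /h /AB.
pose P (l : seq V) y := exists2 x, x \in l /\ K x & ball x (rho x) y.
have [l0 hl0] : \forall l \near F, K `<=` P l.
  apply: cK => x Kx.
  exists (ball x (rho x), [set l : seq V | x \in l]).
    split; first exact: nbhsx_ballx (rho0 x Kx).
    by exists [:: x] => l; apply; exact: mem_head.
  by move=> [y l] [/= xy xl]; exists x.
exists [seq x <- l0 | `[< K x >]].
  by move=> x; rewrite mem_filter => /andP[/asboolP].
move=> y Ky; have [x [xl Kx] xy] := hl0 l0 (fun _ => id) y Ky.
by exists x => //; rewrite mem_filter xl andbT; apply/asboolP.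
Qed.

(** * From local to global, away from the edges *)

Section green_partition.
Context {R : realType}.
Implicit Types (x y z : vec3 R) (s : vec2 R) (eta psi : vec3 R -> R).
Variables (T : polyhedron R) (W : vec3 R -> vec3 R) (G : vec3 R -> R).
Hypothesis cW : {within T, continuous W}.
Hypothesis iG : (@mu3 R).-integrable T (EFin \o G).
Hypothesis HG : forall phi, test_function (interior T) phi ->
  \int[mu3]_(x in T) (G x * phi x) = - \int[mu3]_(x in T) dot (W x) (grad phi x).
Variable sigma : 'I_(nfaces T) -> R.
Hypothesis sigma1 : forall i, sigma i = 1 \/ sigma i = -1.
Hypothesis sigma_side : forall i s, interior (fpolygon (tface T i)) s ->
  exists2 r : R, 0 < r & face_side i (fpoint (tface T i) s) r (sigma i).

Let cT : closed T := @polyhedron_closed R T.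
Let bT : bounded_set T := @polyhedron_bounded R T.
Let mT := closed_measurable3 cT.

Lemma measurable_polygon (p : polygon R) : @measurable _ (vec2m R) p.
Proof. by apply: closed_measurable2; exact: polygon_closed. Qed.

Lemma green_atD eta psi : (forall n, Cn n eta) -> (forall n, Cn n psi) ->
  green_at W G sigma eta -> green_at W G sigma psi ->
  green_at W G sigma (fun x => eta x + psi x).
Proof.
move=> Ce Cp ge gp; rewrite /green_at.
have ce := Cn_continuous (Ce 0%N); have cp := Cn_continuous (Cp 0%N).
have -> : \int[mu3]_(x in T) (G x * (eta x + psi x)) =
    \int[mu3]_(x in T) (G x * eta x) + \int[mu3]_(x in T) (G x * psi x).
  rewrite -RintegralD//.
  - by apply: eq_Rintegral => x _; rewrite mulrDr.
  - by apply: integrableM_within => //; exact: continuous_subspaceT.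
  - by apply: integrableM_within => //; exact: continuous_subspaceT.
have -> : \int[mu3]_(x in T) dot (W x) (grad (fun x => eta x + psi x) x) =
    \int[mu3]_(x in T) dot (W x) (grad eta x) + \int[mu3]_(x in T) dot (W x) (grad psi x).
  rewrite -RintegralD//.
  - by apply: eq_Rintegral => x _; rewrite gradD// dotDr.
  - by apply: integrable_within3 => //; exact: within_dot_grad.
  - by apply: integrable_within3 => //; exact: within_dot_grad.
rewrite addrACA ge gp -big_split /=; apply: eq_bigr => i _; rewrite -mulrDr.
rewrite -RintegralD.
- by congr (_ * _); apply: eq_Rintegral => s _; rewrite mulrDl.
- exact: measurable_polygon.
- exact: integrable_flux.
- exact: integrable_flux.
Qed.

(** The gradient of [eta] is only known to vanish on the interior of [T]; the boundary is a null
    set. *)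
Lemma green_at0 eta : (forall n, Cn n eta) -> (forall x, tregion T x -> eta x = 0) ->
  green_at W G sigma eta.
Proof.
move=> Ce e0; rewrite /green_at.
have Z d (U : measurableType d) (m : {measure set U -> \bar R}) (D : set U) :
    measurable D -> \int[m]_(x in D) (0 : R) = 0.
  by move=> mD; rewrite Rintegral_cst// mul0r.
rewrite (_ : \int[mu3]_(x in T) (G x * eta x) = 0); last first.
  rewrite -[RHS](Z _ _ (@mu3 R) _ mT).
  by apply: eq_Rintegral => x; rewrite inE => Tx; rewrite e0// mulr0.
rewrite (_ : \int[mu3]_(x in T) dot (W x) (grad eta x) = 0).
  rewrite addr0 big1// => i _; rewrite (_ : \int[_]_(_ in _) _ = 0) ?mulr0//.
  rewrite -[RHS](Z _ _ (@mu2 R) _ (measurable_polygon (fpolygon (tface T i)))).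
  apply: eq_Rintegral => s; rewrite inE => Ps.
  by rewrite e0 ?mul0r//; exact: fpoint_T.
rewrite -[RHS](Z _ _ (@mu3 R) _ mT); congr fine.
apply: ae_eq_integral => //.
  apply/measurable_EFinP; apply: continuous_measurable3 => //.
  exact: within_dot_grad.
apply: ae_mu3S (boundary_ae T) => x Tx /Tx Tx'.
rewrite grad_near0; first by rewrite dotC dot0l.
have : nbhs x (interior T) by apply: open_nbhs_nbhs; split => //; exact: open_interior.
by apply: filterS => y /interior_subset /e0.
Qed.

(** The factor 4 leaves room for [bump]: it is 1 on the ball of radius [r], vanishes outside radius
    [2 r], and the closure of its support fits in the ball of radius [4 r]. *)
Definition good x (r : R) := 0 < r /\ forall eta, (forall n, Cn n eta) ->
  closure [set x | eta x != 0] `<=` ball x (4 * r) -> green_at W G sigma eta.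

Lemma good_interior x : interior T x -> exists r, good x r.
Proof.
move=> Tx; have : nbhs x (interior T).
  by apply: open_nbhs_nbhs; split => //; exact: open_interior.
move=> /nbhs_ballP[r /= r0 rT]; exists (r / 4); split; first by rewrite divr_gt0.
move=> eta Ce sub; apply: green_at_interior => //; apply: subset_trans sub _.
by rewrite mulrC divfK.
Qed.

Lemma good_face i x : frelint (tface T i) x -> exists r, good x r.
Proof.
move=> [s Ps <-]; have [r r0 side] := sigma_side Ps.
exists (r / 4); split; first by rewrite divr_gt0.
move=> eta Ce; rewrite mulrC divfK// => sub.
exact: (green_at_face cW iG HG r0 (sigma1 i) side).
Qed.

(** A partition of unity peeled off one ball at a time: [eta * b] is local, and [eta * (1 - b)]
    vanishes on the first ball, so the remaining balls cover where it is nonzero in [T]. *)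
Lemma green_at_seq (l : seq (vec3 R)) (rho : vec3 R -> R) eta :
  (forall x, x \in l -> good x (rho x)) -> (forall n, Cn n eta) ->
  (forall y, tregion T y -> eta y != 0 -> exists2 x, x \in l & ball x (rho x) y) ->
  green_at W G sigma eta.
Proof.
elim: l eta => [|x l IHl] eta gl Ce cov.
  apply: green_at0 => // y Ty; apply/eqP/negPn/negP => /(cov _ Ty)[x].
  by rewrite in_nil.
have [r0 gx] := gl x (mem_head _ _).
pose b := bump x (rho x).
have Cb n : Cn n b := bump_smooth x (rho x) n.
have C1 n : Cn n (fun y => eta y * b y) by exact: CnM.
have C2 n : Cn n (fun y => eta y * (1 - b y)).
  by apply: CnM => //; apply: CnB => //; exact: Cn_cst.
rewrite (_ : eta = fun y => eta y * b y + eta y * (1 - b y)); last first.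
  by apply/funext => y; ring.
apply: green_atD => //.
  apply: gx => // y cy; apply: contrapT => nb.
  have N := @nbhs_not_ball R x (2 * rho x) (4 * rho x) y _ nb.
  have [] := cy _ (N ltac:(lra)) => z [/= ez zb].
  by move: ez; rewrite /b bump_0// mulr0 eqxx.
apply: IHl => // [x' x'l|y Ty]; first by apply: gl; rewrite in_cons x'l orbT.
rewrite mulf_eq0 negb_or => /andP[ey by1].
have [x'] := cov _ Ty ey; rewrite in_cons => /orP[/eqP->|x'l] xy; last by exists x'.
by move: by1; rewrite /b bump_1// subrr eqxx.
Qed.

Lemma green_at_good eta : (forall n, Cn n eta) ->
  (forall x, tregion T x -> closure [set x | eta x != 0] x ->
    interior T x \/ exists i, frelint (tface T i) x) ->
  green_at W G sigma eta.
Proof.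
move=> Ce gx; pose K := tregion T `&` closure [set x | eta x != 0].
have cK : compact K.
  apply: (@subclosed_compact _ K T) => //.
  - apply: closedI => //; exact: closed_closure.
  - exact: compact_vec3.
  - by move=> x [].
have gK x : K x -> exists r, good x r.
  by move=> [Tx cx]; have [/good_interior|[i /good_face]] := gx x Tx cx.
pose rho x := if pselect (exists r, good x r) is left h then projT1 (cid h) else 1.
have rhoP x : K x -> good x (rho x).
  rewrite /rho => Kx; case: pselect => [h|nh]; last by case: nh; exact: gK.
  by case: (cid h).
have [l gl cov] : exists2 l : seq (vec3 R), forall x, x \in l -> K x &
    forall y, K y -> exists2 x, x \in l & ball x (rho x) y.
  apply: (compact_finite_cover cK) => x Kx; exact: (rhoP x Kx).1.
apply: (@green_at_seq l rho) => // [x /gl/rhoP//|y Ty ey].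
by apply: cov; split => //; exact: subset_closure.
Qed.

End green_partition.

(** * Cutoffs near the edges *)

Section cutoffs.
Context {R : realType}.
Implicit Types (x y z q : vec3 R) (chi : vec3 R -> R) (B : R).

Definition cutoff chi B := [/\ forall n, Cn n chi, forall x, 0 <= chi x <= 1 &
  forall i : 'I_3, (\int[mu3]_x (`|'D_(basis3 i) chi x|)%:E <= B%:E)%E].

Lemma measurable_derive chi (i : 'I_3) : Cn 1 chi ->
  @measurable_fun _ _ (vec3m R) _ setT (fun x => (`|'D_(basis3 i) chi x|)%:E).
Proof.
move=> Cc; apply/measurable_EFinP; apply: measurableT_comp => //.
apply: continuous_measurable3 => //; apply: continuous_subspaceT.
exact: Cn_continuous (Cn_derive i Cc).
Qed.

Lemma cutoff_cst1 : cutoff (fun=> 1) 0.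
Proof.
split; [by move=> n; exact: Cn_cst|by move=> x; rewrite ler01 lexx|move=> i].
by rewrite integral0_eq// => x _; rewrite derive_cst normr0.
Qed.

(** In the product rule each derivative is multiplied by a factor in [0, 1], so the L1 bounds add
    up. *)
Lemma cutoffM chi1 chi2 B1 B2 : cutoff chi1 B1 -> cutoff chi2 B2 ->
  cutoff (fun x => chi1 x * chi2 x) (B1 + B2).
Proof.
move=> [C1 c1 b1] [C2 c2 b2]; split.
- by move=> n; exact: CnM.
- move=> x; have /andP[? ?] := c1 x; have /andP[? ?] := c2 x.
  by rewrite mulr_ge0//= mulr_ile1.
move=> i; rewrite EFinD; apply: le_trans (leeD (b1 i) (b2 i)).
rewrite -ge0_integralD//; last 2 first.
- exact: measurable_derive.
- exact: measurable_derive.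
apply: ge0_le_integral => //.
- by apply: measurable_derive; exact: CnM.
- by apply: emeasurable_funD; exact: measurable_derive.
move=> x _; rewrite -EFinD lee_fin.
have := deriveM (@Cn_derivable R 0 chi1 x i (C1 1%N)) (@Cn_derivable R 0 chi2 x i (C2 1%N)).
rewrite -[chi1 * chi2]/(fun x => chi1 x * chi2 x) => ->; rewrite addrC.
have /andP[? ?] := c1 x; have /andP[? ?] := c2 x.
apply: (le_trans (ler_normD _ _)); rewrite !normrZ.
by apply: lerD; rewrite ger0_norm// ler_piMl.
Qed.

Lemma cutoff_prod (I : Type) (r : seq I) (F : I -> vec3 R -> R) B :
  (forall i, cutoff (F i) B) ->
  cutoff (fun x => \prod_(i <- r) F i x) ((size r)%:R * B).
Proof.
move=> cF; elim: r => [|i r IHr].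
  rewrite mul0r; under eq_fun do rewrite big_nil; exact: cutoff_cst1.
under eq_fun do rewrite big_cons.
by rewrite /= -natr1 mulrDl mul1r addrC; exact: cutoffM.
Qed.

Lemma cutoff_bump : exists2 C : R, 0 <= C & forall q (r : R), 0 < r ->
  cutoff (fun x => 1 - bump q r x) (C * r ^+ 2).
Proof.
have [K K0 hK] := @bump_derive_bounded R.
(* The derivative is at most [K / r] and vanishes off a cube of side [6 r], of volume [216 r^3]. *)
exists (K * 216); first by rewrite mulr_ge0.
move=> q r r0; have Cb n : Cn n (bump q r) := bump_smooth q r n.
split.
- by move=> n; apply: CnB => //; exact: Cn_cst.
- by move=> x; have := bump_ge0 q r x; have := bump_le1 q r x; lra.
move=> i.
have dE x : `|'D_(basis3 i) (fun x => 1 - bump q r x) x| = `|'D_(basis3 i) (bump q r) x|.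
  have := is_deriveB (is_derive_cst (1 : R) x (basis3 i))
    (derivableP (@Cn_derivable R 0 (bump q r) x i (Cb 1%N))).
  by rewrite sub0r => -[_ ->]; rewrite normrN.
under eq_integral do rewrite dE.
have mA : @measurable _ (vec3m R) (ball q (3 * r)) := open_measurable3 (ball_open q (3 * r)).
apply: (@le_trans _ _ (\int[mu3]_x ((K / r)%:E * (\1_(ball q (3 * r)) x)%:E))%E).
  apply: ge0_le_integral => //.
  - exact: measurable_derive.
  - apply: emeasurable_funM => //; apply/measurable_EFinP; exact: measurable_indic.
  - move=> x _; rewrite -EFinM lee_fin indicE.
    have [xq|xq] := boolP (x \in _); first by rewrite mulr1; exact: hK.
    rewrite bump_derive0 ?normr0 ?mulr0// => xb.
    by move/negP: xq; rewrite inE.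
rewrite ge0_integralZl//; last 2 first.
- by apply/measurable_EFinP; exact: measurable_indic.
- by rewrite lee_fin divr_ge0// ltW.
rewrite integral_indic// setIT.
have mE : (@mu3 R (ball q (3 * r)) = ((3 * r *+ 2) ^+ 3)%:E)%E.
  by apply: mu3_ball; rewrite mulr_ge0// ltW.
rewrite [X in (_ * X)%E]mE.
rewrite -EFinM lee_fin le_eqVlt; apply/orP; left; apply/eqP; field.
by rewrite gt_eqF.
Qed.

Let near_ordinal m (t : R) : 0 <= t <= m.+1%:R ->
  exists2 j : 'I_m.+1, True & `|t - j%:R| <= 1.
Proof.
elim: m => [|m IHm] /andP[t0 t1].
  by exists ord0 => //; rewrite subr0 ger0_norm.
have [tm|tm] := leP t m.+1%:R.
  have [|j _ hj] := IHm; first by rewrite t0.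
  by exists (widen_ord (leqnSn _) j).
exists ord_max => //=; rewrite ger0_norm; last by rewrite subr_ge0 ltW.
by rewrite lerBlDr addrC natr1.
Qed.

Definition segments (l : seq (vec3 R * vec3 R)) : set (vec3 R) :=
  [set x | exists2 e, e \in l & segment e.1 e.2 x].

Lemma segment_closed (V : normedModType R) (a b : V) : closed (segment a b).
Proof.
apply: compact_closed; first exact: norm_hausdorff.
apply: continuous_compact; last exact: segment_compact.
apply/continuous_subspaceT => t; apply: cvgD; first exact: cvg_cst.
by apply: cvgZr_tmp; exact: cvg_id.
Qed.

Lemma segments_closed l : closed (segments l).
Proof.
elim: l => [|e l IHl].
  rewrite (_ : segments _ = set0); first exact: closed0.
  by apply/seteqP; split=> // x [e].
rewrite (_ : segments _ = segment e.1 e.2 `|` segments l).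
  by apply: closedU; [exact: segment_closed|exact: IHl].
apply/seteqP; split=> x.
  by move=> [e']; rewrite in_cons => /orP[/eqP->|e'l] xe; [left|right; exists e'].
move=> [xe|[e' e'l xe]]; first by exists e => //; exact: mem_head.
by exists e' => //; rewrite in_cons e'l orbT.
Qed.

(* Segments have vanishing capacity: m + 1 balls of radius O(1/m) cover a
   segment, and each bump contributes O(m^-2) to the L1 norm of the gradient. *)
Lemma segments_cutoff l : exists (chi : nat -> vec3 R -> R) (B : R),
  [/\ forall m, cutoff (chi m) (B / m.+1%:R),
      forall m x, segments l x -> \forall y \near x, chi m y = 0 &
      forall x, ~ segments l x -> \forall m \near \oo, chi m x = 1].
Proof.
have [C C0 hC] := cutoff_bump.
(* Exceeds the length of every segment strictly, so balls of radius [L / (m + 1)] around equally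
   spaced centres cover each segment. *)
pose L : R := \sum_(e <- l) `|e.2 - e.1| + 1.
have S0 : 0 <= \sum_(e <- l) `|e.2 - e.1| by exact: sumr_ge0.
have L0 : 0 < L by rewrite ltr_wpDl.
(* The centres stop at [j = m]: the far endpoint is still within one step of the last one. *)
pose q m (e : vec3 R * vec3 R) (j : 'I_m.+1) := e.1 + (j%:R / m.+1%:R) *: (e.2 - e.1).
pose chi m x := \prod_(e <- l) \prod_(j < m.+1) (1 - bump (q m e j) (L / m.+1%:R) x).
exists chi, ((size l)%:R * (C * L ^+ 2)); split.
- move=> m; have m0 : 0 < m.+1%:R :> R by [].
  have r0 : 0 < L / m.+1%:R by rewrite divr_gt0.
  have := @cutoff_prod _ l (fun e x => \prod_(j < m.+1) (1 - bump (q m e j) (L / m.+1%:R) x))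
    (m.+1%:R * (C * (L / m.+1%:R) ^+ 2)).
  have -> : (size l)%:R * (m.+1%:R * (C * (L / m.+1%:R) ^+ 2)) =
      (size l)%:R * (C * L ^+ 2) / m.+1%:R by field; rewrite gt_eqF.
  apply => e.
  have := @cutoff_prod _ (index_enum 'I_m.+1)
    (fun j x => 1 - bump (q m e j) (L / m.+1%:R) x) (C * (L / m.+1%:R) ^+ 2).
  have -> : size (index_enum 'I_m.+1) = m.+1.
    by rewrite -[RHS]card_ord cardT enumT.
  by apply => j; exact: hC.
- move=> m x [e el [t]]; rewrite /= in_itv /= => /andP[t0 t1] xE.
  have m0 : 0 < m.+1%:R :> R by [].
  have r0 : 0 < L / m.+1%:R by rewrite divr_gt0.
  have [|j _ hj] := @near_ordinal m (t * m.+1%:R).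
    by rewrite mulr_ge0//= ler_piMl.
  have xq : ball (q m e j) (L / m.+1%:R) x.
    rewrite -ball_normE /= -xE /q opprD addrACA subrr add0r -scalerBl normrZ.
    have -> : j%:R / m.+1%:R - t = - (t * m.+1%:R - j%:R) / m.+1%:R by field; rewrite gt_eqF.
    rewrite normrM normrN normfV (gtr0_norm m0) mulrAC ltr_pM2r ?invr_gt0//.
    apply: (@le_lt_trans _ _ `|e.2 - e.1|); first by rewrite ler_piMl.
    rewrite /L (big_rem e)//= -addrA ltrDl ltr_wpDl//; exact: sumr_ge0.
  have : nbhs x (ball (q m e j) (L / m.+1%:R)).
    by apply: open_nbhs_nbhs; split => //; exact: ball_open.
  apply: filterS => y yq; apply/eqP; rewrite prodf_seq_eq0; apply/hasP.
  exists e => //=; rewrite prodf_seq_eq0; apply/hasP.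
  by exists j; rewrite ?mem_index_enum//= bump_1// subrr.
- move=> x nx; have : nbhs x (~` segments l).
    by apply: open_nbhs_nbhs; split => //; exact/closed_openC/segments_closed.
  move=> /nbhs_ballP[d /= d0 hd].
  (* From here on the bumps, of support radius [2 L / (m + 1)], do not reach [x], whose distance to
     the segments is at least [d]. *)
  apply: filterS (nbhs_infty_gtr (2 * L / d)) => m hm.
  have m0 : 0 < m.+1%:R :> R by [].
  have r0 : 0 < L / m.+1%:R by rewrite divr_gt0.
  rewrite /chi big_seq big1// => e el; rewrite big1// => j _.
  rewrite bump_0 ?subr0// => /ball_sym xq.
  apply: (hd (q m e j)); last first.
    exists e => //; exists (j%:R / m.+1%:R) => //=.
    by rewrite in_itv /= divr_ge0//= ler_pdivrMr// mul1r ler_nat ltnW.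
  apply: le_ball xq; rewrite mulrA ler_pdivrMr// [d * _]mulrC -ler_pdivrMr//.
  by rewrite ltW// (lt_trans hm)// ltr_nat.
Qed.

End cutoffs.

Section edges.
Context {R : realType}.
Implicit Types (x y z : vec3 R) (s a b : vec2 R).

(** A vertical segment lies in a line of measure 0; any other segment meets each vertical line in at
    most one point. *)
Lemma segment_null a b : @mu2 R (segment a b) = 0%E.
Proof.
have mS : @measurable _ (vec2m R) (segment a b).
  by apply: closed_measurable2; exact: segment_closed.
have [ab|ab] := eqVneq a.1 b.1.
  apply/eqP; rewrite -measure_le0.
  have mv : @measurable _ (vec2m R) ([set a.1] `*` setT) by exact: measurableX.
  have sub : segment a b `<=` [set a.1] `*` setT.
    by move=> _ [t _ <-] /=; rewrite -ab subrr scaler0 addr0.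
  apply: le_trans (@le_measure _ _ _ (@mu2 R) _ _ _ _ sub) _; rewrite ?inE//.
  have E : (@mu2 R ([set a.1] `*` setT) =
      lebesgue_measure [set a.1] * lebesgue_measure [set: R])%E.
    by apply: product_measure1E.
  by rewrite [X in (X <= _)%E]E lebesgue_measure_set1 mul0e.
rewrite -[LHS]/(\int[lebesgue_measure]_x (lebesgue_measure (xsection (segment a b) x)))%E.
apply: integral0_eq => x _.
pose t := (x - a.1) / (b.1 - a.1).
apply/eqP; rewrite -measure_le0.
have sub : xsection (segment a b) x `<=` [set a.2 + t * (b.2 - a.2)].
  move=> y; rewrite xsectionE /= => -[u _ /= [xE <-]].
  rewrite (_ : u = t)// /t -xE addrAC subrr add0r mulfK//.
  by rewrite subr_eq0 eq_sym.
apply: le_trans (@le_measure _ _ _ (@lebesgue_measure R) _ _ _ _ sub) _; rewrite ?inE//.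
- exact: measurable_xsection.
- by rewrite [X in (X <= _)%E]lebesgue_measure_set1.
Qed.

Lemma polygon_boundary_ae (p : polygon R) :
  {ae @mu2 R, forall s, pregion p s -> interior p s}.
Proof.
have n0 : (@mu2 R).-negligible set0 by exact: negligible_set0.
have U : forall l : seq (vec2 R * vec2 R),
    (@mu2 R).-negligible [set s | exists2 e, e \in l & segment e.1 e.2 s].
  elim=> [|e l IHl]; first by apply: negligibleS n0 => s [].
  have ne : (@mu2 R).-negligible (segment e.1 e.2).
    exists (segment e.1 e.2); split => //; last exact: segment_null.
    by apply: closed_measurable2; exact: segment_closed.
  apply: negligibleS (negligibleU ne IHl) => s [e'].
  by rewrite in_cons => /orP[/eqP->|e'l] se; [left|right; exists e'].
apply: negligibleS (U (pedges p)) => s /= /not_implyP[ps nps].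
have : (p `\` interior p) s by [].
by rewrite polygon_boundary.
Qed.

Lemma fpoint_segment (f : face R) a b (t : R) :
  fpoint f (a + t *: (b - a)) = fpoint f a + t *: (fpoint f b - fpoint f a).
Proof.
have E1 : (a + t *: (b - a)).1 = a.1 + t * (b.1 - a.1) by [].
have E2 : (a + t *: (b - a)).2 = a.2 + t * (b.2 - a.2) by [].
by apply: vec3P; rewrite /fpoint E1 E2 !vecE; ring.
Qed.

Definition skeleton (T : polyhedron R) : seq (vec3 R * vec3 R) :=
  flatten [seq [seq (fpoint (tface T i) e.1, fpoint (tface T i) e.2) |
    e <- pedges (fpolygon (tface T i))] | i <- enum 'I_(nfaces T)].

Lemma skeletonP (T : polyhedron R) x : segments (skeleton T) x <->
  exists i, exists2 s, (fpolygon (tface T i) `\` interior (fpolygon (tface T i))) s &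
    fpoint (tface T i) s = x.
Proof.
split=> [[e /flatten_mapP[i _ /mapP[e' e'p ->]] [t t01 <-]]|[i [s]]].
  exists i; exists (e'.1 + t *: (e'.2 - e'.1)); last exact: fpoint_segment.
  by rewrite polygon_boundary; exists e' => //; exists t.
rewrite polygon_boundary => -[e ep [t t01 <-]] <-.
exists (fpoint (tface T i) e.1, fpoint (tface T i) e.2); last first.
  by exists t => //; rewrite fpoint_segment.
by apply/flatten_mapP; exists i; [rewrite mem_enum|apply/mapP; exists e].
Qed.

Lemma interior_skeleton (T : polyhedron R) x : interior T x -> ~ segments (skeleton T) x.
Proof.
move=> Tx /skeletonP[i [s [Ps _] sx]].
by have [] := @fregion_boundary R T i x; [exists s|].
Qed.

(** An edge of another face is excluded because relative interiors avoid the other faces; an edge of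
    the same face because its parametrization is injective. *)
Lemma frelint_skeleton (T : polyhedron R) i x : frelint (tface T i) x ->
  ~ segments (skeleton T) x.
Proof.
move=> fx /skeletonP[j [s [Ps nPs] sx]].
have [ij|ij] := eqVneq i j; last first.
  suff : (frelint (tface T i) `&` fregion (tface T j)) x by rewrite polyhedron_faces.
  by split=> //; exists s.
move: fx => [s' Ps' s'x]; apply: nPs.
by rewrite -(fpointK (tface T j) s) sx -s'x ij fpointK -ij.
Qed.

Lemma skeletonN (T : polyhedron R) x : tregion T x -> ~ segments (skeleton T) x ->
  interior T x \/ exists i, frelint (tface T i) x.
Proof.
move=> Tx nx; have [|nTx] := pselect (interior T x); [by left|right].
have : (tregion T `\` interior T) x by [].
rewrite polyhedron_boundary => -[i _ [s Ps sx]]; exists i; exists s => //.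
by apply: contrapT => nPs; apply: nx; apply/skeletonP; exists i; exists s.
Qed.

End edges.

Section green_formula.
Context {R : realType}.
Implicit Types (x y z : vec3 R) (s : vec2 R) (eta psi : vec3 R -> R).
Variables (T : polyhedron R) (W : vec3 R -> vec3 R) (G : vec3 R -> R).
Hypothesis cW : {within T, continuous W}.
Hypothesis iG : (@mu3 R).-integrable T (EFin \o G).
Hypothesis HG : forall phi, test_function (interior T) phi ->
  \int[mu3]_(x in T) (G x * phi x) = - \int[mu3]_(x in T) dot (W x) (grad phi x).
Variable sigma : 'I_(nfaces T) -> R.
Hypothesis sigma1 : forall i, sigma i = 1 \/ sigma i = -1.
Hypothesis sigma_side : forall i s, interior (fpolygon (tface T i)) s ->
  exists2 r : R, 0 < r & face_side i (fpoint (tface T i) s) r (sigma i).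

Let cT : closed T := @polyhedron_closed R T.
Let bT : bounded_set T := @polyhedron_bounded R T.
Let mT := closed_measurable3 cT.

(** The field is bounded on the compact [T], in the maximum norm; the factor 3 counts the partial
    derivatives. *)
Lemma dot_grad_bound : exists M : R, forall chi B, cutoff chi B ->
  `|\int[mu3]_(x in T) dot (W x) (grad chi x)| <= M * B.
Proof.
have [M [_ hM]] := compact_bounded (continuous_compact cW (compact_vec3 cT bT)).
have hM' x : tregion T x -> `|W x| <= `|M| + 1.
  by move=> Tx; apply: hM; [rewrite (le_lt_trans (ler_norm _))// ltrDl|exists x].
exists ((`|M| + 1) * 3) => chi B [Cchi _ bchi].
have id (i : 'I_3) : (@mu3 R).-integrable T (EFin \o (fun x => `|'D_(basis3 i) chi x|)).
  apply: integrable_within3 => //; apply: continuous_subspaceT => x.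
  by apply: cvg_norm; exact: (Cn_continuous (Cn_derive i (Cchi 1%N))).
have bd (i : 'I_3) : \int[mu3]_(x in T) `|'D_(basis3 i) chi x| <= B.
  rewrite -lee_fin fineK; last exact: (integrable_fin_num mT (id i)).
  apply: le_trans (bchi i); apply: ge0_subset_integral => //.
  exact: measurable_derive.
have iWg : (@mu3 R).-integrable T (EFin \o (fun x => dot (W x) (grad chi x))).
  by apply: integrable_within3 => //; exact: within_dot_grad.
apply: (le_trans (le_normr_Rintegral mT iWg)).
pose d (i : 'I_3) x := `|'D_(basis3 i) chi x|.
pose i1 : 'I_3 := Ordinal (isT : 1 < 3)%N.
have i01 := integrableD mT (id ord0) (id i1).
have i12 := integrableD mT i01 (id ord_max).
apply: (@le_trans _ _ (\int[mu3]_(x in T) ((`|M| + 1) * (d ord0 x + d i1 x + d ord_max x)))).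
  apply: le_Rintegral => //.
  - exact: integrable_norm iWg.
  - exact: integrableZl i12.
  - move=> x Tx; have := hM' x Tx; set N := `|M| + 1 => hN.
    have N0 : 0 <= N by rewrite (le_trans _ hN).
    have [h1 h2 h3] : [/\ `|(W x).1.1| <= N, `|(W x).1.2| <= N & `|(W x).2| <= N].
      by move: hN; rewrite !prod_normE /= !ge_max => /andP[/andP[-> ->] ->].
    rewrite dotE /grad /= !mulrDr.
    apply: (le_trans (ler_normD _ _)); apply: lerD; last by rewrite normrM ler_wpM2r.
    apply: (le_trans (ler_normD _ _)); apply: lerD; by rewrite normrM ler_wpM2r.
have -> : \int[mu3]_(x in T) ((`|M| + 1) * (d ord0 x + d i1 x + d ord_max x)) =
    (`|M| + 1) * (\int[mu3]_(x in T) d ord0 x + \int[mu3]_(x in T) d i1 x +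
      \int[mu3]_(x in T) d ord_max x).
  rewrite (RintegralZl _ mT i12); congr (_ * _).
  rewrite (RintegralD mT i01 (id ord_max)); congr (_ + _).
  exact: RintegralD mT (id ord0) (id i1).
rewrite -mulrA ler_wpM2l ?addr_ge0//.
have b1 : \int[mu3]_(x in T) d ord_max x <= B := bd ord_max.
have b2 : \int[mu3]_(x in T) d i1 x <= B := bd i1.
have b3 : \int[mu3]_(x in T) d ord0 x <= B := bd ord0.
by apply: (le_trans (lerD (lerD b3 b2) b1)); rewrite le_eqVlt; apply/orP; left; apply/eqP; ring.
Qed.

(** The formula at [chi m] holds since these cutoffs vanish near the edges. As [m] grows, the
    gradient term is [O(1/m)]; the other terms converge by domination, the edges being negligible in
    each polygon. *)
Lemma green_formula : \int[mu3]_(x in T) G x =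
  \sum_i sigma i * \int[mu2]_(s in fpolygon (tface T i))
    dot (W (fpoint (tface T i) s)) (fnormal (tface T i)).
Proof.
have [chi [B [cchi chi0 chi1]]] := segments_cutoff (skeleton T).
have [M hM] := dot_grad_bound.
have Cc m n : Cn n (chi m) by have [] := cchi m.
have c01 m x : 0 <= chi m x <= 1 by have [] := cchi m.
have cc m : continuous (chi m) := Cn_continuous (Cc m 0%N).
have gm m : green_at W G sigma (chi m).
  apply: green_at_good => // x Tx cx; apply: skeletonN => // sx.
  by have [y [/= /eqP cy /cy]] := cx _ (chi0 m x sx).
have L1 : \int[mu3]_(x in T) (G x * chi m x) @[m --> \oo] --> \int[mu3]_(x in T) G x.
  apply: cutoff_cvg => //; apply: ae_mu3S (boundary_ae T) => x Tx Tx' _.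
  by apply: chi1; apply: interior_skeleton; exact: Tx.
have L2 : \int[mu3]_(x in T) dot (W x) (grad (chi m) x) @[m --> \oo] --> 0.
  apply/norm_cvg0P.
  apply: (@squeeze_cvgr _ _ _ _ (cst 0) (fun m => M * (B / m.+1%:R))).
  - by apply: nearW => m /=; rewrite normr_ge0/=; exact: hM.
  - exact: cvg_cst.
  - rewrite -(mulr0 M) -(mulr0 B); apply: cvgM; first exact: cvg_cst.
    by apply: cvgM; [exact: cvg_cst|exact: cvg_harmonic].
have L3 : \sum_i sigma i * \int[mu2]_(s in fpolygon (tface T i))
      (chi m (fpoint (tface T i) s) *
       dot (W (fpoint (tface T i) s)) (fnormal (tface T i))) @[m --> \oo] -->
    \sum_i sigma i * \int[mu2]_(s in fpolygon (tface T i))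
      dot (W (fpoint (tface T i) s)) (fnormal (tface T i)).
  apply: cvg_big => [|i _]; first exact: add_continuous.
  apply: cvgM; first exact: cvg_cst.
  have if1 : (@mu2 R).-integrable (fpolygon (tface T i)) (EFin \o (fun s =>
      dot (W (fpoint (tface T i) s)) (fnormal (tface T i)))).
    have := integrable_flux cW i (eta := fun=> 1) (@cst_continuous (vec3 R) R 1).
    by under eq_fun do rewrite mul1r.
  apply: (@Rintegral_dct R _ (vec2m R) (@mu2 R) _ _ _
    (fun s => `|dot (W (fpoint (tface T i) s)) (fnormal (tface T i))|)).
  - exact: measurable_polygon.
  - by move=> m; apply/measurable_EFinP; exact: (measurable_int _ (integrable_flux cW i (cc m))).
  - by apply/measurable_EFinP; exact: (measurable_int _ if1).
  - apply: negligibleS (polygon_boundary_ae (fpolygon (tface T i))) => s ns Ps.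
    apply: ns => {}Ps'.
    have {}Ps := Ps Ps'.
    rewrite -[X in _ --> X]mul1r; apply: cvgM; last exact: cvg_cst.
    apply: cvg_near_cst; apply: chi1; apply: (@frelint_skeleton R T i).
    by exists s.
  - exact: integrable_norm if1.
  - move=> m s _; rewrite normrM ler_piMl//.
    by have /andP[p0 p1] := c01 m (fpoint (tface T i) s); rewrite ger0_norm.
move: L3; under eq_cvg do rewrite -gm; move=> L3.
rewrite -[LHS]addr0 -(cvg_lim (@norm_hausdorff _ R) L3).
by apply/esym/cvg_lim => //; exact: cvgD L1 L2.
Qed.

End green_formula.

(** * The commuting identity *)

Section commuting_diagram.
Context {R : realType}.
Implicit Types (x y z : vec3 R) (s : vec2 R).

Lemma Pdeg_leq n j j' (p : mpoly.mpoly n R) : (j <= j')%N -> Pdeg j p -> Pdeg j' p.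
Proof. by move=> jj' /leq_trans; apply. Qed.

Lemma continuous_ev3 (p : mpoly.mpoly 3 R) : continuous (ev3 p).
Proof. exact: Cn_continuous (ev3_smooth 0 p). Qed.

Lemma continuous_evV (p : vec3 (mpoly.mpoly 3 R)) : continuous (evV p).
Proof.
move=> x; exact: (cvg_pair (cvg_pair (@continuous_ev3 _ x) (@continuous_ev3 _ x))
  (@continuous_ev3 _ x)).
Qed.

Lemma continuous_ev2 (p : mpoly.mpoly 2 R) : continuous (ev2 p).
Proof.
elim/(@mpoly_ind_ring R 2): p.
- move=> c; rewrite (_ : ev2 _ = fun=> c); first exact: cst_continuous.
  by apply/funext => s; rewrite /ev2 mpoly.mevalC.
- move=> i; rewrite (_ : ev2 _ = fun s => coord2 s i); last first.
    by apply/funext => s; rewrite /ev2 mpoly.mevalXU.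
  move=> s; case: i => -[|[|//]] il; rewrite /coord2 /=.
    exact: cvg_fst.
  exact: cvg_snd.
- move=> p q cp cq; rewrite (_ : ev2 _ = fun s => ev2 p s + ev2 q s).
    by move=> s; apply: cvgD; [exact: cp|exact: cq].
  by apply/funext => s; rewrite /ev2 mpoly.mevalD.
- move=> p q cp cq; rewrite (_ : ev2 _ = fun s => ev2 p s * ev2 q s).
    by move=> s; apply: cvgM; [exact: cp|exact: cq].
  by apply/funext => s; rewrite /ev2 mpoly.mevalM.
Qed.

(** [|f| <= 1 + f^2], and [D] has finite measure. *)
Lemma L2_integrable (D : set (vec3 R)) (f : vec3 R -> R) :
  closed D -> bounded_set D -> L2 D f -> (@mu3 R).-integrable D (EFin \o f).
Proof.
move=> cD bD [mf if2]; have mD := closed_measurable3 cD.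
have i1 : (@mu3 R).-integrable D (EFin \o (fun=> 1 : R)).
  by apply: integrable_within3 => //; apply: continuous_subspaceT; exact: cst_continuous.
apply: (le_integrable mD _ _ (integrableD mD i1 if2)).
  by apply/measurable_EFinP; exact: mf.
move=> x Dx; rewrite /= lee_fin.
rewrite [leRHS]ger0_norm; last by rewrite addr_ge0// sqr_ge0.
by rewrite -[in leRHS]real_normK ?num_real//; have := normr_ge0 (f x); nra.
Qed.

Variables (T : polyhedron R) (k : nat) (w : vec3 R -> vec3 R).
Hypothesis cw : {within T, continuous w}.

Let cT : closed T := @polyhedron_closed R T.
Let bT : bounded_set T := @polyhedron_bounded R T.
Let mT := closed_measurable3 cT.

Let withinM (V : topologicalType) (D : set V) (f g : V -> R) :
  {within D, continuous f} -> {within D, continuous g} ->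
  {within D, continuous (fun t => f t * g t)}.
Proof. by move=> cf cg x; exact: (continuousM (cf x) (cg x)). Qed.

Let withinD (V : topologicalType) (D : set V) (f g : V -> R) :
  {within D, continuous f} -> {within D, continuous g} ->
  {within D, continuous (fun t => f t + g t)}.
Proof. by move=> cf cg x; exact: (continuousD (cf x) (cg x)). Qed.

Lemma projection3 (f : vec3 R -> R) j : {within T, continuous f} ->
  exists2 p : mpoly.mpoly 3 R, Pdeg j p & forall q, Pdeg j q ->
    \int[mu3]_(x in T) ((f x - ev3 p x) * ev3 q x) = 0.
Proof.
apply: (@mpoly_projection R _ (vec3m R) (@mu3 R) T mT
  (fun f => {within T, continuous f}) _ _ _ _ 3 (fun x => coord3 x)) => //.
- by move=> c; apply: continuous_subspaceT; exact: cst_continuous.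
- by move=> f1 f2; exact: withinD.
- by move=> f1 f2; exact: withinM.
- by move=> f1; exact: integrable_within3.
- by move=> p; apply: continuous_subspaceT; exact: continuous_ev3.
Qed.

Let within_coord (c : vec3 R -> R) (v : vec3 R -> vec3 R) : continuous c ->
  {within T, continuous v} -> {within T, continuous (fun x => c (v x))}.
Proof. by move=> cc cv x; exact: (@continuous_comp (subspace T) _ _ v c x (cv x) (cc _)). Qed.

(** The inner product of fields is a sum over coordinates, so the coordinates can be projected
    separately. This certifies that [xget] does not fall back on its default. *)
Lemma R0P : is_R0 T k w (R0 T k w).
Proof.
apply: xgetPex.
have c1 := within_coord continuous_x1 cw.
have c2 := within_coord continuous_x2 cw.
have c3 := within_coord continuous_x3 cw.
have [p1 d1 h1] := projection3 (k - 2) c1.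
have [p2 d2 h2] := projection3 (k - 2) c2.
have [p3 d3 h3] := projection3 (k - 2) c3.
exists (p1, p2, p3); split => // q [q1 q2 q3].
have i (f : vec3 R -> R) p r : {within T, continuous f} ->
    (@mu3 R).-integrable T (EFin \o (fun x => (f x - ev3 p x) * ev3 r x)).
  move=> cf; apply: integrable_within3 => //; apply: withinM; last first.
    by apply: continuous_subspaceT; exact: continuous_ev3.
  move=> x; apply: continuousB; first exact: cf.
  by apply: continuous_subspaceT; exact: continuous_ev3.
have i1 := i _ p1 q.1.1 c1; have i2 := i _ p2 q.1.2 c2; have i3 := i _ p3 q.2 c3.
have i12 := integrableD mT i1 i2.
transitivity (\int[mu3]_(x in T) (((w x).1.1 - ev3 p1 x) * ev3 q.1.1 x +
  ((w x).1.2 - ev3 p2 x) * ev3 q.1.2 x + ((w x).2 - ev3 p3 x) * ev3 q.2 x)).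
  by apply: eq_Rintegral => x _; rewrite dotE !vecE.
rewrite (RintegralD mT i12 i3) h3// addr0.
by rewrite (RintegralD mT i1 i2) h1// h2// addr0.
Qed.

Let within_wn i : {within fpolygon (tface T i), continuous
  (fun s => dot (w (fpoint (tface T i) s)) (fnormal (tface T i)))}.
Proof.
apply: (@within_continuous_comp _ _ _ _ T (fpoint (tface T i))
  (fun x => dot (w x) (fnormal (tface T i)))).
- exact: continuous_fpoint.
- exact: fpoint_T.
- by apply: within_continuous_dot => //; apply: continuous_subspaceT; exact: cst_continuous.
Qed.

Let fnormal1 i : dot (fnormal (tface T i)) (fnormal (tface T i)) = 1.
Proof. by have [] := face_unit (tface T i). Qed.

(** Since [fnormal] is a unit vector, the condition is that of the scalar projection of the normal
    component of [w]. *)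
Lemma RfP (i : 'I_(nfaces T)) : is_Rf k i (normal_part i w) (Rf k i (normal_part i w)).
Proof.
apply: xgetPex.
have cP := @polygon_closed R (fpolygon (tface T i)).
have bP := @polygon_bounded R (fpolygon (tface T i)).
have [p dp hp] : exists2 p : mpoly.mpoly 2 R, Pdeg (k - 3) p & forall q, Pdeg (k - 3) q ->
    \int[mu2]_(s in fpolygon (tface T i))
      ((dot (w (fpoint (tface T i) s)) (fnormal (tface T i)) - ev2 p s) * ev2 q s) = 0.
  apply: (@mpoly_projection R _ (vec2m R) (@mu2 R) (fpolygon (tface T i))
    (measurable_polygon _) (fun f => {within fpolygon (tface T i), continuous f}) _ _ _ _
    2 (fun s => coord2 s)) => //.
  - by move=> c; apply: continuous_subspaceT; exact: cst_continuous.
  - by move=> f1 f2; exact: withinD.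
  - by move=> f1 f2; exact: withinM.
  - by move=> f1; exact: integrable_within2.
  - by move=> p; apply: continuous_subspaceT; exact: continuous_ev2.
exists p; split => // q dq; rewrite -(hp q dq); apply: eq_Rintegral => s _.
by rewrite /normal_part /normal_field -scalerBl dotZl dotZr fnormal1 mulr1.
Qed.

Lemma outward_normal_edge (i : 'I_(nfaces T)) s :
  (fpolygon (tface T i) `\` interior (fpolygon (tface T i))) s ->
  outward_normal T (fpoint (tface T i) s) = 0.
Proof.
move=> Ps; apply: xgetPN => nu [_ [j fj _] _].
apply: (frelint_skeleton fj); apply/skeletonP; exists i.
by exists s.
Qed.

Lemma Rintegral_normal_trace (i : 'I_(nfaces T)) (sigma : R)
    (p q : mpoly.mpoly 2 R) (tau : mpoly.mpoly 3 R) :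
  (forall s, ev2 q s = ev3 tau (fpoint (tface T i) s)) ->
  (forall s, interior (fpolygon (tface T i)) s ->
    outward_normal T (fpoint (tface T i) s) = sigma *: fnormal (tface T i)) ->
  \int[mu2]_(s in fpolygon (tface T i))
    dot (normal_field i p s) (ev3 tau (fpoint (tface T i) s) *:
      outward_normal T (fpoint (tface T i) s)) =
  sigma * \int[mu2]_(s in fpolygon (tface T i)) (ev2 p s * ev2 q s).
Proof.
set P := fpolygon (tface T i) => qE nE.
have mP := measurable_polygon P.
have mI : @measurable _ (vec2m R) (interior P).
  by apply: open_measurable2; exact: open_interior.
have cpq : continuous (fun s => ev2 p s * ev2 q s).
  by move=> s; apply: cvgM; exact: continuous_ev2.
have ipq : (@mu2 R).-integrable P (EFin \o (fun s => ev2 p s * ev2 q s)).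
  apply: integrable_within2; [exact: polygon_closed|exact: polygon_bounded|].
  exact: continuous_subspaceT.
have mpq : @measurable_fun _ _ (vec2m R) _ P (fun s => sigma * (ev2 p s * ev2 q s)).
  apply: measurable_funM => //; apply/measurable_EFinP.
  exact: (measurable_int _ ipq).
rewrite -(RintegralZl _ mP ipq).
(* On the edges [outward_normal] takes its default 0 instead of [sigma *: fnormal]; the indicator
   records this and disappears almost everywhere. *)
transitivity (\int[mu2]_(s in P) (sigma * (ev2 p s * ev2 q s) * \1_(interior P) s)).
  apply: eq_Rintegral => s; rewrite inE => Ps; rewrite indicE.
  have [Is|Is] := pselect (interior P s).
    rewrite mem_set// mulr1 nE// /normal_field !dotZl !dotZr fnormal1 -qE; ring.
  rewrite memNset// mulr0 outward_normal_edge// scaler0 dotC; exact: dot0l.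
congr fine; apply: ae_eq_integral => //.
- apply/measurable_EFinP; apply: measurable_funM => //.
- exact/measurable_EFinP.
apply: negligibleS (polygon_boundary_ae P) => s ns Is; apply: ns => Ps.
by rewrite indicE mem_set ?mulr1//; exact: Is.
Qed.

Variable g : vec3 R -> R.
Hypothesis gw : is_divergence T w g.

Let ig : (@mu3 R).-integrable T (EFin \o g).
Proof. by apply: L2_integrable => //; have [] := gw. Qed.

Let cev3 (p : mpoly.mpoly 3 R) : {within T, continuous (ev3 p)}.
Proof. by apply: continuous_subspaceT; exact: continuous_ev3. Qed.

Let ev3_1 (p : mpoly.mpoly 3 R) : Cn 1 (ev3 p) := ev3_smooth 1 p.

(** If [phi] is a test function then so is [tau * phi]; hence [tau w] has distributional divergence
    [tau g + w . grad tau], and [green_formula] applies to this field. *)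
Lemma green_polynomial (tau : mpoly.mpoly 3 R) (sigma : 'I_(nfaces T) -> R) :
  (forall i, sigma i = 1 \/ sigma i = -1) ->
  (forall i s, interior (fpolygon (tface T i)) s ->
    exists2 r : R, 0 < r & face_side i (fpoint (tface T i) s) r (sigma i)) ->
  \int[mu3]_(x in T) (g x * ev3 tau x) +
    \int[mu3]_(x in T) dot (w x) (grad (ev3 tau) x) =
  \sum_i sigma i * \int[mu2]_(s in fpolygon (tface T i))
    (dot (w (fpoint (tface T i) s)) (fnormal (tface T i)) *
     ev3 tau (fpoint (tface T i) s)).
Proof.
move=> sigma1 sigma_side.
have igt : (@mu3 R).-integrable T (EFin \o (fun x => g x * ev3 tau x)).
  exact: integrableM_within.
have cwt : {within T, continuous (fun x => dot (w x) (grad (ev3 tau) x))}.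
  exact: within_dot_grad.
have iwt := integrable_within3 cT bT cwt.
have cW : {within T, continuous (fun x => ev3 tau x *: w x)}.
  by move=> x; apply: continuousZ; [exact: cev3|exact: cw].
rewrite -(RintegralD mT igt iwt).
rewrite (@green_formula R T (fun x => ev3 tau x *: w x) _ cW (integrableD mT igt iwt) _ sigma)//.
  apply: eq_bigr => i _; congr (_ * _); apply: eq_Rintegral => s _.
  by rewrite dotZl mulrC.
move=> phi tphi; have [Cphi _ sphi] := tphi.
have cphi : {within T, continuous phi} := continuous_subspaceT (Cn_continuous (Cphi 0%N)).
have Ctp n : Cn n (fun x => ev3 tau x * phi x).
  by apply: CnM => //; exact: ev3_smooth.
have ttp : test_function (interior T) (fun x => ev3 tau x * phi x).
  apply: test_functionI => //; apply: subset_trans sphi.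
  apply: closure_subset => x /=; apply: contraNN => /eqP ->.
  by rewrite mulr0.
have i1 : (@mu3 R).-integrable T (EFin \o (fun x => g x * (ev3 tau x * phi x))).
  by apply: integrableM_within => //; exact: withinM.
have i2 : (@mu3 R).-integrable T (EFin \o (fun x =>
    dot (w x) (grad (ev3 tau) x) * phi x)).
  exact: integrable_within3 cT bT (withinM cwt cphi).
have i3 : (@mu3 R).-integrable T (EFin \o (fun x =>
    dot (ev3 tau x *: w x) (grad phi x))).
  exact: integrable_within3 cT bT (within_dot_grad cW (Cphi 1%N)).
transitivity (\int[mu3]_(x in T) (g x * (ev3 tau x * phi x)) +
    \int[mu3]_(x in T) (dot (w x) (grad (ev3 tau) x) * phi x)).
  rewrite -(RintegralD mT i1 i2); apply: eq_Rintegral => x _.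
  by rewrite mulrDl mulrA.
have [_ ->//] := gw.
have -> : \int[mu3]_(x in T) dot (w x) (grad (fun x => ev3 tau x * phi x) x) =
    \int[mu3]_(x in T) dot (ev3 tau x *: w x) (grad phi x) +
    \int[mu3]_(x in T) (dot (w x) (grad (ev3 tau) x) * phi x).
  rewrite -(RintegralD mT i3 i2); apply: eq_Rintegral => x _.
  rewrite gradM// dotDr !dotZr dotZl; ring.
by rewrite opprD addrNK.
Qed.

Lemma weak_div_moment (tau : mpoly.mpoly 3 R) : W4 k tau ->
  (- \int[mu3]_(x in T) dot (evV (w0 (Rh3 T k w)) x) (grad (ev3 tau) x)) +
    boundary_ip (Rh3 T k w) tau = \int[mu3]_(x in T) (g x * ev3 tau x).
Proof.
move=> dtau.
have /choice[sigma hsigma] : forall i, exists sigma : R, (sigma = 1 \/ sigma = -1) /\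
    forall s, interior (fpolygon (tface T i)) s ->
    exists2 r : R, 0 < r & face_side i (fpoint (tface T i) s) r sigma.
  by move=> i; have [sigma ? ?] := face_sign i; exists sigma.
have sigma1 i := (hsigma i).1; have sigma_side i := (hsigma i).2.
have -> : \int[mu3]_(x in T) dot (evV (w0 (Rh3 T k w)) x) (grad (ev3 tau) x) =
    \int[mu3]_(x in T) dot (w x) (grad (ev3 tau) x).
  have [_ hR] := R0P.
  (* The gradient of [tau] is an admissible test field, so [w] and its projection have the same
     integral against it. *)
  pose q := (mpoly.mderiv ord0 tau, mpoly.mderiv (Ordinal (isT : 1 < 3)%N) tau,
       mpoly.mderiv ord_max tau).
  have dq : W30 k q.
    have k23 : (k - 3 <= k - 2)%N by rewrite leq_sub2l.
    by split; apply: (Pdeg_leq k23); exact: Pdeg_mderiv.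
  have i1 : (@mu3 R).-integrable T (EFin \o (fun x => dot (w x) (evV q x))).
    apply: integrable_within3 => //; apply: within_continuous_dot => //.
    by apply: continuous_subspaceT; exact: continuous_evV.
  have i2 : (@mu3 R).-integrable T (EFin \o (fun x => dot (evV (R0 T k w) x) (evV q x))).
    apply: integrable_within3 => //; apply: within_continuous_dot => //;
    by apply: continuous_subspaceT; exact: continuous_evV.
  have := hR q dq; under eq_Rintegral do rewrite dotBl.
  rewrite (RintegralB mT i1 i2) => /eqP; rewrite subr_eq0 => /eqP h.
  transitivity (\int[mu3]_(x in T) dot (evV (R0 T k w) x) (evV q x)).
    by apply: eq_Rintegral => x _; rewrite grad_ev3.
  by rewrite -h; apply: eq_Rintegral => x _; rewrite grad_ev3.
suff -> : boundary_ip (Rh3 T k w) tau = \sum_i sigma i *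
    \int[mu2]_(s in fpolygon (tface T i))
    (dot (w (fpoint (tface T i) s)) (fnormal (tface T i)) *
     ev3 tau (fpoint (tface T i) s)).
  by rewrite -(green_polynomial tau sigma1 sigma_side) addrCA addNr addr0.
apply: eq_bigr => i _.
(* The restriction [q] of [tau] to the face has degree at most [k - 3], hence is admissible for
   [Rf]. *)
have [q dq qE] := fpoint_poly (tface T i) dtau.
rewrite (Rintegral_normal_trace (sigma := sigma i) _ qE); last first.
  move=> s Is; have [r r0 side] := sigma_side i s Is.
  by apply: (outward_normal_side _ r0 (sigma1 i) side); exists s.
congr (_ * _).
have cP := @polygon_closed R (fpolygon (tface T i)).
have bP := @polygon_bounded R (fpolygon (tface T i)).
have mP := measurable_polygon (fpolygon (tface T i)).
have [_ /(_ q dq)] := RfP i.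
set p := Rf _ _ _ => H.
have cq (r : mpoly.mpoly 2 R) : {within fpolygon (tface T i), continuous (ev2 r)}.
  by apply: continuous_subspaceT; exact: continuous_ev2.
have i1 : (@mu2 R).-integrable (fpolygon (tface T i)) (EFin \o (fun s =>
    dot (w (fpoint (tface T i) s)) (fnormal (tface T i)) * ev2 q s)).
  by apply: integrable_within2 => //; apply: withinM.
have i2 : (@mu2 R).-integrable (fpolygon (tface T i)) (EFin \o (fun s =>
    ev2 p s * ev2 q s)).
  by apply: integrable_within2 => //; apply: withinM.
transitivity (\int[mu2]_(s in fpolygon (tface T i))
    (dot (w (fpoint (tface T i) s)) (fnormal (tface T i)) * ev2 q s)); last first.
  by apply: eq_Rintegral => s _; rewrite qE.
apply/esym/eqP; rewrite -subr_eq0 -(RintegralB mP i1 i2); apply/eqP.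
rewrite -[RHS]H; apply: eq_Rintegral => s _.
by rewrite -mulrBl /normal_part /normal_field -scalerBl dotZl dotZr fnormal1 mulr1.
Qed.

End commuting_diagram.

Theorem lemma5p3 (R : realType) (T : polyhedron R) (k : nat) (hk : (3 <= k)%N) :
  forall w : vec3 R -> vec3 R,
    Hdiv T w -> {within T, continuous w} ->
    weak_div (Rh3 T k w) = Rh4 T k (divergence T w).
Proof.
(* Both sides choose with [xget] and the same default, so it suffices that the two predicates have
   the same solutions. *)
move=> w [_ divw] cw; congr (xget 0 _).
have gw : is_divergence T w (divergence T w) by exact: xgetPex.
have cT := @polyhedron_closed R T; have bT := @polyhedron_bounded R T.
have mT := closed_measurable3 cT.
have ce (p : mpoly.mpoly 3 R) : {within T, continuous (ev3 p)}.
  by apply: continuous_subspaceT; exact: continuous_ev3.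
have split_moment d tau : \int[mu3]_(x in T) ((divergence T w x - ev3 d x) * ev3 tau x) =
    \int[mu3]_(x in T) (divergence T w x * ev3 tau x) -
    \int[mu3]_(x in T) (ev3 d x * ev3 tau x).
  have i1 : (@mu3 R).-integrable T (EFin \o (fun x => divergence T w x * ev3 tau x)).
    by apply: integrableM_within => //; apply: L2_integrable => //; have [] := gw.
  have i2 : (@mu3 R).-integrable T (EFin \o (fun x => ev3 d x * ev3 tau x)).
    by apply: integrableM_within => //; exact: integrable_within3.
  by rewrite -(RintegralB mT i1 i2); apply: eq_Rintegral => x _; rewrite mulrBl.
apply/seteqP; split=> d [dd hd]; split=> // tau dtau.
  by rewrite split_moment hd// (weak_div_moment cw gw)// subrr.
have /eqP := hd tau dtau; rewrite split_moment subr_eq0 => /eqP <-.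
by rewrite (weak_div_moment cw gw).
Qed.
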